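(* Let $n\ge1$, $\tau\geq 1$ an integer, and $1<p<\infty$. There exists a constant $C(\tau,n,p)$, depending only on $\tau$, $n$ and $p$ (and on the constant $C_0$ in the size condition defining the class), such that for every operator $T_\tau$ in the first class of Haar shift operators of index $\tau$ on $\mathbb{R}^n$, every $b\in BMO$ and every $w\in A_p$, $$\|[b,T_\tau]\|_{L^p(w)\to L^p(w)}\le C(\tau,n,p)\,[w]_{A_p}^{2\max\{1,\frac1{p-1}\}}\,\|b\|_{BMO}.$$
   Context: $\mathcal{D}^n$ is the collection of dyadic cubes in $\mathbb{R}^n$, $\mathcal{D}^n(Q)$ the collection of dyadic subcubes of $Q$ (including $Q$), $|Q|$ the volume of $Q$. A Haar function on a cube $Q$ is a function $H_Q$ such that: (1) $H_Q$ is supported on $Q$ and is constant on each of the $2^n$ dyadic children of $Q$; (2) $\|H_Q\|_\infty\le|Q|^{-1/2}$; (3) $\int H_Q=0$. An operator $T_\tau$ is in the first class of Haar shift operators of index $\tau$ if, for some choice of Haar functions $\{H_Q\}_{Q\in\mathcal{D}^n}$, $$T_\tau f(x)=\sum_{Q\in\mathcal{D}^n}\ \sum_{\substack{Q',Q''\in\mathcal{D}^n(Q)\\ 2^{-\tau n}|Q|\le|Q'|,|Q''|}}a_{Q',Q''}\langle f,H_{Q'}\rangle H_{Q''}(x),$$ where $\langle f,g\rangle=\int fg\,dx$ and the constants (which may depend on $Q$) satisfy the size condition $|a_{Q',Q''}|\le C_0\left(\frac{|Q'|}{|Q|}\cdot\frac{|Q''|}{|Q|}\right)^{1/2}$ with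 a fixed constant $C_0$. A weight is an a.e. positive locally integrable function $w$ on $\mathbb{R}^n$; $\|f\|_{L^p(w)}^p=\int|f|^pw\,dx$. With $\langle f\rangle_Q=\frac1{|Q|}\int_Qf$, $[w]_{A_p}=\sup_Q\langle w\rangle_Q\langle w^{-1/(p-1)}\rangle_Q^{p-1}$ and $\|b\|_{BMO}=\sup_Q\frac1{|Q|}\int_Q|b-\langle b\rangle_Q|\,dx$, suprema over all cubes $Q\subset\mathbb{R}^n$ with sides parallel to the axes; $w\in A_p$ and $b\in BMO$ mean these are finite. The commutator is $[b,T]f=bT(f)-T(bf)$, defined initially for bounded compactly supported $f$ and extended by boundedness. *)

(* Defs.v *)
From HB Require Import structures.
From mathcomp Require Import all_boot all_order all_algebra.
From mathcomp Require Import all_classical all_reals all_analysis.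

Set Implicit Arguments.
Unset Strict Implicit.
Unset Printing Implicit Defensive.

Import Order.TTheory GRing.Theory Num.Theory.
Import numFieldNormedType.Exports.

Local Open Scope classical_set_scope.
Local Open Scope ring_scope.

(* The library's sigma-algebra on tuples is the product (Borel) one. *)
Notation Rn R n := (n.-tuple (measurableTypeR R)).

Section lebesgue_Rn.
Local Open Scope ereal_scope.
Context {R : realType}.

Definition Rn_cons n (p : measurableTypeR R * Rn R n) : Rn R n.+1 :=
  [tuple of p.1 :: p.2].

Definition Rn_uncons n (x : Rn R n.+1) : measurableTypeR R * Rn R n :=
  (thead x, [tuple of behead x]).

Lemma Rn_consK n : cancel (@Rn_cons n) (@Rn_uncons n).
Proof. by move=> [x t]; congr pair; apply/val_inj. Qed.

Lemma Rn_unconsK n : cancel (@Rn_uncons n) (@Rn_cons n).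
Proof. by move=> x; rewrite [RHS]tuple_eta; apply/val_inj. Qed.

Lemma measurable_Rn_cons n : measurable_fun setT (@Rn_cons n).
Proof. exact: measurable_cons. Qed.

Lemma measurable_Rn_uncons n : measurable_fun setT (@Rn_uncons n).
Proof.
apply: measurable_fun_pair; last exact: measurable_behead.
exact: measurable_tnth.
Qed.

Section step.
Variables (n : nat) (m : {sigma_finite_measure set (Rn R n) -> \bar R}).

Definition lebesgue_succ : set (Rn R n.+1) -> \bar R :=
  pushforward (@lebesgue_measure R \x m) (@Rn_cons n).

Let preim_measurable A : measurable A -> measurable (@Rn_cons n @^-1` A).
Proof.
by move=> mA; rewrite -[X in measurable X]setTI; exact: measurable_Rn_cons.
Qed.

Let lebesgue_succ0 : lebesgue_succ set0 = 0.
Proof. by rewrite /lebesgue_succ /pushforward preimage_set0 measure0. Qed.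

Let lebesgue_succ_ge0 A : 0 <= lebesgue_succ A.
Proof. by rewrite /lebesgue_succ /pushforward measure_ge0. Qed.

Let lebesgue_succ_sigma_additive : semi_sigma_additive lebesgue_succ.
Proof.
move=> F mF tF mUF; rewrite /lebesgue_succ /pushforward preimage_bigcup.
apply: measure_semi_sigma_additive.
- by move=> k; apply: preim_measurable; exact: mF.
- move=> i j _ _ [x [Fi Fj]]; apply: (tF i j) => //.
  by exists (Rn_cons x).
- by rewrite -preimage_bigcup; apply: preim_measurable; exact: mUF.
Qed.

HB.instance Definition _ := isMeasure.Build _ _ _ lebesgue_succ
  lebesgue_succ0 lebesgue_succ_ge0 lebesgue_succ_sigma_additive.

Let lebesgue_succ_sigma_finite : sigma_finite setT lebesgue_succ.
Proof.
have /sigma_finiteP[F [TF ndF Foo]] := sigma_finiteT (@lebesgue_measure R).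
have /sigma_finiteP[G [TG ndG Goo]] := sigma_finiteT m.
exists (fun k => @Rn_uncons n @^-1` (F k `*` G k)).
  apply/seteqP; split => // x _.
  have [i _ Fi] : (\bigcup_i F i) (Rn_uncons x).1 by rewrite -TF.
  have [j _ Gj] : (\bigcup_j G j) (Rn_uncons x).2 by rewrite -TG.
  exists (maxn i j) => //; split.
    by move: Fi; exact/subsetPset/ndF/leq_maxl.
  by move: Gj; exact/subsetPset/ndG/leq_maxr.
move=> k; have [mF Fk] := Foo k; have [mG Gk] := Goo k; split.
  rewrite -[X in measurable X]setTI; apply: measurable_Rn_uncons => //.
  exact: measurableX.
rewrite /lebesgue_succ /pushforward.
rewrite (_ : _ @^-1` _ = F k `*` G k); last first.
  rewrite -comp_preimage (_ : _ \o _ = id) ?preimage_id//.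
  by apply/funext => p; exact: Rn_consK.
by rewrite product_measure1E// lte_mul_pinfty// ge0_fin_numE.
Qed.

HB.instance Definition _ := Measure_isSigmaFinite.Build _ _ _ lebesgue_succ
  lebesgue_succ_sigma_finite.

End step.

Fixpoint lebesgue_Rn n : {sigma_finite_measure set (Rn R n) -> \bar R} :=
  match n with
  | 0 => \d_([tuple] : Rn R 0)
  | n'.+1 => lebesgue_succ (lebesgue_Rn n')
  end.

(* Half-open, so that dyadic cubes of one generation tile R^n. *)
Definition box n (a b : Rn R n) : set (Rn R n) :=
  [set x | forall i, (tnth a i <= tnth x i < tnth b i)%R].

Lemma lebesgue_Rn_box n (a b : Rn R n) :
  (forall i, (tnth a i <= tnth b i)%R) ->
  lebesgue_Rn n (box a b) = (\prod_(i < n) (tnth b i - tnth a i))%:E.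
Proof.
elim: n a b => [|n IH] a b ab /=.
  by rewrite big_ord0 diracE mem_set//= => -[].
have mbox k (c d : Rn R k) : measurable (box c d).
  rewrite (_ : box c d = \bigcap_(i in setT)
      ((@tnth _ _ ^~ i) @^-1` `[tnth c i, tnth d i[%classic)); last first.
    apply/seteqP; split => x cdx i; first by move=> _ /=; rewrite in_itv/= cdx.
    by have /= := cdx i I; rewrite in_itv.
  apply: (@fin_bigcap_measurable _ (Rn R k)) => [|i _].
    exact: finite_finset.
  rewrite -[X in measurable X]setTI.
  apply: (@measurable_tnth _ (measurableTypeR R) k i measurableT).
  exact: measurable_itv.
rewrite /lebesgue_succ /pushforward.
have tnth_lift0 (c : Rn R n.+1) j :
    tnth c (lift ord0 j) = tnth [tuple of behead c] j.
  by rewrite [in LHS](tuple_eta c) tnthS.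
have -> : @Rn_cons n @^-1` box a b = `[thead a, thead b[%classic `*`
    box [tuple of behead a] [tuple of behead b].
  have tK x t : [tuple of behead (@Rn_cons n (x, t))] = t by apply/val_inj.
  apply/seteqP; split => [[x t] /= abx|[x t] /= [xab tab] i].
    split; first by have := abx ord0; rewrite /= in_itv.
    by move=> i; have := abx (lift ord0 i); rewrite !tnth_lift0 tK.
  have [j ->|->] := unliftP ord0 i; last by move: xab; rewrite in_itv.
  by have := tab j; rewrite !tnth_lift0 tK.
rewrite product_measure1E//; last exact: mbox.
rewrite IH => [|i]; last by have := ab (lift ord0 i); rewrite !tnth_lift0.
have := lebesgue_measure_itv `[thead a, thead b[; rewrite /= lte_fin => ->.
rewrite big_ord_recl EFinM; congr (_ * _).
  rewrite /thead; have := ab ord0; rewrite le_eqVlt => /predU1P[->|->//].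
  by rewrite ltxx subrr.
by congr EFin; apply: eq_bigr => i _; rewrite !tnth_lift0.
Qed.

End lebesgue_Rn.

Section weights.
Context {R : realType} {n : nat}.
Local Notation mu := (lebesgue_Rn n : {measure set (Rn R n) -> \bar R}).
Implicit Types (A Q : set (Rn R n)) (f g w b : Rn R n -> R) (p : R).

Definition cube (a : Rn R n) (l : R) : set (Rn R n) :=
  box a [tuple tnth a i + l | i < n].

Definition cubes : set (set (Rn R n)) :=
  [set Q | exists a, exists2 l, 0 < l & Q = cube a l].

Definition vol A : R := fine (mu A).

(* Extended-real valued: the average of a nonnegative f may be +oo. *)
Definition average f A : \bar R :=
  (((vol A)^-1)%:E * \int[mu]_(x in A) (f x)%:E)%E.

(* Every compact set is contained in a cube. *)
Definition loc_integrable f : Prop :=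
  measurable_fun setT f /\
  forall Q, cubes Q -> mu.-integrable Q (EFin \o f).

Definition weight w : Prop :=
  loc_integrable w /\ {ae mu, forall x, 0 < w x}.

Definition Ap_char p w : \bar R :=
  ereal_sup [set (average w Q *
    (average (fun x => w x `^ (- (p - 1)^-1))%R Q) `^ (p - 1)%R)%E | Q in cubes].

Definition Ap p w : Prop := weight w /\ (Ap_char p w < +oo)%E.

Definition BMO_norm b : \bar R :=
  ereal_sup
    [set average (fun x => `|b x - fine (average b Q)|) Q | Q in cubes].

Definition BMO b : Prop := loc_integrable b /\ (BMO_norm b < +oo)%E.

Definition Lpw_norm p w f : \bar R :=
  ((\int[mu]_x (`|f x| `^ p * w x)%:E) `^ p^-1%R)%E.

Definition bounded_compact_support f : Prop :=
  [/\ measurable_fun setT f,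
      exists M : R, forall x, `|f x| <= M &
      exists r : R, forall x, (exists i, r < `|tnth x i|) -> f x = 0].

(* g is the value at f of the extension of S, from bounded compactly supported
   functions to L^p(w), by continuity. *)
Definition extends_to p w (S : (Rn R n -> R) -> Rn R n -> R) f g : Prop :=
  [/\ measurable_fun setT f, measurable_fun setT g &
      exists u : nat -> Rn R n -> R,
        [/\ forall k, bounded_compact_support (u k),
            Lpw_norm p w (fun x => u k x - f x) @[k --> \oo] --> 0%E &
            Lpw_norm p w (fun x => S (u k) x - g x) @[k --> \oo] --> 0%E]].

Definition Lpw_opnorm p w (S : (Rn R n -> R) -> Rn R n -> R) : \bar R :=
  ereal_sup [set v | exists f g,
    [/\ extends_to p w S f g, (Lpw_norm p w f <= 1)%E & v = Lpw_norm p w g]].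

Definition commutator b (T : (Rn R n -> R) -> Rn R n -> R) f : Rn R n -> R :=
  fun x => b x * T f x - T (fun y => b y * f y) x.

End weights.

Section haar_shift.
Context (R : realType) (n : nat).
Local Notation mu := (lebesgue_Rn n : {measure set (Rn R n) -> \bar R}).

(* (k, m) stands for the cube of side 2^k with lower corner 2^k m. *)
Definition dyadic : Type := (int * n.-tuple int)%type.
Implicit Types Q : dyadic.

Definition dcube Q : set (Rn R n) :=
  cube [tuple 2 ^ Q.1 * (tnth Q.2 i)%:~R | i < n] (2 ^ Q.1).

Definition dvol Q : R := vol (dcube Q).

Definition subcubes Q : set dyadic := [set Q' | dcube Q' `<=` dcube Q].

Definition children Q : set dyadic :=
  [set Q' | subcubes Q Q' /\ Q'.1 = Q.1 - 1].

Definition haar_function Q (h : Rn R n -> R) : Prop :=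
  [/\ forall x, ~ dcube Q x -> h x = 0,
      forall Q', children Q Q' -> exists c, forall x, dcube Q' x -> h x = c,
      forall x, `|h x| <= (Num.sqrt (dvol Q))^-1 &
      (\int[mu]_x (h x)%:E = 0)%E].

Definition pairing (f g : Rn R n -> R) : R := \int[mu]_x (f x * g x).

Definition near_subcubes (tau : nat) Q : set dyadic :=
  [set Q' | subcubes Q Q' /\ 2 ^- (tau * n) * dvol Q <= dvol Q'].

Definition shift_block (tau : nat) (H : dyadic -> Rn R n -> R)
    (a : dyadic -> dyadic -> dyadic -> R) Q (f : Rn R n -> R) (x : Rn R n) : R :=
  \sum_(Q' \in near_subcubes tau Q) \sum_(Q'' \in near_subcubes tau Q)
    a Q Q' Q'' * pairing f (H Q') * H Q'' x.

(* The sum over all Q is the limit of the sums over the Q with side in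
   [2^-N, 2^N].  At each x such a sum has at most 2N+1 nonzero terms, one for
   each generation, and for f integrable with compact support the limit exists
   at almost every x. *)
Definition shift_series tau H a (f : Rn R n -> R) (x : Rn R n) : R :=
  limn (fun N : nat =>
    \sum_(Q \in [set Q | - N%:Z <= Q.1 <= N%:Z]) shift_block tau H a Q f x).

Definition haar_shift (tau : nat) (C0 : R)
    (T : (Rn R n -> R) -> Rn R n -> R) : Prop :=
  exists (H : dyadic -> Rn R n -> R) (a : dyadic -> dyadic -> dyadic -> R),
    [/\ forall Q, haar_function Q (H Q),
        forall Q Q' Q'', near_subcubes tau Q Q' -> near_subcubes tau Q Q'' ->
          `|a Q Q' Q''| <=
            C0 * Num.sqrt (dvol Q' / dvol Q * (dvol Q'' / dvol Q)) &
        forall f x, T f x = shift_series tau H a f x].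

End haar_shift.

(* Main.v *)
Require Import Defs.
From mathcomp Require Import all_boot all_order all_algebra.
From mathcomp Require Import all_classical all_reals all_analysis.
From mathcomp Require Import measurable_realfun zify ring lra.

(* Put [s = tau + 1].  The Haar functions in the block of a cube [Q] are constant on the
   descendants of [Q] that lie [s] generations below it, so the generations congruent to
   a given [j] modulo [s] form an operator on the [2^(s n)]-adic tree whose block at a
   node is a bounded kernel with zero row and column sums acting on the averages over
   the children.  On a finite such tree a stopping-time argument dominates the form
   [<[b,T] u, g>] by [||b|| sum <|u|>_P <|g|>_P] summed over a sparse family with the
   oscillations of [b] controlled by the number of members of the family above a leaf;
   for sparse operators the bound with the power [max(1, 1/(p-1))] of the A_p constant
   follows from Doob's inequality with respect to [w] and its dual weight, and two of
   them are composed here.  The trees are finite, so one discretizes the functions by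
   averages over cubes of a fixed generation and passes to the limit: weak type (1,1)
   and density give the almost everywhere convergence of the partial sums, and Fatou's
   lemma carries the bound to the limit. *)

Set Implicit Arguments.
Unset Strict Implicit.
Unset Printing Implicit Defensive.

Import Order.TTheory GRing.Theory Num.Theory.
Import numFieldNormedType.Exports.

Local Open Scope classical_set_scope.
Local Open Scope ring_scope.

(** The exponent [2 * ap_exp p] comes from the shape of the dominating form. Below a member of the
    family, [b] minus its average is at most [10 * M * beta] times the counting function, and
    integrating the counting function against [f] is integrating the sparse operator applied to [f].
    This takes the place of the John-Nirenberg inequality and leaves a product of two sparse
    operators, one on [u] and one on [g]. The first is estimated in L^p(w), the second in the dual
    space, each at the cost of one factor [D] to the power [ap_exp p].

    No constant depends on the depth of the tree. The obstacle in letting the depth grow is that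
    discretization does not commute with multiplication by [b]: on the tree, [b u] becomes a product
    of two averages. A mask on the generations keeps the operator fixed while the mesh shrinks, so
    the error consists of finitely many blocks applied to a function that is small in L^1.

    Where Hoelder's inequality would be expected, Young-type inequalities with a free parameter
    stand in for it; they lose only constants. *)

Section tree.
Context {R : realType} {I : finType}.
Hypothesis I_gt0 : (0 < #|I|)%N.
Local Notation M := (#|I|%:R : R).
Implicit Types (f g : seq I -> R) (k : nat) (c : I) (s : seq I).
Implicit Types (S : seq I -> bool).

(* Words of length [k] over [I] are the leaves of the complete [#|I|]-ary tree of
   depth [k]; the words below a node are read relative to it. *)
Definition sub {T} (f : seq I -> T) c : seq I -> T := fun s => f (c :: s).

Fixpoint avg k f : R :=
  if k is k'.+1 then M^-1 * \sum_c avg k' (sub f c) else f [::].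

Lemma M_ge1 : 1 <= M. Proof. by rewrite ler1n. Qed.
Lemma M_gt0 : 0 < M. Proof. by rewrite ltr0n. Qed.
Lemma MV_gt0 : 0 < M^-1. Proof. by rewrite invr_gt0 M_gt0. Qed.
Lemma MV_ge0 : 0 <= M^-1. Proof. exact/ltW/MV_gt0. Qed.
Let MVM : M^-1 * M = 1. Proof. by rewrite mulVf// gt_eqF// M_gt0. Qed.

Lemma le_mean (F G : I -> R) : (forall c, F c <= G c) ->
  M^-1 * \sum_c F c <= M^-1 * \sum_c G c.
Proof. by move=> FG; rewrite ler_wpM2l ?MV_ge0// ler_sum. Qed.

Lemma mean_cst (x : R) : M^-1 * \sum_(c : I) x = x.
Proof. by rewrite sumr_const -[x *+ _]mulr_natl mulrA MVM mul1r. Qed.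

Lemma meanD (F G : I -> R) : M^-1 * \sum_c (F c + G c) =
  M^-1 * \sum_c F c + M^-1 * \sum_c G c.
Proof. by rewrite big_split mulrDr. Qed.

Lemma meanZ a (F : I -> R) : M^-1 * \sum_c (a * F c) = a * (M^-1 * \sum_c F c).
Proof. by rewrite -mulr_sumr mulrCA. Qed.

Lemma meanB (F G : I -> R) : M^-1 * \sum_c (F c - G c) =
  M^-1 * \sum_c F c - M^-1 * \sum_c G c.
Proof. by rewrite sumrB mulrBr. Qed.

Lemma ler_norm_mean (F : I -> R) :
  `|M^-1 * \sum_c F c| <= M^-1 * \sum_c `|F c|.
Proof.
by rewrite normrM gtr0_norm ?MV_gt0// ler_wpM2l ?MV_ge0// ler_norm_sum.
Qed.

Lemma le_avg k f g : (forall s, size s = k -> f s <= g s) -> avg k f <= avg k g.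
Proof.
elim: k f g => [|k IH] f g fg /=; first exact: fg.
by apply: le_mean => c; apply: IH => s sk; apply: fg; rewrite /= sk.
Qed.

Lemma eq_avg k f g : (forall s, size s = k -> f s = g s) -> avg k f = avg k g.
Proof.
by move=> fg; apply/le_anti; rewrite !le_avg// => s sk; rewrite fg.
Qed.

Lemma avg_cst k (x : R) : avg k (fun=> x) = x.
Proof.
elim: k => //= k IH; rewrite -[RHS]mean_cst; congr (_ * _).
by apply: eq_bigr => c _; exact: IH.
Qed.

Lemma avgD k f g : avg k (fun s => f s + g s) = avg k f + avg k g.
Proof.
elim: k f g => //= k IH f g; rewrite -meanD; congr (_ * _).
by apply: eq_bigr => c _; rewrite -IH.
Qed.

Lemma avgZ k a f : avg k (fun s => a * f s) = a * avg k f.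
Proof.
elim: k f => //= k IH f; rewrite -meanZ; congr (_ * _).
by apply: eq_bigr => c _; rewrite -IH.
Qed.

Lemma avgN k f : avg k (fun s => - f s) = - avg k f.
Proof. by rewrite -mulN1r -avgZ; apply: eq_avg => s _; rewrite mulN1r. Qed.

Lemma avgB k f g : avg k (fun s => f s - g s) = avg k f - avg k g.
Proof. by rewrite avgD avgN. Qed.

Lemma avg_ge0 k f : (forall s, size s = k -> 0 <= f s) -> 0 <= avg k f.
Proof. by move=> f0; rewrite -(avg_cst k 0) le_avg. Qed.

Lemma ler_norm_avg k f : `|avg k f| <= avg k (fun s => `|f s|).
Proof.
rewrite ler_norml -avgN; apply/andP; split; apply: le_avg => s _.
  by rewrite lerNl -normrN ler_norm.
exact: ler_norm.
Qed.

Lemma avg_child_le k f c : (forall s, size s = k.+1 -> 0 <= f s) ->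
  avg k (sub f c) <= M * avg k.+1 f.
Proof.
move=> f0 /=; rewrite mulrA mulfV ?gt_eqF ?M_gt0// mul1r (bigD1 c)//= lerDl.
by apply: sumr_ge0 => d _; apply: avg_ge0 => s sk; rewrite f0//= sk.
Qed.

Lemma avg_gt0_mul k f g : (forall s, size s = k -> 0 <= f s) ->
  (forall s, size s = k -> 0 < g s) -> 0 < avg k f ->
  0 < avg k (fun s => g s * f s).
Proof.
elim: k f g => [|k IH] f g f0 g0 /=; first by move=> fp; rewrite mulr_gt0// g0.
rewrite !pmulr_rgt0 ?MV_gt0//.
have ge0 c : 0 <= avg k (sub f c) by apply: avg_ge0 => s sk; rewrite f0//= sk.
have ge0' c : 0 <= avg k (sub (fun s => g s * f s) c).
  by apply: avg_ge0 => s sk; rewrite mulr_ge0 ?f0 ?(ltW (g0 _ _))//= sk.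
move=> sp; have /psumr_neq0P[//|c /andP[_ fc]] : \sum_c avg k (sub f c) <> 0.
  by apply/eqP; rewrite gt_eqF.
rewrite (bigD1 c)//= ltr_pwDl ?sumr_ge0//.
by apply: (IH (sub f c) (sub g c)) => // s sk; rewrite ?f0 ?g0//= sk.
Qed.

(** * Sparse families *)

(** The proportion of the leaves that lie below some member of [S]. The recursion stops at the first
    member met, so nested members are not counted twice. *)
Fixpoint cov k S : R :=
  if S [::] then 1 else
  if k is k'.+1 then M^-1 * \sum_c cov k' (sub S c) else 0.

(** The members strictly below a member cover at most half of it; the half left free is what carries
    the weighted estimates. *)
Fixpoint sparse k S : Prop :=
  if k is k'.+1 then
    (S [::] -> M^-1 * \sum_c cov k' (sub S c) <= 2^-1) /\
    (forall c, sparse k' (sub S c))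
  else True.

(* Averages over the members of [S] above [s]; [S] selects nodes of the tree. *)
Fixpoint spsum k S f s : R :=
  (S [::])%:R * avg k f +
  (if k is k'.+1 then if s is c :: s' then spsum k' (sub S c) (sub f c) s'
   else 0 else 0).

Fixpoint spcount k S s : R :=
  (S [::])%:R +
  (if k is k'.+1 then if s is c :: s' then spcount k' (sub S c) s'
   else 0 else 0).

Lemma spsum_ge0 k S f s : (forall s, size s = k -> 0 <= f s) -> size s = k ->
  0 <= spsum k S f s.
Proof.
elim: k S f s => [|k IH] S f [|c s]//= f0.
  by move=> _; rewrite addr0 mulr_ge0// f0.
move=> [sk]; apply: addr_ge0.
  by apply: mulr_ge0 => //; exact: (@avg_ge0 k.+1).
by rewrite IH// => s' sk'; rewrite f0//= sk'.
Qed.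

(** Both sides sum the averages of [f] over the members of [S], weighted by the sizes of the
    members. This converts a pointwise bound by the counting function into a sparse operator. *)
Lemma avg_spcount k S f : 
  avg k (fun s => spcount k S s * f s) = avg k (spsum k S f).
Proof.
elim: k S f => [|k IH] S f; first by rewrite /= !addr0.
rewrite [LHS]/= [RHS]/= /sub/=.
rewrite (eq_bigr (fun c => (S [::])%:R * avg k (sub f c) +
    avg k (fun s => spcount k (sub S c) s * sub f c s))); last first.
  by move=> c _; rewrite -avgZ -avgD; apply: eq_avg => s _; rewrite mulrDl.
rewrite meanD meanZ.
rewrite [in RHS](eq_bigr (fun c => (S [::])%:R * (M^-1 * \sum_c avg k (sub f c)) +
    avg k (spsum k (sub S c) (sub f c)))); last first.
  by move=> c _; rewrite avgD avg_cst.
rewrite meanD mean_cst; congr (_ + _); congr (_ * _).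
by apply: eq_bigr => c _; rewrite IH.
Qed.

End tree.

(** * Sparse domination of the commutator on a finite tree *)
Section commutator_tree.
Context {R : realType} {I : finType}.
Hypothesis I_gt0 : (0 < #|I|)%N.
Local Notation M := (#|I|%:R : R).
Implicit Types (f g u b h : seq I -> R) (k : nat) (c : I) (s : seq I).
Implicit Types (kap : seq I -> I -> I -> R).

(* The block at a node acts through a kernel on the averages over its children. *)
Fixpoint mtrans k kap f s : R :=
  if k is k'.+1 then
    if s is c :: s' then
      M^-1 * (\sum_c' kap [::] c c' * avg k' (sub f c')) +
      mtrans k' (sub kap c) (sub f c) s'
    else 0
  else 0.

Definition kernel_bound (C : R) kap := [/\ forall s c c', `|kap s c c'| <= C,
  forall s c, \sum_c' kap s c c' = 0 & forall s c', \sum_c kap s c c' = 0].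

Lemma kernel_bound_sub C kap c : kernel_bound C kap -> kernel_bound C (sub kap c).
Proof. by case=> h1 h2 h3; split=> *; [exact: h1|exact: h2|exact: h3]. Qed.

Fixpoint bmo_tree k b (beta : R) : Prop :=
  avg k (fun s => `|b s - avg k b|) <= beta /\
  (if k is k'.+1 then forall c, bmo_tree k' (sub b c) beta else True).

Lemma mtransD k kap f g s :
  mtrans k kap (fun s => f s + g s) s = mtrans k kap f s + mtrans k kap g s.
Proof.
elim: k kap f g s => [|k IH] kap f g [|c s]/=; rewrite ?addr0//.
rewrite IH/=; set x := mtrans k _ _ s; set y := mtrans k _ _ s.
rewrite addrACA; congr (_ + _); rewrite -mulrDr -big_split/=; congr (_ * _).
by apply: eq_bigr => d _; rewrite -mulrDr; congr (_ * _); rewrite -avgD.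
Qed.

Lemma mtransZ k kap a f s :
  mtrans k kap (fun s => a * f s) s = a * mtrans k kap f s.
Proof.
elim: k kap f s => [|k IH] kap f [|c s]/=; rewrite ?mulr0//.
rewrite IH/= mulrDr; congr (_ + _); rewrite mulrCA; congr (_ * _).
by rewrite mulr_sumr; apply: eq_bigr => d _; rewrite mulrCA; congr (_ * _); rewrite -avgZ.
Qed.

Lemma eq_mtrans k kap f g s : (forall s, size s = k -> f s = g s) ->
  mtrans k kap f s = mtrans k kap g s.
Proof.
elim: k kap f g s => [|k IH] kap f g [|c s]//= fg; congr (_ * _ + _).
  apply: eq_bigr => d _; congr (_ * _).
  by apply: (eq_avg I_gt0) => s' s'k; rewrite /sub fg//= s'k.
by apply: IH => s' s'k; rewrite /sub fg//= s'k.
Qed.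

Definition mform k kap u h := avg k (fun s => mtrans k kap u s * h s).

Definition comform k kap u g b :=
  mform k kap u (fun s => b s * g s) - mform k kap (fun s => b s * u s) g.

Lemma mform_step k kap u h : mform k.+1 kap u h =
  M^-1 * (\sum_c M^-1 * \sum_c' kap [::] c c' * avg k (sub u c') * avg k (sub h c)) +
  M^-1 * \sum_c mform k (sub kap c) (sub u c) (sub h c).
Proof.
rewrite /mform [LHS]/= -meanD; congr (_ * _); apply: eq_bigr => c _.
rewrite -mulr_suml mulrA -avgZ -avgD; apply: (eq_avg I_gt0) => s _.
by rewrite /sub/= mulrDl.
Qed.

(** The commutator with a constant vanishes, so [b] may be recentred at the average over the node
    where a stopping argument starts. *)
Lemma comform_shift k kap u g b (b0 : R) :
  comform k kap u g b = comform k kap u g (fun s => b s - b0).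
Proof.
rewrite /comform /mform -!(avgB I_gt0); apply: (eq_avg I_gt0) => s _.
have -> : mtrans k kap (fun s => (b s - b0) * u s) s =
    mtrans k kap (fun s => b s * u s) s - b0 * mtrans k kap u s.
  rewrite -mulNr -mtransZ -mtransD; apply: eq_mtrans => s' _; ring.
ring.
Qed.

Definition vari (x : I -> R) := M^-1 * (\sum_c x c ^+ 2) - (M^-1 * \sum_c x c) ^+ 2.

Lemma vari_mean (x : I -> R) :
  M^-1 * \sum_c (x c - M^-1 * \sum_d x d) ^+ 2 = vari x.
Proof.
rewrite /vari; set m := M^-1 * \sum_c x c.
under eq_bigr do rewrite sqrrB.
rewrite meanD meanB mean_cst//.
have -> : \sum_c x c * m *+ 2 = \sum_c (m *+ 2) * x c.
  by apply: eq_bigr => c _; ring.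
rewrite meanZ -/m; ring.
Qed.

(** Zero row and column sums allow [x] and [y] to be centred, so the block is controlled by
    variances, and a variance is the increase of the mean square from a node to its children. The
    parameter [al] stays free because one value has to serve at all nodes before it is optimized. *)
Lemma block_bound (K : I -> I -> R) (C : R) (x y : I -> R) (al : R) : 0 < al ->
  (forall c c', `|K c c'| <= C) ->
  (forall c, \sum_c' K c c' = 0) -> (forall c', \sum_c K c c' = 0) ->
  `|M^-1 * \sum_c M^-1 * \sum_c' K c c' * x c' * y c| <=
    C / 2 * (al * vari x + al^-1 * vari y).
Proof.
move=> al0 KC Kr Kc.
set mx := M^-1 * \sum_c x c; set my := M^-1 * \sum_c y c.
have -> : \sum_c M^-1 * (\sum_c' K c c' * x c' * y c) =
   \sum_c M^-1 * (\sum_c' K c c' * (x c' - mx) * (y c - my)).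
  have -> : \sum_c M^-1 * (\sum_c' K c c' * (x c' - mx) * (y c - my)) =
    \sum_c M^-1 * (\sum_c' K c c' * x c' * (y c - my)).
    apply: eq_bigr => c _; congr (_ * _).
    under eq_bigr do rewrite [_ * (_ - mx)]mulrBr mulrBl.
    by rewrite sumrB -!mulr_suml Kr !mul0r subr0.
  rewrite -!mulr_sumr; congr (_ * _); rewrite exchange_big/= [RHS]exchange_big/=.
  apply: eq_bigr => c' _; under [RHS]eq_bigr do rewrite mulrBr.
  by rewrite sumrB -!mulr_suml Kc !mul0r subr0.
rewrite -!vari_mean -/mx -/my.
have E : C / 2 * (al * (M^-1 * \sum_c (x c - mx) ^+ 2) +
      al^-1 * (M^-1 * \sum_c (y c - my) ^+ 2)) =
   M^-1 * \sum_c M^-1 * \sum_c' C / 2 * (al * (x c' - mx) ^+ 2 + al^-1 * (y c - my) ^+ 2).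
  under [in RHS]eq_bigr do rewrite meanZ meanD meanZ mean_cst//.
  by rewrite meanZ meanD !meanZ (mean_cst I_gt0).
rewrite E.
apply: le_trans (ler_norm_mean I_gt0 _) _; apply: (le_mean I_gt0) => // c.
apply: le_trans (ler_norm_mean I_gt0 _) _; apply: (le_mean I_gt0) => // c'.
have C0 : 0 <= C by apply: le_trans (KC c c').
set X := x c' - mx; set Y := y c - my.
rewrite !normrM -!mulrA; apply: ler_pM => //.
have : 0 <= al^-1 * (al * `|X| - `|Y|) ^+ 2.
  by rewrite mulr_ge0 ?sqr_ge0// invr_ge0 ltW.
have -> : al^-1 * (al * `|X| - `|Y|) ^+ 2 =
   al * X ^+ 2 + al^-1 * Y ^+ 2 - 2 * (`|X| * `|Y|).
  rewrite -[X ^+ 2]real_normK ?num_real// -[Y ^+ 2]real_normK ?num_real//.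
  by field; rewrite gt_eqF.
lra.
Qed.

(** For positive [A] and [B] the choice [al = B / A] gives equality. If one of them vanishes the
    infimum over [al] may not be attained, whence the margin [ep]. *)
Lemma inf_amgm K (A B x z : R) : 0 <= K -> 0 <= A -> 0 <= B ->
  (forall al, 0 < al -> x <= K * (al * A ^+ 2 + al^-1 * B ^+ 2) + z) ->
  x <= K * (2 * A * B) + z.
Proof.
move=> K0 A0 B0 H; apply/ler_addgt0Pr => ep ep0.
have key : exists2 al, 0 < al & K * (al * A ^+ 2 + al^-1 * B ^+ 2) <= K * (2 * A * B) + ep.
  have aux X : 0 <= X -> X * (ep / (X + 1)) <= ep.
    move=> X0; rewrite mulrA ler_pdivrMr ?ltr_wpDl// mulrC ler_pM2l//.
    by rewrite lerDl.
  move: A0; rewrite le_eqVlt => /predU1P[<-|A0].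
    have X0 : 0 <= K * B ^+ 2 by rewrite mulr_ge0// sqr_ge0.
    exists ((K * B ^+ 2 + 1) / ep); first by rewrite divr_gt0// ltr_wpDl.
    rewrite expr0n/= !mulr0 mul0r mulr0 !add0r invf_div mulrCA mulrC.
    by rewrite mulrC [_ * (K * _)]mulrC aux.
  move: B0; rewrite le_eqVlt => /predU1P[<-|B0].
    have X0 : 0 <= K * A ^+ 2 by rewrite mulr_ge0// sqr_ge0.
    exists (ep / (K * A ^+ 2 + 1)); first by rewrite divr_gt0// ltr_wpDl.
    by rewrite expr0n/= !mulr0 add0r addr0 mulrCA mulrC aux.
  exists (B / A); first by rewrite divr_gt0.
  have -> : B / A * A ^+ 2 + (B / A)^-1 * B ^+ 2 = 2 * A * B.
    by field; rewrite !gt_eqF.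
  by rewrite lerDl ltW.
have [al al0 Hal] := key.
by apply: le_trans (H _ al0) _; rewrite addrAC lerD2r.
Qed.

(** A threshold may be zero, and then [t^-1] is zero by convention; but then [a = 0], so
    [x <= M * a] excludes [t < x]. *)
Lemma le_threshold (a t x : R) : 0 <= a -> a <= t -> x <= M * a -> t < x -> 1 <= t^-1 * x.
Proof.
move=> a0 at_ xa tx; have t0 : 0 <= t := le_trans a0 at_.
move: t0; rewrite le_eqVlt => /predU1P[t0|t0]; last first.
  by rewrite mulrC ler_pdivlMr// mul1r ltW.
have : a = 0 by apply/le_anti; rewrite a0 t0 at_.
by move=> a00; move: xa; rewrite a00 mulr0 leNgt t0 tx.
Qed.
End commutator_tree.

(** * The stopping-time argument: passing from a node to its children *)

Section stopping.
Context {R : realType} {I : finType}.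
Hypothesis I_gt0 : (0 < #|I|)%N.
Local Notation M := (#|I|%:R : R).
Local Notation sparse := (@sparse R I).
Implicit Types (f g u e h : seq I -> R) (k : nat) (c : I) (s : seq I).
Implicit Types (kap : seq I -> I -> I -> R) (S : seq I -> bool).

Definition tree_abs f : seq I -> R := fun s => `|f s|.

(* [main_prop] is the domination started at a node of [S].  [stop_prop] continues it
   below such a node until an average of [|u|], [|g|], [|e u|], [|e g|] or [|e|], with
   [e = b - b0], exceeds its threshold; the energies [(M t)^2 - <f>^2] telescope along
   the generations and pay for the blocks above the stopping nodes. *)
Definition main_prop (C : R) k := forall kap u g (b : seq I -> R) (beta : R),
  kernel_bound C kap -> bmo_tree k b beta ->
  exists S, [/\ S [::], sparse k S,
   forall s, size s = k -> `|b s - avg k b| <= 10 * M * beta * spcount k S s &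
   `|comform k kap u g b| <= 2000 * C * M ^+ 3 * beta *
      avg k (fun s => spsum k S (tree_abs u) s * spsum k S (tree_abs g) s)].

(** At a node where the process stops, some average exceeds its threshold, so the five quotients
    bounding [cov] add up to at least 1 there; being linear in the averages, the bound survives
    averaging over children. [al1] and [al2] are quantified inside since the energies telescope only
    if all nodes share their values. *)
Definition stop_concl (C : R) k kap u g (b : seq I -> R) (b0 beta tu tg tv th te : R) S :=
  let e := fun s => b s - b0 in
  let v := fun s => e s * u s in
  let h := fun s => e s * g s in
  [/\ sparse k S,
   cov k S <= tu^-1 * avg k (tree_abs u) + tg^-1 * avg k (tree_abs g) +
     tv^-1 * avg k (tree_abs v) + th^-1 * avg k (tree_abs h) + te^-1 * avg k (tree_abs e),
   forall s, size s = k -> `|e s| <= M * te * (1 + spcount k S s) &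
   forall al1 al2, 0 < al1 -> 0 < al2 ->
     `|comform k kap u g b| <=
     C / 2 * (al1 * ((M * tu) ^+ 2 - avg k u ^+ 2) +
              al1^-1 * ((M * th) ^+ 2 - avg k h ^+ 2)) +
     C / 2 * (al2 * ((M * tv) ^+ 2 - avg k v ^+ 2) +
              al2^-1 * ((M * tg) ^+ 2 - avg k g ^+ 2)) +
     2000 * C * M ^+ 3 * beta *
      avg k (fun s => spsum k S (tree_abs u) s * spsum k S (tree_abs g) s)].

Definition stop_prop (C : R) k :=
  forall kap u g (b : seq I -> R) (b0 beta tu tg tv th te : R),
  kernel_bound C kap -> bmo_tree k b beta ->
  let e := fun s => b s - b0 in
  avg k (tree_abs u) <= tu -> avg k (tree_abs g) <= tg ->
  avg k (tree_abs (fun s => e s * u s)) <= tv ->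
  avg k (tree_abs (fun s => e s * g s)) <= th ->
  avg k (tree_abs e) <= te -> 10 * beta <= te ->
  exists2 S, S [::] = false & stop_concl C k kap u g b b0 beta tu tg tv th te S.

Lemma spcount_ge0 k S s : 0 <= spcount k S s :> R.
Proof.
elim: k S s => [|k IH] S [|c s]; apply: addr_ge0 => //; exact: IH.
Qed.

Lemma avg_tree_abs_ge0 k f : 0 <= avg k (tree_abs f).
Proof. by apply: avg_ge0 => // s _; exact: normr_ge0. Qed.

Lemma energy_ge0 k f t : avg k (tree_abs f) <= t -> 0 <= t ^+ 2 - avg k f ^+ 2.
Proof.
move=> ft; have := ler_norm_avg I_gt0 k f => nf.
rewrite subr_ge0 -[leLHS]real_normK ?num_real// lerXn2r ?nnegrE//.
  by apply: le_trans ft; exact: avg_tree_abs_ge0.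
exact: le_trans ft.
Qed.

Lemma stop0 C : 0 <= C -> stop_prop C 0.
Proof.
move=> C0 kap u g b b0 beta tu tg tv th te kb bb e Hu Hg Hv Hh He bte.
have e_t (f : seq I -> R) t : avg 0 (tree_abs f) <= t -> avg 0 (tree_abs f) <= M * t.
  move=> ft; apply: (le_trans ft); rewrite ler_peMl ?(M_ge1 I_gt0)//.
  by apply: le_trans ft; exact: (avg_tree_abs_ge0 0).
have e_t0 (f : seq I -> R) t : avg 0 (tree_abs f) <= t -> 0 <= t.
  by apply: le_trans; exact: (avg_tree_abs_ge0 0).
have e0 (f : seq I -> R) t : avg 0 (tree_abs f) <= t -> 0 <= t^-1 * avg 0 (tree_abs f).
  by move=> ft; rewrite mulr_ge0 ?invr_ge0 ?(e_t0 _ _ ft)// (avg_tree_abs_ge0 0).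
exists (fun=> false) => //; split => //.
- by rewrite [leLHS]/= !addr_ge0 ?e0.
- case=> // _; rewrite [spcount _ _ _]addr0 mulr0n addr0 mulr1; exact: (e_t e).
- move=> al1 al2 al10 al20.
  have -> : comform 0 kap u g b = 0 by rewrite /comform /mform /= !mul0r subrr.
  have sp0 f : spsum 0 (fun=> false) f [::] = 0 by rewrite /= mul0r addr0.
  rewrite normr0 [avg 0 (fun s => spsum _ _ _ s * _)]/avg sp0 mul0r mulr0 addr0.
  have en (f : seq I -> R) t : avg 0 (tree_abs f) <= t ->
    0 <= (M * t) ^+ 2 - avg 0 f ^+ 2 by move=> /e_t; exact: (@energy_ge0 0).
  have C20 : 0 <= C / 2 by rewrite divr_ge0.
  by rewrite !addr_ge0// mulr_ge0// addr_ge0// mulr_ge0 ?invr_ge0 ?(ltW al10) ?(ltW al20)// en.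
Qed.

(** A child where some average exceeds its threshold joins the family and [main_prop] restarts
    there; otherwise the process continues with the same thresholds and the same centre [b0]. A
    child's average of a nonnegative function is at most [M] times its parent's, so even at a
    stopping child the averages are at most [M] times the thresholds: this is the factor [M] in the
    energies. *)
Lemma stop_child C k kap u g (b : seq I -> R) (b0 beta tu tg tv th te : R) c :
  0 <= C -> main_prop C k -> stop_prop C k ->
  kernel_bound C kap -> bmo_tree k.+1 b beta ->
  let e := fun s => b s - b0 in
  avg k.+1 (tree_abs u) <= tu -> avg k.+1 (tree_abs g) <= tg ->
  avg k.+1 (tree_abs (fun s => e s * u s)) <= tv ->
  avg k.+1 (tree_abs (fun s => e s * g s)) <= th ->
  avg k.+1 (tree_abs e) <= te -> 10 * beta <= te ->
  exists S, stop_concl C k (sub kap c) (sub u c) (sub g c) (sub b c) b0 beta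
    tu tg tv th te S.
Proof.
move=> C0 mainP stopP kb bb e Hu Hg Hv Hh He bte.
have [_ /(_ c) bbc] := bb.
have kbc := kernel_bound_sub c kb.
have chM (f : seq I -> R) : avg k (tree_abs (sub f c)) <= M * avg k.+1 (tree_abs f).
  by apply: (avg_child_le I_gt0 c) => s _; exact: normr_ge0.
pose v := fun s => e s * u s.
pose h := fun s => e s * g s.
have thr (f : seq I -> R) t : avg k.+1 (tree_abs f) <= t -> t < avg k (tree_abs (sub f c)) ->
    1 <= t^-1 * avg k (tree_abs (sub f c)).
  by move=> ft; apply: le_threshold ft _ => //; exact: avg_tree_abs_ge0.
have t0 (f : seq I -> R) t : avg k.+1 (tree_abs f) <= t -> 0 <= t.
  by apply: le_trans; exact: avg_tree_abs_ge0.
have q0 (f : seq I -> R) t : avg k.+1 (tree_abs f) <= t ->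
    0 <= t^-1 * avg k (tree_abs (sub f c)).
  by move=> ft; apply: mulr_ge0; rewrite ?avg_tree_abs_ge0// invr_ge0 (t0 _ _ ft).
have chMt (f : seq I -> R) t : avg k.+1 (tree_abs f) <= t ->
    avg k (tree_abs (sub f c)) <= M * t.
  by move=> ft; apply: le_trans (chM f) _; rewrite ler_wpM2l.
have [|] := boolP [|| tu < avg k (tree_abs (sub u c)), tg < avg k (tree_abs (sub g c)),
   tv < avg k (tree_abs (sub v c)), th < avg k (tree_abs (sub h c)) |
   te < avg k (tree_abs (sub e c))]; last first.
  rewrite !negb_or -!leNgt => /and5P[hu hg hv hh he].
  have [S _ SP] := stopP (sub kap c) (sub u c) (sub g c) (sub b c) b0 beta _ _ _ _ _
     kbc bbc hu hg hv hh he bte.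
  by exists S.
move=> st; have [S [S0 sS Sb Sc]] := mainP (sub kap c) (sub u c) (sub g c) (sub b c) beta kbc bbc.
exists S; split => //.
(* The child itself belongs to [S]; the quotient of the exceeded threshold alone pays for it. *)
- have -> : cov k S = 1 by case: (k) => [|?]/=; rewrite S0.
  have := q0 _ _ Hu; have := q0 _ _ Hg; have := q0 _ _ Hv; have := q0 _ _ Hh;
  have := q0 _ _ He; rewrite -/(sub v c) -/(sub h c) -/(sub e c).
  have T (x1 x2 x3 x4 x5 : R) : 0 <= x5 -> 0 <= x4 -> 0 <= x3 -> 0 <= x2 -> 0 <= x1 ->
    [\/ 1 <= x1, 1 <= x2, 1 <= x3 | 1 <= x4 \/ 1 <= x5] -> 1 <= x1 + x2 + x3 + x4 + x5.
    by move=> ? ? ? ? ? []; [lra..|case; lra].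
  move=> ? ? ? ? ?; apply: T => //.
  case/or4P: st => [h1|h1|h1|/orP[h1|h1]].
  + by apply: Or41; exact: thr.
  + by apply: Or42; exact: thr.
  + by apply: Or43; exact: thr Hv h1.
  + by apply: Or44; left; exact: thr Hh h1.
  + by apply: Or44; right; exact: thr He h1.
- move=> s sk.
  have h1 : `|avg k (sub b c) - b0| <= M * te.
    apply: le_trans (chMt _ _ He); rewrite -[b0](avg_cst I_gt0 k) -(avgB I_gt0).
    exact: ler_norm_avg.
  have -> : sub b c s - b0 = (sub b c s - avg k (sub b c)) + (avg k (sub b c) - b0) by ring.
  apply: le_trans (ler_normD _ _) _; rewrite mulrDr mulr1 addrC lerD//.
  (* Moving the centre from the child's average to [b0] costs [M * te] once; each member below costs
     [10 * M * beta], which is at most [M * te] because [10 * beta <= te]. *)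
  apply: le_trans (Sb s sk) _.
  have N0 : 0 <= spcount k S s :> R by exact: spcount_ge0.
  rewrite ler_wpM2r// mulrAC [M * te]mulrC; apply: ler_wpM2r => //.
- move=> al1 al2 al10 al20.
  (* The energies of a stopping child are nonnegative and are simply added. *)
  apply: le_trans Sc _; rewrite lerDr.
  have en (f : seq I -> R) t : avg k.+1 (tree_abs f) <= t ->
    0 <= (M * t) ^+ 2 - avg k (sub f c) ^+ 2 by move=> ft; apply: energy_ge0; exact: chMt.
  have C20 : 0 <= C / 2 by rewrite divr_ge0.
  rewrite addr_ge0// mulr_ge0// addr_ge0// mulr_ge0 ?invr_ge0 ?(ltW al10) ?(ltW al20)//.
  + exact: en.
  + exact: (en h).
  + exact: (en v).
  + exact: en.
Qed.

End stopping.

(** * Telescoping of the energies and induction on the depth *)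

Section sparse_domination.
Context {R : realType} {I : finType}.
Hypothesis I_gt0 : (0 < #|I|)%N.
Local Notation M := (#|I|%:R : R).
Local Notation sparse := (@sparse R I).
Implicit Types (f g u e h : seq I -> R) (k : nat) (c : I) (s : seq I).
Implicit Types (kap : seq I -> I -> I -> R) (S : seq I -> bool).

Lemma comform_step k kap u g (b : seq I -> R) : comform k.+1 kap u g b =
  M^-1 * (\sum_c M^-1 * \sum_c' kap [::] c c' * avg k (sub u c') *
     avg k (sub (fun s => b s * g s) c)) -
  M^-1 * (\sum_c M^-1 * \sum_c' kap [::] c c' *
     avg k (sub (fun s => b s * u s) c') * avg k (sub g c)) +
  M^-1 * \sum_c comform k (sub kap c) (sub u c) (sub g c) (sub b c).
Proof.
rewrite [in LHS]/comform !mform_step// meanB /sub; ring.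
Qed.

(** The family is the union of those of the children. The variance of the children's averages is the
    mean of their squares minus the square of their mean, so adding it to the mean of the children's
    energies gives exactly the energy of the node; the final inequality is an identity. *)
Lemma stopS (C : R) k : 0 <= C -> @main_prop R I C k -> @stop_prop R I C k ->
  @stop_prop R I C k.+1.
Proof.
move=> C0 mainP stopP kap u g b b0 beta tu tg tv th te kb bb e Hu Hg Hv Hh He bte.
have /choice[Sf SfP] c := stop_child I_gt0 c C0 mainP stopP kb bb Hu Hg Hv Hh He bte.
pose S s := if s is c :: s' then Sf c s' else false.
exists S => //; split.
- by split=> // c; have [] := SfP c.
- rewrite [leLHS]/= -!meanZ -!meanD; apply: (le_mean I_gt0) => c.
  by have [_ + _ _] := SfP c.
- case=> // c s [sk]; have [_ _ + _] := SfP c => /(_ s sk).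
  by rewrite [spcount _ _ (c :: s)]/= mulr0n add0r.
move=> al1 al2 al10 al20.
pose v := fun s => e s * u s; pose h := fun s => e s * g s.
rewrite (comform_shift I_gt0 _ _ _ _ _ b0) comform_step -/e.
pose bnd c := C / 2 * (al1 * ((M * tu) ^+ 2 - avg k (sub u c) ^+ 2) +
              al1^-1 * ((M * th) ^+ 2 - avg k (sub h c) ^+ 2)) +
     C / 2 * (al2 * ((M * tv) ^+ 2 - avg k (sub v c) ^+ 2) +
              al2^-1 * ((M * tg) ^+ 2 - avg k (sub g c) ^+ 2)) +
     2000 * C * M ^+ 3 * beta *
      avg k (fun s => spsum k (Sf c) (tree_abs (sub u c)) s * spsum k (Sf c) (tree_abs (sub g c)) s).
have hb c : `|comform k (sub kap c) (sub u c) (sub g c) (sub e c)| <= bnd c.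
  by have [_ _ _ /(_ _ _ al10 al20)] := SfP c;
   rewrite (comform_shift I_gt0 _ _ _ _ _ b0).
have [kb1 kb2 kb3] := kb.
have r1 := block_bound I_gt0 (fun c => avg k (sub u c)) (fun c => avg k (sub h c)) al10
  (kb1 [::]) (kb2 [::]) (kb3 [::]).
have r2 := block_bound I_gt0 (fun c => avg k (sub v c)) (fun c => avg k (sub g c)) al20
  (kb1 [::]) (kb2 [::]) (kb3 [::]).
have r3 := le_trans (ler_norm_mean I_gt0 _) (le_mean I_gt0 hb).
apply: le_trans (ler_normD _ _) _.
apply: le_trans (lerD (ler_normB _ _) (lexx _)) _.
apply: le_trans (lerD (lerD r1 r2) r3) _.
rewrite /bnd !(meanD, meanB, meanZ) !(mean_cst I_gt0) /vari.
have -> : avg k.+1 (fun s => spsum k.+1 S (tree_abs u) s * spsum k.+1 S (tree_abs g) s) =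
   M^-1 * \sum_c avg k (fun s => spsum k (Sf c) (tree_abs (sub u c)) s *
       spsum k (Sf c) (tree_abs (sub g c)) s).
  rewrite [LHS]/=; congr (_ * _); apply: eq_bigr => c _; apply: (eq_avg I_gt0) => s _.
  by rewrite /sub/= !mulr0n !mul0r !add0r.
rewrite [avg k.+1 u]/= [avg k.+1 g]/= -/h -/v [avg k.+1 h]/= [avg k.+1 v]/=.
rewrite le_eqVlt; apply/orP; left; apply/eqP; rewrite !sumrN; ring.
Qed.

(** Each threshold is 10 times an average, or [10 * beta] for [e], so each of the five quotients is
    at most one tenth and the stopping nodes cover at most half of the root. Optimizing [al1] and
    [al2] reduces the energies to products of an average of [|u|] or [|g|] with one of [|e g|] or
    [|e u|]. *)
Lemma main_of_stop (C : R) k : 0 <= C -> @stop_prop R I C k -> @main_prop R I C k.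
Proof.
move=> C0 stopP kap u g b beta kb bb.
pose b0 := avg k b.
pose e := fun s => b s - b0.
pose v := fun s => e s * u s; pose h := fun s => e s * g s.
pose th f := 10 * avg k (tree_abs f).
have A0 f : 0 <= avg k (tree_abs f) := avg_tree_abs_ge0 I_gt0 k f.
have th1 f : avg k (tree_abs f) <= th f by rewrite /th; have := A0 f; lra.
have ebeta : avg k (tree_abs e) <= beta.
  by rewrite /tree_abs /e /b0; case: (k) bb => [|k'] [].
have beta0 : 0 <= beta := le_trans (A0 e) ebeta.
have [|S S0 [sS cS Se Sc]] := stopP kap u g b b0 beta (th u) (th g) (th v) (th h)
   (10 * beta) kb bb (th1 u) (th1 g) (th1 v) (th1 h) _ (lexx _).
  by rewrite -/e; lra.
have q f : (th f)^-1 * avg k (tree_abs f) <= 10^-1.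
  rewrite /th invfM -mulrA; have [->|n0] := eqVneq (avg k (tree_abs f)) 0.
    by rewrite mulr0 mulr0.
  by rewrite mulVf// mulr1.
have qe : (10 * beta)^-1 * avg k (tree_abs e) <= 10^-1.
  rewrite invfM -mulrA ler_piMr//; move: beta0; rewrite le_eqVlt => /predU1P[<-|b_gt0].
    by rewrite invr0 mul0r.
  by rewrite mulrC ler_pdivrMr// mul1r.
pose S' s := if s is [::] then true else S s.
have S'sum f s : size s = k -> spsum k S' f s = avg k f + spsum k S f s.
  case: (k) s => [|k'] [|c s]//= _; rewrite S0 !mul1r mulr0n mul0r add0r// addr0//.
have S'count s : size s = k -> spcount k S' s = 1 + spcount k S s :> R.
  case: (k) s => [|k'] [|c s]//= _; rewrite S0 mulr0n add0r// addr0//.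
have sS' : sparse k S'.
  have cS2 : cov k S <= 2^-1 :> R.
    apply: (le_trans cS); rewrite -/e -/v -/h.
    have := q u; have := q g; have := q v; have := q h; move: qe.
    set x1 := _ * _; set x2 := _ * _; set x3 := _ * _; set x4 := _ * _.
    set x5 := _ * _; lra.
  case: (k) sS cS2 S0 => [|k']//= [sSr sSc] cS2 S0; split => // _.
  by move: cS2; rewrite S0.
have S'e s : size s = k -> `|b s - avg k b| <= 10 * M * beta * spcount k S' s.
  move=> sk; apply: le_trans (Se s sk) _.
  by rewrite S'count// [M * _]mulrA [M * 10]mulrC.
exists S'; split => //.
have C20 : 0 <= C / 2 by rewrite divr_ge0.
have en al1 al2 : 0 < al1 -> 0 < al2 -> `|comform k kap u g b| <=
    C / 2 * (al1 * (M * th u) ^+ 2 + al1^-1 * (M * th h) ^+ 2) +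
    (C / 2 * (al2 * (M * th v) ^+ 2 + al2^-1 * (M * th g) ^+ 2) +
    2000 * C * M ^+ 3 * beta *
      avg k (fun s => spsum k S (tree_abs u) s * spsum k S (tree_abs g) s)).
  move=> a1 a2; apply: le_trans (Sc _ _ a1 a2) _; rewrite -/e -/h -/v addrA lerD2r.
  have sq (a x y : R) : 0 < a -> a * (x ^+ 2 - y ^+ 2) <= a * x ^+ 2.
    by move=> a0; apply: ler_wpM2l; rewrite ?(ltW a0)// gerBl sqr_ge0.
  by apply: lerD; apply: ler_wpM2l => //; apply: lerD; apply: sq; rewrite ?invr_gt0.
have Mth f : 0 <= M * th f by rewrite !mulr_ge0.
have en1 al2 : 0 < al2 -> `|comform k kap u g b| <=
    C / 2 * (al2 * (M * th v) ^+ 2 + al2^-1 * (M * th g) ^+ 2) +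
    (C / 2 * (2 * (M * th u) * (M * th h)) +
    2000 * C * M ^+ 3 * beta *
      avg k (fun s => spsum k S (tree_abs u) s * spsum k S (tree_abs g) s)).
  move=> a2; rewrite addrCA; apply: (inf_amgm C20 (Mth _) (Mth _)) => al1 a1.
  exact: en.
have {en en1} := inf_amgm C20 (Mth _) (Mth _) en1.
(* The factor [e] is traded for the counting function, and that for one more application of the
   sparse operator. *)
have prod f : avg k (tree_abs (fun s => e s * f s)) <=
    10 * M * beta * avg k (spsum k S' (tree_abs f)).
  rewrite -(avg_spcount I_gt0) -avgZ; apply: (le_avg I_gt0) => s sk.
  by rewrite /tree_abs normrM mulrA ler_wpM2r//; exact: S'e.
have avgS f : avg k (spsum k S' (tree_abs f)) = avg k (tree_abs f) + avg k (spsum k S (tree_abs f)).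
  by rewrite -[in RHS](avg_cst I_gt0 k (avg k (tree_abs f))) -avgD; apply: (eq_avg I_gt0) => s sk; rewrite S'sum.
have := prod u; have := prod g; rewrite -/v -/h !avgS {prod}.
have -> : avg k (fun s => spsum k S' (tree_abs u) s * spsum k S' (tree_abs g) s) =
  avg k (tree_abs u) * avg k (tree_abs g) + avg k (tree_abs u) * avg k (spsum k S (tree_abs g))
  + avg k (tree_abs g) * avg k (spsum k S (tree_abs u)) +
  avg k (fun s => spsum k S (tree_abs u) s * spsum k S (tree_abs g) s).
  have aux (x y : R) F G : avg k (fun s => (x + F s) * (y + G s)) =
      x * y + x * avg k G + y * avg k F + avg k (fun s => F s * G s).
    rewrite -(avg_cst I_gt0 k (x * y)) -!avgZ -!avgD.
    by apply: (eq_avg I_gt0) => s _; ring.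
  by rewrite -aux; apply: (eq_avg I_gt0) => s sk; rewrite !S'sum.
have Sp0 f : 0 <= avg k (spsum k S (tree_abs f)).
  by apply: (avg_ge0 I_gt0) => s sk; apply: spsum_ge0 => // s' _; exact: normr_ge0.
move: (A0 u) (A0 g) (Sp0 u) (Sp0 g); rewrite /th.
set x := avg k (tree_abs u); set y := avg k (tree_abs g).
set X := avg k (spsum k S (tree_abs u)); set Y := avg k (spsum k S (tree_abs g)).
set Z := avg k (fun s => _ * _); set vv := avg k (tree_abs v); set hh := avg k (tree_abs h).
(* The energies give [100 C M^2 (x hh + y vv)], hence at most [1000 C M^3 beta (2 x y + x Y + y X)].
   The factor 2000 covers the doubled [x y], and [h3] fills the slack in the other two terms. *)
move=> x0 y0 X0 Y0 Hh Hv H; apply: le_trans H _.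
have CM : 0 <= C * M ^+ 2 by rewrite mulr_ge0.
have h1 : 0 <= C * M ^+ 2 * 100 * (y * (10 * M * beta * (x + X) - vv)).
  by rewrite !mulr_ge0// subr_ge0.
have h2 : 0 <= C * M ^+ 2 * 100 * (x * (10 * M * beta * (y + Y) - hh)).
  by rewrite !mulr_ge0// subr_ge0.
have h3 : 0 <= C * M ^+ 3 * beta * (x * Y + y * X).
  by rewrite !mulr_ge0// addr_ge0// mulr_ge0.
lra.
Qed.

Theorem sparse_domination (C : R) k : 0 <= C -> @main_prop R I C k.
Proof.
move=> C0; apply: main_of_stop => //; elim: k => [|k IH]; first exact: stop0.
by apply: stopS => //; exact: main_of_stop.
Qed.

End sparse_domination.

(** * Weighted bounds for sparse operators *)
Section powR_inequalities.
Context {R : realType}.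
Implicit Types a x y p q r : R.

Lemma powR_addp x q r : 0 < x -> x `^ (q + r) = x `^ q * x `^ r.
Proof. by move=> x0; rewrite powRD//; apply/implyP => _; rewrite gt_eqF. Qed.

Lemma ler_powRl x y r : 0 <= r -> 0 <= x -> x <= y -> x `^ r <= y `^ r.
Proof.
move=> r0 x0 xy; apply: ge0_ler_powR => //; rewrite nnegrE//.
exact: le_trans xy.
Qed.

Lemma ler_powR_neg x y r : r <= 0 -> 0 < x -> x <= y -> y `^ r <= x `^ r.
Proof.
move=> r0 x0 xy; rewrite -[r]opprK !(powRN _ (- r)).
by rewrite lef_pV2 ?posrE ?powR_gt0 ?(lt_le_trans x0 xy)// ler_powRl ?oppr_ge0// ltW.
Qed.

Definition conj_exp p : R := p / (p - 1).

Lemma conj_exp_gt1 p : 1 < p -> 1 < conj_exp p.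
Proof. by move=> p1; rewrite /conj_exp ltr_pdivlMr ?subr_gt0//; lra. Qed.

Lemma conj_expB1 p : 1 < p -> conj_exp p - 1 = (p - 1)^-1.
Proof. by move=> p1; rewrite /conj_exp; field; lra. Qed.

Lemma conj_expK p : 1 < p -> conj_exp (conj_exp p) = p.
Proof.
move=> p1; rewrite {1}/conj_exp conj_expB1// invrK /conj_exp; field; lra.
Qed.

Lemma conj_expM p : 1 < p -> (p - 1) * conj_exp p = p.
Proof. by move=> p1; rewrite /conj_exp; field; lra. Qed.

Lemma young p x y : 1 < p -> 0 <= x -> 0 <= y ->
  x * y <= x `^ p / p + y `^ conj_exp p / conj_exp p.
Proof.
move=> p1 x0 y0; have q1 := conj_exp_gt1 p1.
apply: conjugate_powR => //; [lra|lra|rewrite /conj_exp; field; lra].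
Qed.

Lemma young_powR p x y : 1 < p -> 0 <= x -> 0 <= y ->
  x * y <= x `^ p + y `^ conj_exp p.
Proof.
move=> p1 x0 y0; apply: le_trans (young p1 x0 y0) _.
have q1 := conj_exp_gt1 p1.
by apply: lerD; rewrite ler_piMr ?powR_ge0// invf_le1 ?ltW//; lra.
Qed.

(** Convexity: the left-hand side is the tangent of the [p]-th power at [m], evaluated at [a]. It is
    Young's inequality for [a] and [m^(p-1)]. *)
Lemma tangent_powR p a m : 1 < p -> 0 <= m -> 0 <= a ->
  p * (m `^ (p - 1) * a) - (p - 1) * m `^ p <= a `^ p.
Proof.
move=> p1 m0 a0; have := young p1 a0 (powR_ge0 m (p - 1)).
rewrite -powRrM conj_expM// mulrC => H.
have H2 : p * (m `^ (p - 1) * a) <= p * (a `^ p / p + m `^ p / conj_exp p).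
  by rewrite ler_wpM2l//; lra.
have E : p * (a `^ p / p + m `^ p / conj_exp p) = a `^ p + (p - 1) * m `^ p.
  by rewrite /conj_exp; field; lra.
lra.
Qed.

(** [F], [H], [W], [Sg] stand for averages at a member of the family, [x] and [y] for the masses of
    its free part under the weight and its dual. Then [W Sg <= D Sg^(2-p) <= D y^(2-p)], the second
    step because [p >= 2]; the lower bound on [x y^(p-1)] turns [y^(2-p)] into [x^(1/p') y^(1/p)],
    which Young's inequality separates. That [D] enters to the first power is the source of the
    exponent. *)
Lemma node_ineq p (c D W Sg x y F H : R) : 2 <= p -> 0 < c -> 0 < W -> 0 < Sg ->
  0 < x -> 0 < y -> y <= Sg -> W * Sg `^ (p - 1) <= D -> c <= x * y `^ (p - 1) ->
  0 <= F -> 0 <= H ->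
  F * H <= c `^ (- ((p - 1) / p)) * D *
    ((F / Sg) `^ p * y + (H / W) `^ conj_exp p * x).
Proof.
move=> p2 c0 W0 Sg0 x0 y0 ySg WD cxy F0 H0.
have p1 : 1 < p by lra.
have D0 : 0 <= D by apply: le_trans WD; rewrite mulr_ge0 ?powR_ge0// ltW.
set a := F / Sg; set g := H / W.
have a0 : 0 <= a by rewrite divr_ge0// ltW.
have g0 : 0 <= g by rewrite divr_ge0// ltW.
have -> : F * H = a * g * (W * Sg) by rewrite /a /g; field; rewrite !gt_eqF.
clearbody a g.
have h1 : W * Sg <= D * y `^ (2 - p).
  apply: (@le_trans _ _ (D * Sg `^ (2 - p))); last first.
    by rewrite ler_wpM2l// ler_powR_neg//; lra.
  have -> : W * Sg = W * Sg `^ (p - 1) * Sg `^ (2 - p).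
    by rewrite -mulrA -powR_addp// (_ : p - 1 + (2 - p) = 1) ?powRr1 ?ltW//; ring.
  by rewrite ler_wpM2r// powR_ge0.
have h2 : y `^ (2 - p) <= c `^ (- ((p - 1) / p)) * (x `^ (conj_exp p)^-1 * y `^ p^-1).
  have -> : x `^ (conj_exp p)^-1 * y `^ p^-1 =
      (x * y `^ (p - 1)) `^ ((p - 1) / p) * y `^ (2 - p).
    rewrite powRM ?powR_ge0 ?ltW// -powRrM -mulrA -powR_addp//.
    by congr (_ `^ _ * _ `^ _); rewrite /conj_exp; field; lra.
  rewrite mulrA -[leLHS]mul1r ler_wpM2r ?powR_ge0//.
  rewrite powRN mulrC ler_pdivlMr ?powR_gt0// mul1r.
  by apply: ler_powRl; rewrite ?(ltW c0)// divr_ge0//; lra.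
have h3 : a * g * (x `^ (conj_exp p)^-1 * y `^ p^-1) <=
    a `^ p * y + g `^ conj_exp p * x.
  have -> : a * g * (x `^ (conj_exp p)^-1 * y `^ p^-1) =
    (a * y `^ p^-1) * (g * x `^ (conj_exp p)^-1) by ring.
  have aY : 0 <= a * y `^ p^-1 by rewrite mulr_ge0 ?powR_ge0.
  have gX : 0 <= g * x `^ (conj_exp p)^-1 by rewrite mulr_ge0 ?powR_ge0.
  apply: le_trans (young_powR p1 aY gX) _.
  rewrite (powRM _ a0) ?powR_ge0// (powRM _ g0) ?powR_ge0//.
  have pn : p != 0 by rewrite gt_eqF//; lra.
  have qn : conj_exp p != 0 by rewrite gt_eqF// (lt_trans ltr01)// conj_exp_gt1.
  by rewrite -!powRrM !mulVf// !powRr1// ltW.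
have ag : 0 <= a * g by rewrite mulr_ge0.
have cc : 0 <= c `^ (- ((p - 1) / p)) * D by rewrite mulr_ge0// powR_ge0.
apply: le_trans (ler_wpM2l ag h1) _.
apply: le_trans (ler_wpM2l ag (ler_wpM2l D0 h2)) _.
apply: le_trans (ler_wpM2l cc h3); rewrite le_eqVlt; apply/orP; left; apply/eqP; ring.
Qed.

(* Either [w >= mu] or [s >= (c / mu)^(1/(p-1))]; optimizing in [mu] replaces
   Hoelder's inequality. *)
Lemma dichotomy p (c w s mu : R) : 1 < p -> 0 < c -> 0 < w -> 0 < s -> 0 < mu ->
  c <= w * s `^ (p - 1) -> 1 <= w / mu + s * (mu / c) `^ (p - 1)^-1.
Proof.
move=> p1 c0 w0 s0 mu0 cws.
have h0 : 0 <= w / mu by rewrite divr_ge0 ?ltW.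
have h1 : 0 <= s * (mu / c) `^ (p - 1)^-1 by rewrite mulr_ge0 ?powR_ge0 ?ltW.
have [muw|wmu] := leP mu w.
  by rewrite ler_wpDr// ler_pdivlMr// mul1r.
rewrite ler_wpDl//.
have e : s * (mu / c) `^ (p - 1)^-1 = (s `^ (p - 1) * (mu / c)) `^ (p - 1)^-1.
  rewrite [RHS]powRM ?powR_ge0 ?divr_ge0 ?ltW// -powRrM divff ?powRr1 ?ltW//.
  by rewrite gt_eqF//; lra.
apply: (@le_trans _ _ (1 `^ (p - 1)^-1)); first by rewrite powR1.
rewrite e.
apply: ler_powRl; rewrite ?ler01// ?invr_ge0; first lra.
rewrite mulrA ler_pdivlMr// mul1r; apply: le_trans cws _.
by rewrite mulrC ler_wpM2l ?powR_ge0 ?ltW.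
Qed.

End powR_inequalities.

(** * Carleson sums over a sparse family and the weighted maximal function *)

Section weighted_tree.
Context {R : realType} {I : finType}.
Hypothesis I_gt0 : (0 < #|I|)%N.
Local Notation M := (#|I|%:R : R).
Local Notation sparse := (@sparse R I).
Implicit Types (f h w sg : seq I -> R) (k : nat) (c : I) (s : seq I).
Implicit Types (S : seq I -> bool) (p D m : R).

Fixpoint ap_tree p D k w sg : Prop :=
  avg k w * avg k sg `^ (p - 1) <= D /\
  (if k is k'.+1 then forall c, ap_tree p D k' (sub w c) (sub sg c) else True).

(** A lower A_p bound at the leaves. The leaf values will be averages over small cubes, for which
    the product is not 1 but is bounded below; [c0 = 2^-p] is the value obtained later. *)
Definition leaf_ap p (c0 : R) k w sg := forall s, size s = k ->
  [/\ 0 < w s, 0 < sg s & c0 <= w s * sg s `^ (p - 1)].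

Lemma avg_gt0 k w : (forall s, size s = k -> 0 < w s) -> 0 < avg k w.
Proof.
move=> w0; have := @avg_gt0_mul _ _ I_gt0 k (fun=> 1) w (fun _ _ => ler01) w0.
rewrite (avg_cst I_gt0) => /(_ ltr01); congr (_ < _).
by apply: (eq_avg I_gt0) => s _; rewrite mulr1.
Qed.

(* The indicator of the leaves lying in no member of [S]. *)
Fixpoint unc k S s : R :=
  if S [::] then 0 else
  if k is k'.+1 then if s is c :: s' then unc k' (sub S c) s' else 1 else 1.

(* The indicator of the leaves lying in no member of [S] other than the root. *)
Definition ebelow k S s : R :=
  if k is k'.+1 then if s is c :: s' then unc k' (sub S c) s' else 1 else 1.

Lemma unc_ge0 k S s : 0 <= unc k S s.
Proof.
elim: k S s => [|k IH] S s /=; case: ifP => // _; case: s => // c s; exact: IH.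
Qed.

Lemma unc_le1 k S s : unc k S s <= 1.
Proof.
elim: k S s => [|k IH] S s /=; case: ifP => // _; case: s => // c s; exact: IH.
Qed.

Lemma ebelow_ge0 k S s : 0 <= ebelow k S s.
Proof. by case: k s => [|k] [|c s]//=; exact: unc_ge0. Qed.

Lemma ebelow_le1 k S s : ebelow k S s <= 1.
Proof. by case: k s => [|k] [|c s]//=; exact: unc_le1. Qed.

Lemma avg_unc k S : avg k (unc k S) = 1 - cov k S.
Proof.
elim: k S => [|k IH] S /=; case: ifP => SE; rewrite ?subrr ?subr0//.
  rewrite big1 ?mulr0// => c _; rewrite -[RHS](avg_cst I_gt0 k).
  exact: (eq_avg I_gt0).
rewrite -[X in X - _](mean_cst I_gt0) -meanB; congr (_ * _).
apply: eq_bigr => c _; rewrite -IH; exact: (eq_avg I_gt0).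
Qed.

Lemma avg_ebelow k S : sparse k S -> S [::] -> 2^-1 <= avg k (ebelow k S).
Proof.
case: k => [|k] /=; first by move=> _ _; rewrite invf_le1// ler1n.
move=> [+ _] S0 => /(_ S0) cS; rewrite (eq_bigr (fun c => 1 - cov k (sub S c))).
  rewrite meanB mean_cst//; lra.
by move=> c _; rewrite -avg_unc.
Qed.

(** A Carleson sum relative to the measure with density [w]: powers of the [w]-averages of [f / w]
    over the members, weighted by the [w]-mass of their free parts. These parts are pairwise
    disjoint. *)
Fixpoint carl p k S w f : R :=
  (S [::])%:R * ((avg k f / avg k w) `^ p * avg k (fun s => w s * ebelow k S s)) +
  (if k is k'.+1 then M^-1 * \sum_c carl p k' (sub S c) (sub w c) (sub f c) else 0).

Definition form k S f h := avg k (fun s => spsum k S f s * h s).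

Lemma form_step k S f h : form k.+1 S f h =
  (S [::])%:R * (avg k.+1 f * avg k.+1 h) +
  M^-1 * \sum_c form k (sub S c) (sub f c) (sub h c).
Proof.
rewrite mulrA; set A := _ * avg k.+1 f.
rewrite /form -[avg k.+1 h]/(M^-1 * _) -meanZ -meanD.
rewrite [LHS]/=; congr (_ * _); apply: eq_bigr => c _.
rewrite -(@avgZ _ _ k A) -avgD.
by apply: (eq_avg I_gt0) => s _; rewrite /sub/= mulrDl.
Qed.

Lemma form_sym k S f h : form k S f h = form k S h f.
Proof.
elim: k S f h => [|k IH] S f h.
  by rewrite /form/= !addr0 mulrAC.
rewrite !form_step; congr (_ + _ * _); first by rewrite [avg _ f * _]mulrC.
by apply: eq_bigr => c _; rewrite IH.
Qed.

(** A Hoelder inequality on the free part, whose measure is at least one half. [dichotomy] is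
    averaged over it with parameter [4 * x]: the term in [w] then contributes one quarter, which
    leaves one quarter for the term in [sg]. *)
Lemma mass_ebelow p (c0 : R) k S w sg : 1 < p -> 0 < c0 -> sparse k S -> S [::] ->
  leaf_ap p c0 k w sg ->
  [/\ 0 < avg k (fun s => w s * ebelow k S s),
      0 < avg k (fun s => sg s * ebelow k S s),
      avg k (fun s => sg s * ebelow k S s) <= avg k sg &
  c0 / 4 / 4 `^ (p - 1) <= avg k (fun s => w s * ebelow k S s) *
                 avg k (fun s => sg s * ebelow k S s) `^ (p - 1)].
Proof.
move=> p1 c00 sS S0 lf; have hE := avg_ebelow sS S0.
set x := avg k (fun s => w s * _); set y := avg k (fun s => sg s * _).
have E0 : 0 < avg k (ebelow k S) by apply: lt_le_trans hE; rewrite invr_gt0.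
have x0 : 0 < x.
  by apply: avg_gt0_mul => // s sk; [exact: ebelow_ge0|have [] := lf s sk].
have y0 : 0 < y.
  by apply: avg_gt0_mul => // s sk; [exact: ebelow_ge0|have [] := lf s sk].
split => //.
  apply: (le_avg I_gt0) => s sk; have [_ sg0 _] := lf s sk.
  by rewrite ler_piMr ?ebelow_le1// ltW.
have mu0 : 0 < 4 * x by rewrite mulr_gt0.
have key : 2^-1 <= 4^-1 + y * (4 * x / c0) `^ (p - 1)^-1.
  have -> : 4^-1 = (4 * x)^-1 * x by field; rewrite gt_eqF.
  rewrite [y * _]mulrC -(@avgZ _ _ k (4 * x)^-1) -(@avgZ _ _ k (_ `^ _)) -avgD.
  apply: le_trans hE _.
  apply: (le_avg I_gt0) => s sk; have [w0 s0 cs] := lf s sk.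
  rewrite mulrA [X in _ + X]mulrA -mulrDl -[leLHS]mul1r ler_wpM2r ?ebelow_ge0//.
  have := dichotomy p1 c00 w0 s0 mu0 cs.
  by rewrite [w s / _]mulrC [sg s * _]mulrC.
have {}key : 4^-1 <= y * (4 * x / c0) `^ (p - 1)^-1 by lra.
have : 4^-1 `^ (p - 1) <= (y * (4 * x / c0) `^ (p - 1)^-1) `^ (p - 1).
  by rewrite ler_powRl//; lra.
have pn : p - 1 != 0 by rewrite gt_eqF//; lra.
have xc : 0 <= 4 * x / c0 by rewrite divr_ge0// ltW.
rewrite [leRHS](powRM _ (ltW y0) (powR_ge0 _ _)) -[_ `^ _ `^ (p - 1)]powRrM mulVf// powRr1//.
have -> : 4^-1 `^ (p - 1) = (4 `^ (p - 1))^-1 :> R.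
  by rewrite -[4^-1]powR_inv1// -powRrM mulN1r powRN.
have q0 : 0 < 4 `^ (p - 1) :> R by rewrite powR_gt0.
set q := 4 `^ _ in q0 *; set Y := y `^ _ => H.
have {}H : c0 / 4 * q^-1 <= c0 / 4 * (Y * (4 * x / c0)) by rewrite ler_wpM2l// divr_ge0// ltW.
apply: (le_trans H); rewrite le_eqVlt; apply/orP; left; apply/eqP; field.
by rewrite gt_eqF.
Qed.

Lemma form_le_carl p (c0 : R) D k S w sg f h : 2 <= p -> 0 < c0 -> sparse k S ->
  leaf_ap p c0 k w sg -> ap_tree p D k w sg ->
  (forall s, size s = k -> 0 <= f s) -> (forall s, size s = k -> 0 <= h s) ->
  form k S f h <= (c0 / 4 / 4 `^ (p - 1)) `^ (- ((p - 1) / p)) * D *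
     (carl p k S sg f + carl (conj_exp p) k S w h).
Proof.
move=> p2 c00; have p1 : 1 < p by lra.
set c1 := c0 / 4 / 4 `^ (p - 1).
have c10 : 0 < c1 by rewrite !divr_gt0// powR_gt0.
have root k' S' w' sg' f' h' : sparse k' S' -> leaf_ap p c0 k' w' sg' ->
    avg k' w' * avg k' sg' `^ (p - 1) <= D ->
    (forall s, size s = k' -> 0 <= f' s) -> (forall s, size s = k' -> 0 <= h' s) ->
    (S' [::])%:R * (avg k' f' * avg k' h') <= c1 `^ (- ((p - 1) / p)) * D *
   ((S' [::])%:R * ((avg k' f' / avg k' sg') `^ p * avg k' (fun s => sg' s * ebelow k' S' s)) +
    (S' [::])%:R * ((avg k' h' / avg k' w') `^ conj_exp p * avg k' (fun s => w' s * ebelow k' S' s))).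
  move=> sS lf apD f0 h0; case: (boolP (S' [::])) => S0; last first.
    by rewrite mulr0n !mul0r addr0 mulr0.
  rewrite !mul1r; have [x0 y0 ySg cxy] := mass_ebelow p1 c00 sS S0 lf.
  apply: node_ineq => //; last 2 first.
  - exact: (avg_ge0 I_gt0).
  - exact: (avg_ge0 I_gt0).
  - by apply: avg_gt0 => s sk; have [] := lf s sk.
  - by apply: avg_gt0 => s sk; have [] := lf s sk.
elim: k S w sg f h => [|k IH] S w sg f h.
  move=> sS lf [apD _] f0 h0; rewrite /form [leLHS]/= [carl _ _ _ _ _]/= [X in _ * (_ + X)]/=.
  by rewrite !addr0 -mulrA; apply: (root 0 S w sg f h).
move=> sS lf [apD apc] f0 h0; rewrite form_step [carl _ _ _ _ _]/= [X in _ * (_ + X)]/=.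
have [_ sSc] := sS.
rewrite addrACA mulrDr; apply: lerD; first exact: (root k.+1 S w sg f h).
rewrite -meanD -meanZ; apply: (le_mean I_gt0) => c; apply: IH.
- exact: sSc.
- by move=> s sk; apply: lf; rewrite /= sk.
- exact: apc.
- by move=> s sk; apply: f0; rewrite /= sk.
- by move=> s sk; apply: h0; rewrite /= sk.
Qed.

Fixpoint maxf k w f m s : R :=
  let m' := Num.max m (avg k f / avg k w) in
  if k is k'.+1 then if s is c :: s' then maxf k' (sub w c) (sub f c) m' s' else m'
  else m'.

Lemma maxf_ge k w f m s : m <= maxf k w f m s.
Proof.
elim: k w f m s => [|k IH] w f m s /=; first by rewrite le_max lexx.
case: s => [|c s]; first by rewrite le_max lexx.
by apply: le_trans (IH _ _ _ _); rewrite le_max lexx.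
Qed.

(** On the free part of a member the running maximum is at least the average at that member. In the
    induction, the term in [m] accounts for the leaves that no member below claims: there the
    maximum inherited from above is used. *)
Lemma carl_le_maxf p k S w f m : 0 < p -> 0 <= m ->
  (forall s, size s = k -> 0 < w s) -> (forall s, size s = k -> 0 <= f s) ->
  carl p k S w f + m `^ p * avg k (fun s => w s * unc k S s) <=
  avg k (fun s => w s * maxf k w f m s `^ p).
Proof.
move=> p0; elim: k S w f m => [|k IH] S w f m m0 w0 f0.
  have a0 : 0 <= f [::] / w [::] by rewrite divr_ge0 ?f0// ltW// w0.
  have h1 : (f [::] / w [::]) `^ p * w [::] <= w [::] * Num.max m (f [::] / w [::]) `^ p.
    by rewrite mulrC ler_wpM2l ?(ltW (w0 _ _))// ler_powRl ?(ltW p0)// le_max lexx orbT.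
  have h2 : m `^ p * w [::] <= w [::] * Num.max m (f [::] / w [::]) `^ p.
    by rewrite mulrC ler_wpM2l ?(ltW (w0 _ _))// ler_powRl ?(ltW p0)// le_max lexx.
  rewrite /= addr0; case: (S [::]).
    by rewrite !mulr1 mulr0 mulr0 addr0 mul1r.
  by rewrite mulr0n mul0r add0r mulr1.
have W0 : 0 < avg k.+1 w by exact: avg_gt0.
have F0 : 0 <= avg k.+1 f by exact: (avg_ge0 I_gt0).
have wc c s : size s = k -> 0 < sub w c s by move=> sk; apply: w0; rewrite /= sk.
have fc c s : size s = k -> 0 <= sub f c s by move=> sk; apply: f0; rewrite /= sk.
set a := avg k.+1 f / avg k.+1 w.
have a0 : 0 <= a by rewrite divr_ge0// ltW.
set m' := Num.max m a.
have m'0 : 0 <= m' by rewrite le_max m0.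
have E0 c : 0 <= avg k (fun s => sub w c s * unc k (sub S c) s).
  by apply: (avg_ge0 I_gt0) => s sk; rewrite mulr_ge0 ?unc_ge0// ltW// wc.
have key : M^-1 * \sum_c carl p k (sub S c) (sub w c) (sub f c) +
   m' `^ p * (M^-1 * \sum_c avg k (fun s => sub w c s * unc k (sub S c) s)) <=
   avg k.+1 (fun s => w s * maxf k.+1 w f m s `^ p).
  rewrite -meanZ -meanD; apply: (le_mean I_gt0) => c.
  by apply: IH => // s; [exact: wc|exact: fc].
apply: le_trans key.
set X := M^-1 * \sum_c carl _ _ _ _ _.
set Y := M^-1 * \sum_c avg k (fun s => sub w c s * unc k (sub S c) s).
have Y0 : 0 <= Y by rewrite mulr_ge0 ?invr_ge0// sumr_ge0.
rewrite (_ : carl p k.+1 S w f = (S [::])%:R * (a `^ p * Y) + X)//.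
rewrite -[avg k.+1 (fun s => w s * unc k.+1 S s)]/(M^-1 * _).
rewrite addrAC addrC lerD2l; case: (boolP (S [::])) => S0.
  rewrite mul1r big1 ?mulr0 ?addr0; last first.
    move=> c _; rewrite -[RHS](avg_cst I_gt0 k); apply: (eq_avg I_gt0) => s _.
    by rewrite /sub/= S0 mulr0.
  by rewrite ler_wpM2r// ler_powRl ?(ltW p0)// le_max lexx orbT.
rewrite mulr0n mul0r add0r.
have -> : M^-1 * (\sum_c avg k (sub (fun s => w s * unc k.+1 S s) c)) = Y.
  by congr (_ * _); apply: eq_bigr => c _; apply: (eq_avg I_gt0) => s _;
    rewrite /sub/= (negbTE S0).
by rewrite ler_wpM2r// ler_powRl ?(ltW p0)// le_max lexx.
Qed.

End weighted_tree.

Section weighted_bounds.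
Context {R : realType} {I : finType}.
Hypothesis I_gt0 : (0 < #|I|)%N.
Local Notation M := (#|I|%:R : R).
Local Notation sparse := (@sparse R I).
Implicit Types (f g u h w sg : seq I -> R) (k : nat) (c : I) (s : seq I).
Implicit Types (S : seq I -> bool) (p D m : R).

(* Doob's maximal inequality: [p m^(p-1) x - (p-1) m^p], with [m] the running
   maximum of the averages and [x] the current one, is a submartingale. *)
Lemma doob_step p k w f m : 1 < p -> 0 <= m ->
  (forall s, size s = k -> 0 < w s) -> (forall s, size s = k -> 0 <= f s) ->
  p * (Num.max m (avg k f / avg k w) `^ (p - 1) * avg k f) -
  (p - 1) * (Num.max m (avg k f / avg k w) `^ p * avg k w) <=
  avg k (fun s => p * (maxf k w f m s `^ (p - 1) * f s) -
                  (p - 1) * (maxf k w f m s `^ p * w s)).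
Proof.
move=> p1; elim: k w f m => [|k IH] w f m m0 w0 f0; first by [].
set m' := Num.max m _.
have wc c s : size s = k -> 0 < sub w c s by move=> sk; apply: w0; rewrite /= sk.
have fc c s : size s = k -> 0 <= sub f c s by move=> sk; apply: f0; rewrite /= sk.
have m'0 : 0 <= m' by rewrite le_max m0.
rewrite [leLHS](_ : _ = M^-1 * \sum_c (p * (m' `^ (p - 1) * avg k (sub f c)) -
   (p - 1) * (m' `^ p * avg k (sub w c)))); last by rewrite meanB !meanZ.
apply: (le_mean I_gt0) => c.
apply: le_trans (IH (sub w c) (sub f c) m' m'0 (wc c) (fc c)).
have W0 : 0 < avg k (sub w c) := avg_gt0 I_gt0 (wc c).
have F0 : 0 <= avg k (sub f c) := avg_ge0 I_gt0 (fc c).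
set a := avg k (sub f c) / _.
have a0 : 0 <= a by rewrite divr_ge0// ltW.
have -> : avg k (sub f c) = a * avg k (sub w c) by rewrite /a mulfVK// gt_eqF.
have [am|ma] := leP a m'; first exact: lexx.
rewrite [leLHS](_ : _ =
  (p * (m' `^ (p - 1) * a) - (p - 1) * m' `^ p) * avg k (sub w c)); last ring.
rewrite [leRHS](_ : _ =
  (p * (a `^ (p - 1) * a) - (p - 1) * a `^ p) * avg k (sub w c)); last ring.
rewrite ler_wpM2r ?(ltW W0)//.
rewrite [a `^ _ * a]mulrC mulr_powRB1//; last lra.
rewrite (_ : p * a `^ p - (p - 1) * a `^ p = a `^ p); last ring.
exact: tangent_powR.
Qed.

(** Starting from maximum 0, [doob_step] bounds [(p-1)] times the mean of [mx^p w] by [p] times that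
    of [mx^(p-1) f]. Where [mx <= T f / w] the latter is estimated directly; elsewhere
    [T = 2 p / (p - 1)] makes it half of the left-hand side, which absorbs it. *)
Lemma doob p : 1 < p -> exists2 K : R, 0 <= K & forall k w f,
  (forall s, size s = k -> 0 < w s) -> (forall s, size s = k -> 0 <= f s) ->
  avg k (fun s => w s * maxf k w f 0 s `^ p) <=
  K * avg k (fun s => f s `^ p * w s `^ (1 - p)).
Proof.
move=> p1; pose T := 2 * p / (p - 1).
have p10 : 0 < p - 1 by lra.
have T0 : 0 <= T by rewrite divr_ge0//; lra.
pose K := 2 * p * T `^ (p - 1) / (p - 1).
have K0 : 0 <= K by rewrite divr_ge0 ?mulr_ge0 ?powR_ge0//; lra.
exists K => // k w f w0 f0.
set mx := maxf k w f 0.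
have W0 : 0 < avg k w by apply: (avg_gt0 I_gt0).
have F0 : 0 <= avg k f by exact: (avg_ge0 I_gt0).
have a0 : 0 <= avg k f / avg k w by rewrite divr_ge0// ltW.
have := doob_step p1 (lexx 0) w0 f0; rewrite /= max_r//.
set a := _ / _ in a0 *; rewrite (avgB I_gt0) !avgZ -/mx => H.
have {H} H : (p - 1) * avg k (fun s => mx s `^ p * w s) <=
    p * avg k (fun s => mx s `^ (p - 1) * f s).
  rewrite -subr_ge0; apply: le_trans H.
  have -> : avg k f = a * avg k w by rewrite /a mulfVK// gt_eqF.
  rewrite [_ `^ (p - 1) * _]mulrA [_ `^ (p - 1) * _]mulrC mulr_powRB1//; last lra.
  rewrite [leRHS](_ : _ = a `^ p * avg k w); last ring.
  by rewrite mulr_ge0 ?powR_ge0// ltW.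
have H2 : p * avg k (fun s => mx s `^ (p - 1) * f s) <=
   (p - 1) / 2 * avg k (fun s => mx s `^ p * w s) +
   p * T `^ (p - 1) * avg k (fun s => f s `^ p * w s `^ (1 - p)).
  rewrite -!avgZ -avgD; apply: (le_avg I_gt0) => s sk.
  have ws := w0 s sk; have fs := f0 s sk.
  have m0 : 0 <= mx s := maxf_ge _ _ _ _ _.
  have [h|h] := leP (mx s) (T * (f s / w s)).
    apply: ler_wpDl; first by rewrite !mulr_ge0 ?powR_ge0 ?divr_ge0//; lra.
    rewrite -mulrA ler_wpM2l//; first lra.
    apply: (@le_trans _ _ ((T * (f s / w s)) `^ (p - 1) * f s)).
      by rewrite ler_wpM2r// ler_powRl//; lra.
    have fw : 0 <= f s / w s by rewrite divr_ge0// ltW.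
    have wv : 0 <= (w s)^-1 by rewrite invr_ge0 ltW.
    rewrite (powRM _ T0 fw) (powRM _ fs wv) -(mulr_powRB1 fs (lt_trans ltr01 p1)).
    rewrite -powR_inv1 ?(ltW ws)// -powRrM (_ : -1 * (p - 1) = 1 - p); last ring.
    by rewrite le_eqVlt; apply/orP; left; apply/eqP; ring.
  apply: ler_wpDr; first by rewrite !mulr_ge0 ?powR_ge0//; lra.
  have h' : f s <= (p - 1) / (2 * p) * (mx s * w s).
    move/ltW: h; rewrite mulrA ler_pdivrMr// => h.
    have : (p - 1) / (2 * p) * (T * f s) <= (p - 1) / (2 * p) * (mx s * w s).
      by rewrite ler_wpM2l// divr_ge0//; lra.
    by rewrite {1}(_ : (p - 1) / (2 * p) * (T * f s) = f s)// /T; field; lra.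
  have : p * (mx s `^ (p - 1) * f s) <=
     p * (mx s `^ (p - 1) * ((p - 1) / (2 * p) * (mx s * w s))).
    by rewrite ler_wpM2l ?ler_wpM2l ?powR_ge0//; lra.
  move/le_trans; apply; rewrite -(mulr_powRB1 m0 (lt_trans ltr01 p1)).
  by rewrite le_eqVlt; apply/orP; left; apply/eqP; field; lra.
have -> : avg k (fun s => w s * mx s `^ p) = avg k (fun s => mx s `^ p * w s).
  by apply: (eq_avg I_gt0) => s _; rewrite mulrC.
set X := avg k (fun s => mx s `^ p * w s) in H H2 *.
set Y := avg k (fun s => f s `^ p * _) in H2 *.
have : (p - 1) / 2 * X <= p * T `^ (p - 1) * Y by lra.
rewrite mulrC -ler_pdivlMr ?divr_gt0// => /le_trans; apply.
by rewrite le_eqVlt; apply/orP; left; apply/eqP; rewrite /K; field; lra.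
Qed.

Lemma carl_bound p : 1 < p -> exists2 K : R, 0 <= K & forall k S w f,
  (forall s, size s = k -> 0 < w s) -> (forall s, size s = k -> 0 <= f s) ->
  carl p k S w f <= K * avg k (fun s => f s `^ p * w s `^ (1 - p)).
Proof.
move=> p1; have [K K0 H] := doob p1; exists K => // k S w f w0 f0.
apply: le_trans (H k w f w0 f0).
apply: le_trans (carl_le_maxf I_gt0 S (lt_trans ltr01 p1) (lexx 0) w0 f0).
by rewrite powR0 ?mul0r ?addr0// gt_eqF// (lt_trans ltr01).
Qed.

Lemma form_bound2 p (c0 : R) : 2 <= p -> 0 < c0 -> exists2 K : R, 0 <= K &
  forall k S w sg D f h, sparse k S -> leaf_ap p c0 k w sg -> ap_tree p D k w sg ->
  (forall s, size s = k -> 0 <= f s) -> (forall s, size s = k -> 0 <= h s) ->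
  form k S f h <= K * D * (avg k (fun s => f s `^ p * sg s `^ (1 - p)) +
     avg k (fun s => h s `^ conj_exp p * w s `^ (1 - conj_exp p))).
Proof.
move=> p2 c00; have p1 : 1 < p by lra.
have [K1 K10 H1] := carl_bound p1.
have [K2 K20 H2] := carl_bound (conj_exp_gt1 p1).
set c1 := (c0 / 4 / 4 `^ (p - 1)) `^ (- ((p - 1) / p)).
have c10 : 0 <= c1 by exact: powR_ge0.
exists (c1 * (K1 + K2)) => [|k S w sg D f h sS lf ap f0 h0].
  by rewrite mulr_ge0 ?addr_ge0.
have w0 s : size s = k -> 0 < w s by move=> /lf[].
have s0 s : size s = k -> 0 < sg s by move=> /lf[].
have D0 : 0 <= D.
  have : avg k w * avg k sg `^ (p - 1) <= D by case: (k) ap => [|k'] [].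
  by apply: le_trans; rewrite mulr_ge0 ?powR_ge0// ltW// (avg_gt0 I_gt0).
apply: le_trans (form_le_carl I_gt0 p2 c00 sS lf ap f0 h0) _; rewrite -/c1.
have := H1 k S sg f s0 f0; have := H2 k S w h w0 h0.
set X := avg k _; set Y := avg k _ => hY hX.
have X0 : 0 <= X by apply: (avg_ge0 I_gt0) => s sk; rewrite mulr_ge0 ?powR_ge0.
have Y0 : 0 <= Y by apply: (avg_ge0 I_gt0) => s sk; rewrite mulr_ge0 ?powR_ge0.
have -> : c1 * (K1 + K2) * D * (Y + X) = c1 * D * ((K1 + K2) * (Y + X)) by ring.
rewrite ler_wpM2l ?mulr_ge0//.
have : 0 <= K1 * X + K2 * Y by rewrite addr_ge0// mulr_ge0.
lra.
Qed.

Lemma ap_tree_swap p D k w sg : 1 < p ->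
  (forall s, size s = k -> 0 < w s) -> (forall s, size s = k -> 0 < sg s) ->
  ap_tree p D k w sg -> ap_tree (conj_exp p) (D `^ (p - 1)^-1) k sg w.
Proof.
move=> p1; have root k' w' sg' : (forall s, size s = k' -> 0 < w' s) ->
    (forall s, size s = k' -> 0 < sg' s) ->
    avg k' w' * avg k' sg' `^ (p - 1) <= D ->
    avg k' sg' * avg k' w' `^ (conj_exp p - 1) <= D `^ (p - 1)^-1.
  move=> w0 s0 H; rewrite conj_expB1//.
  have W0 : 0 < avg k' w' by apply: (avg_gt0 I_gt0).
  have S0 : 0 < avg k' sg' by apply: (avg_gt0 I_gt0).
  have p0 : p - 1 != 0 by rewrite gt_eqF//; lra.
  have -> : avg k' sg' * avg k' w' `^ (p - 1)^-1 =
      (avg k' w' * avg k' sg' `^ (p - 1)) `^ (p - 1)^-1.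
    by rewrite (powRM _ (ltW W0) (powR_ge0 _ _)) -powRrM mulfV// powRr1 ?(ltW S0)// mulrC.
  apply: ler_powRl => //; first by rewrite invr_ge0; lra.
  by rewrite mulr_ge0 ?powR_ge0// ltW.
elim: k w sg => [|k IH] w sg w0 s0 [H Hc]; split => //.
- exact: (root 0).
- exact: (root k.+1).
- by move=> c; apply: IH (Hc c) => s sk; [apply: w0|apply: s0]; rewrite /= sk.
Qed.

Lemma leaf_ap_swap p (c0 : R) k w sg : 1 < p -> 0 < c0 -> leaf_ap p c0 k w sg ->
  leaf_ap (conj_exp p) (c0 `^ (p - 1)^-1) k sg w.
Proof.
move=> p1 c00 lf s sk; have [w0 s0 cs] := lf s sk; split => //.
have p0 : p - 1 != 0 by rewrite gt_eqF//; lra.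
rewrite conj_expB1//.
have -> : sg s * w s `^ (p - 1)^-1 = (w s * sg s `^ (p - 1)) `^ (p - 1)^-1.
  by rewrite (powRM _ (ltW w0) (powR_ge0 _ _)) -powRrM mulfV// powRr1 ?(ltW s0)// mulrC.
by apply: ler_powRl; rewrite ?(ltW c00)// invr_ge0; lra.
Qed.

Definition ap_exp p := Num.max 1 (p - 1)^-1.

(** For [p < 2] the symmetric form is read with the two weights exchanged and the conjugate
    exponent, which is at least 2. The constant of the dual weight is [D] to the power [1/(p-1)],
    which explains the maximum in [ap_exp]. *)
Lemma form_bound p (c0 : R) : 1 < p -> 0 < c0 -> exists2 K : R, 0 < K &
  forall k S w sg D f h, sparse k S -> leaf_ap p c0 k w sg -> ap_tree p D k w sg ->
  (forall s, size s = k -> 0 <= f s) -> (forall s, size s = k -> 0 <= h s) ->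
  form k S f h <= K * D `^ ap_exp p * (avg k (fun s => f s `^ p * sg s `^ (1 - p)) +
     avg k (fun s => h s `^ conj_exp p * w s `^ (1 - conj_exp p))).
Proof.
move=> p1 c00.
suff [K K0 H] : exists2 K : R, 0 <= K &
  forall k S w sg D f h, sparse k S -> leaf_ap p c0 k w sg -> ap_tree p D k w sg ->
  (forall s, size s = k -> 0 <= f s) -> (forall s, size s = k -> 0 <= h s) ->
  form k S f h <= K * D `^ ap_exp p * (avg k (fun s => f s `^ p * sg s `^ (1 - p)) +
     avg k (fun s => h s `^ conj_exp p * w s `^ (1 - conj_exp p))).
  exists (K + 1) => [|k S w sg D f h sS lf ap f0 h0]; first by rewrite ltr_wpDl.
  apply: le_trans (H k S w sg D f h sS lf ap f0 h0) _.
  rewrite -!mulrA ler_wpM2r ?lerDl// mulr_ge0 ?powR_ge0// addr_ge0//;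
    by apply: (avg_ge0 I_gt0) => s sk; rewrite mulr_ge0 ?powR_ge0.
have Dge0 k w sg D : leaf_ap p c0 k w sg -> ap_tree p D k w sg -> 0 <= D.
  move=> lf ap; have : avg k w * avg k sg `^ (p - 1) <= D by case: (k) ap => [|k'] [].
  by apply: le_trans; rewrite mulr_ge0 ?powR_ge0// ltW// (avg_gt0 I_gt0)// => s /lf[].
have [p2|p2] := leP 2 p.
  have [K K0 H] := form_bound2 p2 c00; exists K => // k S w sg D f h sS lf ap f0 h0.
  rewrite (_ : ap_exp p = 1) ?powRr1; [exact: H|exact: Dge0 ap|].
  by rewrite /ap_exp max_l// invf_le1; lra.
have q2 : 2 <= conj_exp p by rewrite /conj_exp ler_pdivlMr; lra.
have [K K0 H] := form_bound2 q2 (powR_gt0 (p - 1)^-1 c00).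
exists K => // k S w sg D f h sS lf ap f0 h0.
rewrite (form_sym I_gt0) (_ : ap_exp p = (p - 1)^-1); last first.
  by rewrite /ap_exp max_r// invf_ge1; lra.
rewrite [_ + avg k _]addrC.
have := H k S sg w (D `^ (p - 1)^-1) h f sS (leaf_ap_swap p1 c00 lf) _ h0 f0.
rewrite conj_expK//; apply.
by apply: ap_tree_swap => // s /lf[].
Qed.

(* The bound for the sparse operator follows from the one for its form by testing
   against a multiple of its [p-1]st power times the weight. *)
Lemma spsum_bound p (c0 : R) : 1 < p -> 0 < c0 -> exists2 K : R, 0 < K &
  forall k S w sg D f, sparse k S -> leaf_ap p c0 k w sg -> ap_tree p D k w sg ->
  0 < D -> (forall s, size s = k -> 0 <= f s) ->
  avg k (fun s => spsum k S f s `^ p * w s) <=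
  (K * D `^ ap_exp p) `^ p * avg k (fun s => f s `^ p * sg s `^ (1 - p)).
Proof.
move=> p1 c00; have [K K0 H] := form_bound p1 c00.
exists (2 * K) => [|k S w sg D f sS lf ap D0 f0]; first by rewrite mulr_gt0.
set q := conj_exp p in H.
have q1 : 1 < q := conj_exp_gt1 p1.
have L0 : 0 < 2 * K * D `^ ap_exp p by rewrite !mulr_gt0// powR_gt0.
set L := 2 * K * _ in L0 *.
pose X := spsum k S f.
have X0 s : size s = k -> 0 <= X s by exact: spsum_ge0.
(* Makes [t^q = t / L], so that the term in [h], which has coefficient [L / 2], is half of the
   left-hand side and can be absorbed. *)
pose t := L `^ (- (p - 1)).
have t0 : 0 < t by exact: powR_gt0.
pose h s := t * (X s `^ (p - 1) * w s).
have w0 s : size s = k -> 0 < w s by move=> /lf[].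
have h0 s : size s = k -> 0 <= h s.
  by move=> sk; rewrite !mulr_ge0 ?powR_ge0 ?(ltW t0) ?(ltW (w0 s sk)).
have := H k S w sg D f h sS lf ap f0 h0.
have -> : form k S f h = t * avg k (fun s => X s `^ p * w s).
  rewrite /form -avgZ; apply: (eq_avg I_gt0) => s sk.
  by rewrite -/(X s) -(mulr_powRB1 (X0 s sk) (lt_trans ltr01 p1)) /h; ring.
have -> : avg k (fun s => h s `^ q * w s `^ (1 - q)) =
    t `^ q * avg k (fun s => X s `^ p * w s).
  rewrite -avgZ; apply: (eq_avg I_gt0) => s sk.
  have wp := w0 s sk.
  rewrite (powRM _ (ltW t0)) ?mulr_ge0 ?powR_ge0 ?(ltW wp)//.
  rewrite (powRM _ (powR_ge0 _ _) (ltW wp)) -powRrM conj_expM// -!mulrA.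
  by rewrite -powR_addp// (_ : q + (1 - q) = 1) ?powRr1 ?ltW//; ring.
set Z := avg k (fun s => X s `^ p * w s).
set A := avg k _ => HH.
have tq : t `^ q = t * L^-1.
  rewrite -(mulr_powRB1 (ltW t0) (lt_trans ltr01 q1)) conj_expB1// /t -powRrM.
  rewrite (_ : - (p - 1) * (p - 1)^-1 = -1) ?powR_inv1 ?ltW//.
  by field; lra.
have HL : K * D `^ ap_exp p = L / 2 by rewrite /L; field.
rewrite HL tq in HH.
have : t * (Z / 2) <= L / 2 * A.
  have -> : t * (Z / 2) = t * Z - L / 2 * (t / L * Z) by field; rewrite gt_eqF.
  lra.
rewrite mulrA ler_pdivrMr// => h1.
have {}h1 : Z * t <= L * A by rewrite mulrC; apply: le_trans h1 _; lra.
rewrite -ler_pdivlMr// in h1; apply: (le_trans h1).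
rewrite /t powRN invrK mulrAC mulr_powRB1// ?ltW//; lra.
Qed.

(** The left-hand side is what testing with the optimal multiple produces; the right-hand side shows
    it as a [p]-th power in which the two sparse constants [L1] and [L2] are multiplied. *)
Lemma test_constant p (B L1 L2 c : R) : 1 < p -> 0 < B -> 0 < L1 -> 0 < L2 -> 0 < c ->
  2 * B * L1 `^ p * (2 * B * (c * L2 `^ conj_exp p)) `^ (p - 1) =
  (2 * B * (L1 * L2) * c `^ ((p - 1) / p)) `^ p.
Proof.
move=> p1 B0 L10 L20 c0; have p0 : 0 < p := lt_trans ltr01 p1.
have B20 : 0 <= 2 * B by rewrite mulr_ge0// ltW.
have LL0 : 0 <= L1 * L2 by rewrite mulr_ge0// ltW.
have lq : 0 <= L2 `^ conj_exp p by exact: powR_ge0.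
have cq : 0 <= c `^ ((p - 1) / p) by exact: powR_ge0.
rewrite (powRM _ B20 (mulr_ge0 (ltW c0) lq)) (powRM _ (ltW c0) lq).
rewrite (powRM _ (mulr_ge0 B20 LL0) cq) (powRM _ B20 LL0) (powRM _ (ltW L10) (ltW L20)).
rewrite -(mulr_powRB1 B20 p0) -!powRrM [conj_exp p * _]mulrC conj_expM//.
rewrite mulfVK ?gt_eqF//; ring.
Qed.

(** * The weighted commutator bound on a finite tree *)
Theorem commutator_tree_bound p (c0 C : R) : 1 < p -> 0 < c0 -> 0 <= C ->
  exists2 K : R, 0 <= K & forall k kap u b w sg D beta,
  kernel_bound C kap -> bmo_tree k b beta ->
  leaf_ap p c0 k w sg -> ap_tree p D k w sg -> 0 < D ->
  avg k (fun s => `|b s * mtrans k kap u s - mtrans k kap (fun s => b s * u s) s| `^ p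
    * w s) <=
  (K * D `^ (2 * ap_exp p) * beta) `^ p *
    avg k (fun s => `|u s| `^ p * sg s `^ (1 - p)).
Proof.
move=> p1 c00 C0; pose q := conj_exp p.
have q1 : 1 < q := conj_exp_gt1 p1.
have p0 : 0 < p - 1 by lra.
have pn : p - 1 != 0 by rewrite gt_eqF.
have [K1 K10 H1] := spsum_bound p1 c00.
pose c2 := c0 `^ (p - 1)^-1.
have c20 : 0 < c2 by exact: powR_gt0.
have [K2 K20 H2] := spsum_bound q1 c20.
have [T TE] : exists T, T = 2000 * C * M ^+ 3 by exists (2000 * C * M ^+ 3).
have T0 : 0 <= T.
  by rewrite TE; apply: mulr_ge0; [apply: mulr_ge0 C0; exact: ler0n|exact/exprn_ge0/ler0n].
(* [B] below is [T beta]; the constant comes from [t = (2 B c2^-1 L2^q)^(1-p)]. *)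
pose K := 2 * T * K1 * K2 * (c2^-1 `^ ((p - 1) / p)).
exists K => [|k kap u b w sg D beta kb bb lf ap D0].
  by rewrite !mulr_ge0 ?powR_ge0// ltW.
have w0 s : size s = k -> 0 < w s by move=> /lf[].
have s0 s : size s = k -> 0 < sg s by move=> /lf[].
pose F s := b s * mtrans k kap u s - mtrans k kap (fun s => b s * u s) s.
pose B := T * beta.
have beta0 : 0 <= beta.
  have : avg k (fun s => `|b s - avg k b|) <= beta by case: (k) bb => [|k'] [].
  by apply: le_trans; exact: avg_ge0.
have B0 : 0 <= B by rewrite mulr_ge0.
pose L1 := K1 * D `^ ap_exp p.
pose L2 := K2 * (D `^ (p - 1)^-1) `^ ap_exp q.
have L10 : 0 < L1 by rewrite mulr_gt0// powR_gt0.
have L20 : 0 < L2 by rewrite mulr_gt0// !powR_gt0.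
set Z := avg k (fun s => `|F s| `^ p * w s).
set A := avg k (fun s => `|u s| `^ p * _).
have A0 : 0 <= A by apply: (avg_ge0 I_gt0) => s sk; rewrite mulr_ge0 ?powR_ge0.
have Z0 : 0 <= Z.
  by apply: (avg_ge0 I_gt0) => s sk; rewrite mulr_ge0 ?powR_ge0// ltW// w0.
(* testing against [g = t sgn(F) |F|^(p-1) w] *)
have key (t : R) : 0 < t -> t * Z <= B * (L1 `^ p * A + c2^-1 * L2 `^ q * (t `^ q * Z)).
  move=> t0; pose g s : R := t * (Num.sg (F s) * (`|F s| `^ (p - 1) * w s)).
  have ag s : size s = k -> `|g s| <= t * (`|F s| `^ (p - 1) * w s).
    move=> sk; rewrite /g normrM (gtr0_norm t0) ler_wpM2l ?(ltW t0)//.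
    rewrite normrM [X in _ * X]ger0_norm ?mulr_ge0 ?powR_ge0 ?(ltW (w0 s sk))//.
    rewrite ler_piMl ?mulr_ge0 ?powR_ge0 ?(ltW (w0 s sk))//.
    by rewrite normr_sg; case: (_ != 0).
  have [S [_ sS _ dom]] := sparse_domination I_gt0 C0 u g kb bb.
  have comE : comform k kap u g b = t * Z.
    rewrite /comform /mform -(avgB I_gt0) /Z -avgZ; apply: (eq_avg I_gt0) => s sk.
    rewrite -(mulr_powRB1 (normr_ge0 (F s)) (lt_trans ltr01 p1)).
    rewrite [LHS](_ : _ = F s * g s); last by rewrite /F; ring.
    by rewrite /g; set P := _ `^ (p - 1); rewrite normrEsg; ring.
  rewrite -comE; apply: le_trans (ler_norm _) _; apply: (le_trans dom).
  rewrite -TE -/B ler_wpM2l//.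
  have f0 (f : seq I -> R) s : size s = k -> 0 <= tree_abs f s by move=> _; exact: normr_ge0.
  have b1 := H1 k S w sg D (tree_abs u) sS lf ap D0 (f0 u).
  have lf' : leaf_ap q c2 k sg w by exact: leaf_ap_swap.
  have ap' : ap_tree q (D `^ (p - 1)^-1) k sg w by exact: ap_tree_swap.
  have b2 := H2 k S sg w _ (tree_abs g) sS lf' ap' (powR_gt0 _ D0) (f0 g).
  (* Young's inequality after inserting [w^(1/p) w^(-1/p)]. The second factor acquires the weight
     [w^(-1/(p-1))], which the leaf condition bounds by [c2^-1 * sg]. *)
  apply: (@le_trans _ _ (avg k (fun s => spsum k S (tree_abs u) s `^ p * w s) +
      c2^-1 * avg k (fun s => spsum k S (tree_abs g) s `^ q * sg s))).
    rewrite -avgZ -avgD; apply: (le_avg I_gt0) => s sk.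
    have [wp sp cs] := lf s sk; set x := spsum _ _ _ _; set y := spsum _ _ _ _.
    have x0 : 0 <= x by apply: spsum_ge0 => // s' /f0; apply.
    have y0 : 0 <= y by apply: spsum_ge0 => // s' /f0; apply.
    have -> : x * y = (x * w s `^ p^-1) * (y * w s `^ (- p^-1)).
      rewrite mulrACA -powR_addp// subrr powRr0 mulr1//.
    have xw : 0 <= x * w s `^ p^-1 by rewrite mulr_ge0 ?powR_ge0.
    have yw : 0 <= y * w s `^ (- p^-1) by rewrite mulr_ge0 ?powR_ge0.
    apply: le_trans (young_powR p1 xw yw) _.
    rewrite (powRM _ x0 (powR_ge0 _ _)) (powRM _ y0 (powR_ge0 _ _)) -!powRrM.
    rewrite mulVf ?gt_eqF ?(lt_trans ltr01 p1)// powRr1 ?(ltW wp)// lerD2l.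
    rewrite [leRHS]mulrCA ler_wpM2l ?powR_ge0//.
    have -> : - p^-1 * conj_exp p = - (p - 1)^-1.
      by rewrite /conj_exp; field; rewrite pn gt_eqF// (lt_trans ltr01).
    rewrite powRN -[leLHS]mul1r ler_pdivrMr ?powR_gt0// -mulrA ler_pdivlMl// mulr1.
    have -> : sg s * w s `^ (p - 1)^-1 = (w s * sg s `^ (p - 1)) `^ (p - 1)^-1.
      rewrite (powRM _ (ltW wp) (powR_ge0 _ _)) -powRrM mulfV// powRr1 ?(ltW sp)//.
      exact: mulrC.
    by apply: ler_powRl; rewrite ?(ltW c00)// invr_ge0 ltW.
  rewrite -/L1 -/L2 in b1 b2 *.
  apply: lerD; first exact: b1.
  rewrite -mulrA ler_wpM2l ?invr_ge0 ?(ltW c20)//; apply: (le_trans b2).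
  rewrite ler_wpM2l ?powR_ge0// -avgZ; apply: (le_avg I_gt0) => s sk.
  have wp := w0 s sk.
  apply: (@le_trans _ _ ((t * (`|F s| `^ (p - 1) * w s)) `^ q * w s `^ (1 - q))).
    by rewrite ler_wpM2r ?powR_ge0// ler_powRl ?normr_ge0 ?ag// (ltW (lt_trans ltr01 q1)).
  rewrite (powRM _ (ltW t0)) ?mulr_ge0 ?powR_ge0 ?(ltW wp)//.
  rewrite (powRM _ (powR_ge0 _ _) (ltW wp)) -powRrM conj_expM// -!mulrA.
  have -> : 1 - q = - (q - 1) by ring.
  rewrite powRN -{1}(mulr_powRB1 (ltW wp) (lt_trans ltr01 q1)) mulfK//.
  by rewrite gt_eqF// powR_gt0.
have [B00|Bn0] := eqVneq B 0.
  have := key 1 ltr01; rewrite B00 mul0r mul1r => /le_trans; apply.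
  by rewrite mulr_ge0 ?powR_ge0.
have Bp : 0 < B by rewrite lt_def Bn0.
pose L := 2 * B * (c2^-1 * L2 `^ q).
have L0 : 0 < L.
  apply: mulr_gt0; first exact: mulr_gt0.
  by apply: mulr_gt0; rewrite ?invr_gt0// powR_gt0.
have := key (L `^ (- (p - 1))) (powR_gt0 _ L0).
set t := L `^ _; have t0 : 0 < t by exact: powR_gt0.
have -> : t `^ q = t * L^-1.
  rewrite -(mulr_powRB1 (ltW t0) (lt_trans ltr01 q1)) conj_expB1// /t -powRrM.
  rewrite (_ : - (p - 1) * (p - 1)^-1 = -1) ?powR_inv1 ?ltW//.
  by field.
have -> : B * (L1 `^ p * A + c2^-1 * L2 `^ q * (t * L^-1 * Z)) =
  B * L1 `^ p * A + t * Z / 2.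
  have aux (B' c' l t' L' Z' X A' : R) : L' != 0 -> B' * (c' * l) = L' / 2 ->
      B' * (X * A' + c' * l * (t' * L'^-1 * Z')) = B' * X * A' + t' * Z' / 2.
    move=> L'0 e; have -> : B' * (X * A' + c' * l * (t' * L'^-1 * Z')) =
      B' * X * A' + B' * (c' * l) * (t' * L'^-1 * Z') by ring.
    by rewrite e; field.
  apply: aux; first by rewrite gt_eqF.
  by rewrite /L -[2 * B * _]mulrA [RHS]mulrAC divff ?mul1r// pnatr_eq0.
have aux (x b' l a : R) : x <= b' * l * a + x / 2 -> x <= 2 * b' * l * a.
  by rewrite -!mulrA; set y := b' * _ => h; lra.
move=> /aux; rewrite [t * Z]mulrC.
rewrite -ler_pdivlMr// => /le_trans; apply.
rewrite /t powRN invrK mulrAC ler_wpM2r//.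
rewrite le_eqVlt; apply/orP; left; apply/eqP.
(* [max(1, p - 1) / (p - 1) = max(1, 1/(p-1))]: the dual sparse bound has the same power of [D] as
   the first one, whence the factor 2 in the exponent. *)
have LL2 : L2 = K2 * D `^ ap_exp p.
  rewrite /L2; congr (_ * _); rewrite -powRrM; congr (_ `^ _).
  rewrite /ap_exp conj_expB1// invrK; have [h|h] := leP 1 (p - 1).
    by rewrite mulVf// max_l// invf_le1.
  by rewrite mulr1 max_r// invf_ge1// ltW.
have De0 : 0 < D `^ ap_exp p by exact: powR_gt0.
have e1 : K * D `^ (2 * ap_exp p) * beta = (2 * B) * (L1 * L2) * c2^-1 `^ ((p - 1) / p).
  rewrite /K /B LL2 /L1 (_ : 2 * ap_exp p = ap_exp p + ap_exp p); last ring.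
  rewrite powR_addp//; ring.
have cV : 0 < c2^-1 by rewrite invr_gt0.
by rewrite e1 -test_constant.
Qed.

End weighted_bounds.

(** * Weak type (1,1) of the maximal truncation on a finite tree *)
Section weak_type.
Context {R : realType} {I : finType}.
Hypothesis I_gt0 : (0 < #|I|)%N.
Local Notation M := (#|I|%:R : R).
Implicit Types (f : seq I -> R) (k : nat) (c : I) (s : seq I).
Implicit Types (kap : seq I -> I -> I -> R).

(* Along the branch [s], some average of [|f|] or some partial sum of [mtrans], shifted
   by [x], exceeds [lam]. *)
Fixpoint bad k kap f (lam x : R) s : bool :=
  [|| lam < `|x|, lam < avg k (tree_abs f) |
  (if k is k'.+1 then if s is c :: s' then
     bad k' (sub kap c) (sub f c) lam
       (x + M^-1 * (\sum_c' kap [::] c c' * avg k' (sub f c'))) s'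
   else false else false)].

(* The right-hand side is a Bellman function: the cancellation of the kernel makes the
   average of its values at the children at most its value at the node. *)
Lemma weak_type_aux (C lam : R) k kap f x : 0 <= C -> 0 < lam ->
  kernel_bound C kap -> avg k (tree_abs f) <= M * lam ->
  avg k (fun s => (bad k kap f lam x s)%:R) <=
  (1 + C ^+ 2 * M) / lam * avg k (tree_abs f) +
  (x ^+ 2 - C ^+ 2 * avg k f ^+ 2) / lam ^+ 2.
Proof.
move=> C0 lam0.
have M0 := M_gt0 I_gt0 : 0 < M.
have l2 : 0 < lam ^+ 2 by rewrite exprn_gt0.
(* Nonnegativity of the Bellman function: as long as the average is at most [M * lam], the negative
   quadratic term is dominated by a part of the linear one. *)
have small k' (f' : seq I -> R) : avg k' (tree_abs f') <= M * lam ->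
    C ^+ 2 * avg k' f' ^+ 2 / lam ^+ 2 <= C ^+ 2 * M / lam * avg k' (tree_abs f').
  move=> h; have a0 := avg_tree_abs_ge0 I_gt0 k' f'.
  have h1 : avg k' f' ^+ 2 <= avg k' (tree_abs f') ^+ 2.
    by rewrite -[leLHS]real_normK ?num_real// lerXn2r ?nnegrE// ler_norm_avg.
  have h2 : avg k' (tree_abs f') ^+ 2 <= M * lam * avg k' (tree_abs f').
    by rewrite expr2 ler_wpM2r.
  rewrite ler_pdivrMr//.
  have -> : C ^+ 2 * M / lam * avg k' (tree_abs f') * lam ^+ 2 =
    C ^+ 2 * (M * lam * avg k' (tree_abs f')) by field; rewrite gt_eqF.
  by rewrite ler_wpM2l ?sqr_ge0//; exact: le_trans h2.
have a0' k' (f' : seq I -> R) : 0 <= avg k' (tree_abs f') / lam.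
  by rewrite divr_ge0 ?(ltW lam0)// avg_tree_abs_ge0.
have eqb k' (f' : seq I -> R) (y : R) :
   (1 + C ^+ 2 * M) / lam * avg k' (tree_abs f') +
   (y ^+ 2 - C ^+ 2 * avg k' f' ^+ 2) / lam ^+ 2 =
   avg k' (tree_abs f') / lam + y ^+ 2 / lam ^+ 2 +
   (C ^+ 2 * M / lam * avg k' (tree_abs f') - C ^+ 2 * avg k' f' ^+ 2 / lam ^+ 2).
  by ring.
have y0 (y : R) : 0 <= y ^+ 2 / lam ^+ 2 by rewrite divr_ge0 ?sqr_ge0 ?ltW.
have sum3 (a b e : R) : 0 <= a -> 0 <= b -> 0 <= e -> 1 <= a \/ 1 <= b -> 1 <= a + b + e.
  by move=> ? ? ? []; lra.
have far (y : R) : lam < `|y| -> 1 <= y ^+ 2 / lam ^+ 2.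
  move=> ly; rewrite ler_pdivlMr// mul1r -[y ^+ 2]real_normK ?num_real//.
  by rewrite lerXn2r ?nnegrE ?(ltW lam0) ?(ltW ly).
elim: k kap f x => [|k IH] kap f x kb fM; rewrite eqb.
  have := small _ _ fM; rewrite -subr_ge0.
  set E := _ - _ => E0; rewrite [leLHS]/= orbF; case: ltP => h1 /=.
    by apply: sum3 (a0' 0%N f) (y0 x) E0 _; right; exact: far.
  case: ltP => h2 /=.
    apply: sum3 (a0' 0%N f) (y0 x) E0 _; left.
    by rewrite ler_pdivlMr// mul1r ltW.
  exact: (addr_ge0 (addr_ge0 (a0' 0%N f) (y0 x)) E0).
have := small _ _ fM; rewrite -subr_ge0.
set E := _ - _ => E0.
have le1 : avg k.+1 (fun s => (bad k.+1 kap f lam x s)%:R) <= 1 :> R.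
  rewrite -[leRHS](avg_cst I_gt0 k.+1); apply: (le_avg I_gt0) => s _.
  by rewrite lern1; case: (bad _ _ _ _ _ _).
have [h1|h1] := ltP lam `|x|.
  apply: (le_trans le1).
  by apply: sum3 (a0' k.+1 f) (y0 x) E0 _; right; exact: far.
have [h2|h2] := ltP lam (avg k.+1 (tree_abs f)).
  apply: (le_trans le1).
  apply: sum3 (a0' k.+1 f) (y0 x) E0 _; left.
  by rewrite ler_pdivlMr// mul1r ltW.
pose d c := M^-1 * (\sum_c' kap [::] c c' * avg k (sub f c')).
have [kb1 kb2 kb3] := kb.
have d_mean : M^-1 * \sum_c d c = 0.
  rewrite /d -mulr_sumr exchange_big big1/= ?mulr0// => c' _.
  by rewrite -mulr_suml kb3 mul0r.
pose m := M^-1 * \sum_c avg k (sub f c).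
have dE c : d c = M^-1 * (\sum_c' kap [::] c c' * (avg k (sub f c') - m)).
  under eq_bigr do rewrite mulrBr.
  by rewrite sumrB -mulr_suml kb2 mul0r subr0.
have jensen (y : I -> R) : (M^-1 * \sum_c y c) ^+ 2 <= M^-1 * \sum_c y c ^+ 2.
  rewrite -subr_ge0 -/(vari y) -(vari_mean I_gt0).
  by rewrite mulr_ge0 ?invr_ge0 ?sumr_ge0// => c _; exact: sqr_ge0.
(* As [d] has mean zero by the column sums, [x ^+ 2] grows on average by the mean of [d c ^+ 2]. The
   row sums centre the averages, and Jensen's inequality bounds this by [C ^+ 2] times their
   variance, exactly what the term [- C ^+ 2 * avg ^+ 2] gives back. *)
have d2 c : d c ^+ 2 <= C ^+ 2 * (M^-1 * \sum_c avg k (sub f c) ^+ 2 - m ^+ 2).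
  rewrite dE; apply: le_trans (jensen _) _.
  rewrite -/(vari (fun c => avg k (sub f c))) -(vari_mean I_gt0) -/m -meanZ.
  apply: (le_mean I_gt0) => c'; rewrite exprMn ler_wpM2r ?sqr_ge0//.
  by rewrite -[leLHS]real_normK ?num_real// lerXn2r ?nnegrE.
apply: (@le_trans _ _ (M^-1 * \sum_c ((1 + C ^+ 2 * M) / lam * avg k (tree_abs (sub f c)) +
   ((x + d c) ^+ 2 - C ^+ 2 * avg k (sub f c) ^+ 2) / lam ^+ 2))).
  rewrite [leLHS]/=; apply: (le_mean I_gt0) => c.
  have fcM : avg k (tree_abs (sub f c)) <= M * lam.
    have f0 s : size s = k.+1 -> 0 <= tree_abs f s by move=> _; exact: normr_ge0.
    by apply: le_trans (avg_child_le I_gt0 c f0) _; rewrite ler_pM2l.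
  apply: le_trans (IH _ _ (x + d c) (kernel_bound_sub c kb) fcM).
  apply: (le_avg I_gt0) => s _.
  rewrite /sub/= -/(avg k.+1 (tree_abs f)) (le_gtF h1) (le_gtF h2)/=.
  by [].
rewrite meanD meanZ.
have -> : M^-1 * (\sum_c avg k (tree_abs (sub f c))) = avg k.+1 (tree_abs f) by [].
have -> : M^-1 * (\sum_c ((x + d c) ^+ 2 - C ^+ 2 * avg k (sub f c) ^+ 2) / lam ^+ 2) =
   (x ^+ 2 + M^-1 * (\sum_c d c ^+ 2) - C ^+ 2 * (M^-1 * \sum_c avg k (sub f c) ^+ 2)) / lam ^+ 2.
  rewrite -mulr_suml mulrA; congr (_ / _).
  rewrite meanB meanZ; congr (_ - _).
  have -> : \sum_c (x + d c) ^+ 2 = \sum_c (x ^+ 2 + ((2 * x) * d c + d c ^+ 2)).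
    by apply: eq_bigr => c _; ring.
  by rewrite !meanD (mean_cst I_gt0) meanZ d_mean mulr0 add0r.
have d2m : M^-1 * (\sum_c d c ^+ 2) <= C ^+ 2 * (M^-1 * \sum_c avg k (sub f c) ^+ 2 - m ^+ 2).
  by rewrite -[leRHS](mean_cst I_gt0); exact: (le_mean I_gt0).
rewrite /E -eqb lerD2l ler_wpM2r ?invr_ge0 ?(ltW l2)//.
rewrite -[avg k.+1 f]/m; move: d2m; clear; lra.
Qed.

Lemma weak_type (C lam : R) k kap f : 0 <= C -> 0 < lam -> kernel_bound C kap ->
  avg k (fun s => (bad k kap f lam 0 s)%:R) <=
  (1 + C ^+ 2 * M) / lam * avg k (tree_abs f).
Proof.
move=> C0 lam0 kb; have M0 := M_gt0 I_gt0 : 0 < M.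
have [h|h] := leP (avg k (tree_abs f)) (M * lam).
  apply: le_trans (weak_type_aux 0 C0 lam0 kb h) _.
  rewrite expr0n/= sub0r mulNr gerDl oppr_le0.
  by apply: divr_ge0; [apply: mulr_ge0|]; exact: sqr_ge0.
apply: (@le_trans _ _ 1).
  rewrite -[leRHS](avg_cst I_gt0 k); apply: (le_avg I_gt0) => s _.
  by rewrite lern1; case: (bad _ _ _ _ _ _).
rewrite mulrAC ler_pdivlMr// mul1r; apply: le_trans (ltW (le_lt_trans _ h)) _.
  by rewrite ler_peMl ?(M_ge1 I_gt0)// ltW.
by rewrite ler_peMl ?avg_tree_abs_ge0// lerDl mulr_ge0 ?sqr_ge0// ltW.
Qed.

End weak_type.

(** * Dyadic cubes *)
Section dyadic_cubes.
Context {R : realType} {n : nat}.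
Local Notation mu := (lebesgue_Rn n : {measure set (Rn R n) -> \bar R}).
Implicit Types (x y : Rn R n) (k : int) (Q : dyadic n).

Lemma pow2_gt0 k : 0 < (2 : R) ^ k.
Proof. exact: exprz_gt0. Qed.

Lemma pow2D k k' : (2 : R) ^ (k + k') = 2 ^ k * 2 ^ k'.
Proof. by rewrite expfzDr ?pnatr_eq0. Qed.

Lemma pow2_le k k' : ((2 : R) ^ k <= 2 ^ k') = (k <= k').
Proof. by rewrite ler_eXz2l ?ltr1n. Qed.

Definition cell k x : n.-tuple int := [tuple Num.floor (tnth x i / 2 ^ k) | i < n].

Lemma in_dcube Q x : dcube Q x <-> cell Q.1 x = Q.2.
Proof.
case: Q => k m; pose Q : dyadic n := (k, m); rewrite -/Q.
have E i : (2 ^ Q.1 * (tnth Q.2 i)%:~R <= tnth x i < 2 ^ Q.1 * (tnth Q.2 i)%:~R + 2 ^ Q.1) =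
    (Num.floor (tnth x i / 2 ^ Q.1) == tnth Q.2 i).
  rewrite floor_eq intrD1 ler_pdivlMr ?pow2_gt0// ltr_pdivrMr ?pow2_gt0//.
  by rewrite mulrDl mul1r [_ * 2 ^ _]mulrC.
split=> [xQ|xQ i].
  apply: eq_from_tnth => i; rewrite tnth_mktuple; apply/eqP; rewrite -E.
  by have := xQ i; rewrite !tnth_mktuple.
by rewrite !tnth_mktuple E -xQ tnth_mktuple.
Qed.

(** An integer is below a floor exactly when it is below the number, so coarsening by [j]
    generations multiplies the integer by [2 ^+ j]. The nesting of dyadic cubes follows without
    dividing integers. *)
Lemma cell_geS (j : nat) k x i (m : int) :
  (m <= tnth (cell (k + j%:Z) x) i) = (m * 2 ^+ j <= tnth (cell k x) i).
Proof.
rewrite !tnth_mktuple !floor_ge_int pow2D !ler_pdivlMr ?mulr_gt0 ?pow2_gt0//.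
by rewrite rmorphM rmorphXn/= -mulrA [2 ^+ j * _]mulrC.
Qed.

Lemma cell_mono k k' x y : k <= k' -> cell k x = cell k y -> cell k' x = cell k' y.
Proof.
move=> kk' xy; have e : k' = k + `|k' - k|%N by rewrite gez0_abs ?subr_ge0//; ring.
rewrite e; apply: eq_from_tnth => i; apply/le_anti.
by rewrite cell_geS -xy -cell_geS lexx cell_geS xy -cell_geS lexx.
Qed.

Lemma measurable_box (a b : Rn R n) : measurable (box a b).
Proof.
rewrite (_ : box a b = \bigcap_(i in setT)
    ((@tnth _ _ ^~ i) @^-1` `[tnth a i, tnth b i[%classic)); last first.
  apply/seteqP; split => x abx i; first by move=> _ /=; rewrite in_itv/= abx.
  by have /= := abx i I; rewrite in_itv.
apply: (@fin_bigcap_measurable _ (Rn R n)) => [|i _]; first exact: finite_finset.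
rewrite -[X in measurable X]setTI.
apply: (@measurable_tnth _ (measurableTypeR R) n i measurableT).
exact: measurable_itv.
Qed.

Lemma measurable_dcube Q : measurable (dcube Q : set (Rn R n)).
Proof. exact: measurable_box. Qed.

Lemma mu_cube (a : Rn R n) (l : R) : 0 <= l -> mu (cube a l) = (l ^+ n)%:E.
Proof.
move=> l0; rewrite /cube /= lebesgue_Rn_box => [|i]; last by rewrite tnth_mktuple lerDl.
congr EFin; rewrite (eq_bigr (fun=> l)) ?prodr_const ?card_ord// => i _.
by rewrite tnth_mktuple addrC addKr.
Qed.

Lemma dvolE Q : dvol R Q = (2 ^ Q.1) ^+ n.
Proof. by rewrite /dvol /vol mu_cube// ltW// pow2_gt0. Qed.

Lemma mu_dcube Q : mu (dcube Q) = (dvol R Q)%:E.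
Proof. by rewrite dvolE mu_cube// ltW// pow2_gt0. Qed.

Lemma dvol_gt0 Q : 0 < dvol R Q.
Proof. by rewrite dvolE exprn_gt0// pow2_gt0. Qed.

Definition corner Q : Rn R n := [tuple 2 ^ Q.1 * (tnth Q.2 i)%:~R | i < n].

Lemma corner_in Q : dcube Q (corner Q).
Proof. by move=> i; rewrite !tnth_mktuple lexx ltrDl pow2_gt0. Qed.

Lemma dcube_cubes Q : cubes (dcube Q : set (Rn R n)).
Proof. by exists (corner Q), (2 ^ Q.1) => //; exact: pow2_gt0. Qed.

Lemma dcube_cell k x : dcube (k, cell k x) x.
Proof. exact/in_dcube. Qed.

Lemma dcube_eq Q x : dcube Q x -> Q = (Q.1, cell Q.1 x).
Proof. by move=> /in_dcube ->; case: Q. Qed.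

Lemma subcubes_nested Q Q' x : Q'.1 <= Q.1 -> dcube Q x -> dcube Q' x ->
  subcubes R Q Q'.
Proof.
move=> h /in_dcube xQ /in_dcube xQ' y /in_dcube yQ'; apply/in_dcube.
by rewrite -xQ; apply: cell_mono h _; rewrite xQ'.
Qed.

(** By comparison of volumes; in dimension 0 all cubes coincide and the generation cannot be
    recovered. *)
Lemma subcubes_gen Q Q' : (0 < n)%N -> subcubes R Q Q' -> Q'.1 <= Q.1.
Proof.
move=> n0 sub; have : (mu (dcube Q') <= mu (dcube Q))%E.
  by apply: le_measure => //; rewrite inE; exact: measurable_dcube.
rewrite !mu_dcube lee_fin !dvolE.
by rewrite ler_pXn2r ?nnegrE ?(ltW (pow2_gt0 _))// pow2_le.
Qed.

Variable s : nat.
Definition cidx := n.-tuple 'I_(2 ^ s).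
Implicit Types (c : cidx).

Definition child Q c : dyadic n :=
  (Q.1 - s%:Z, [tuple tnth Q.2 i * 2 ^+ s + (tnth c i : nat)%:Z | i < n]).

Lemma expn2_gt0 : (0 < 2 ^ s)%N. Proof. by rewrite expn_gt0. Qed.

(** The residue makes the index total; for [x] in [Q] the difference already lies between 0 and
    [2 ^ s]. *)
Definition cidx_of Q x : cidx := [tuple
  Ordinal (ltn_pmod (absz (tnth (cell (Q.1 - s%:Z) x) i - tnth Q.2 i * 2 ^+ s)%R) expn2_gt0) | i < n].

Lemma card_cidx : #|{: cidx}| = ((2 ^ s) ^ n)%N.
Proof. by rewrite card_tuple card_ord. Qed.

Lemma pow2z : (2 ^ s)%N%:Z = 2 ^+ s.
Proof. by rewrite -natz natrX. Qed.

Lemma cidx_gt0 : (0 < #|{: cidx}|)%N.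
Proof. by rewrite card_cidx expn_gt0 expn2_gt0. Qed.

Lemma cell_ge_sub k x i (m : int) :
  (m <= tnth (cell k x) i) = (m * 2 ^+ s <= tnth (cell (k - s%:Z) x) i).
Proof. by rewrite -cell_geS subrK. Qed.

Lemma child_cidx_of Q x : dcube Q x -> dcube (child Q (cidx_of Q x)) x.
Proof.
move=> /in_dcube xQ; apply/in_dcube; apply: eq_from_tnth => i.
rewrite [RHS]tnth_mktuple [tnth (cidx_of Q x) i]tnth_mktuple /= -xQ.
set a := tnth (cell _ x) i; set b := tnth (cell _ x) i.
have h1 : b * 2 ^+ s <= a by rewrite -cell_ge_sub.
have h2 : a < (b + 1) * 2 ^+ s by rewrite ltNge -cell_ge_sub -ltNge ltzD1.
have h3 : a - b * 2 ^+ s < (2 ^ s)%N%:Z.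
  by rewrite pow2z; move: h2; rewrite mulrDl mul1r ltrBlDl.
move: h3; rewrite -[X in X < _]gez0_abs ?subr_ge0// ltz_nat => h3.
by rewrite modn_small// gez0_abs ?subr_ge0// addrC subrK.
Qed.

Lemma child_in Q c x : dcube (child Q c) x -> dcube Q x /\ c = cidx_of Q x.
Proof.
move=> /in_dcube /= xc.
have xi i : tnth (cell (Q.1 - s%:Z) x) i = tnth Q.2 i * 2 ^+ s + (tnth c i : nat)%:Z.
  by rewrite xc tnth_mktuple.
have cs i : (tnth c i : nat)%:Z < 2 ^+ s by rewrite -pow2z ltz_nat ltn_ord.
split.
  apply/in_dcube; apply: eq_from_tnth => i; apply/le_anti/andP; split.
    rewrite -ltzD1 ltNge cell_ge_sub -ltNge xi mulrDl mul1r ltrD2l; exact: cs.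
  by rewrite cell_ge_sub xi lerDl.
apply: eq_from_tnth => i; apply: val_inj; rewrite [in RHS]tnth_mktuple /=.
by rewrite xi [_ + (_ : nat)%:Z]addrC addrK absz_nat modn_small.
Qed.

Lemma dcube_children Q :
  dcube Q = \big[setU/set0]_(c : cidx) (dcube (child Q c) : set (Rn R n)).
Proof.
rewrite -bigcup_seq; apply/seteqP; split => [x xQ|x [c _ /child_in[]//]].
by exists (cidx_of Q x); [rewrite /= mem_index_enum|exact: child_cidx_of].
Qed.

Lemma trivIset_children Q :
  trivIset [set` index_enum cidx] (fun c => dcube (child Q c) : set (Rn R n)).
Proof. by move=> c d _ _ [x [/child_in[_ ->] /child_in[_ ->]]]. Qed.

Lemma dvol_child Q c : dvol R (child Q c) = dvol R Q / #|{: cidx}|%:R.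
Proof.
rewrite !dvolE /= card_cidx !natrX pow2D exprMn; congr (_ * _).
by rewrite -exprVn exprnN.
Qed.

End dyadic_cubes.

(** * Averages over dyadic cubes as functions on a tree *)

Section dyadic_averages.
Context {R : realType} {n : nat}.
Local Notation mu := (lebesgue_Rn n : {measure set (Rn R n) -> \bar R}).
Implicit Types (x y : Rn R n) (k : int) (Q : dyadic n) (f g w : Rn R n -> R).

Definition step_fun k f := forall x y, cell k x = cell k y -> f x = f y.

Definition level_set k (p : n.-tuple int -> Prop) : set (Rn R n) := [set x | p (cell k x)].

Lemma measurable_level_set k p : measurable (level_set k p).
Proof.
pose F i : set (Rn R n) := if (unpickle i : option (n.-tuple int)) is Some m then dcube (k, m) else set0.
have -> : level_set k p = \bigcup_(i in [set i | exists2 m, unpickle i = Some m & p m]) F i.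
  apply/seteqP; split => x.
    move=> px; exists (pickle (cell k x)); first by exists (cell k x); rewrite ?pickleK.
    by rewrite /F pickleK; exact: dcube_cell.
  by move=> [i [m im pm]]; rewrite /F im => /in_dcube /= xm; rewrite /level_set/= xm.
apply: bigcup_measurable => i [m im _]; rewrite /F im; exact: measurable_dcube.
Qed.

Lemma measurable_step k f : step_fun k f -> measurable_fun setT f.
Proof.
move=> kf _ Y mY; rewrite setTI.
have -> : f @^-1` Y = level_set k (fun m => exists2 x, cell k x = m & Y (f x)).
  apply/seteqP; split => x /=; first by move=> Yf; exists x.
  by move=> [y yx]; rewrite (kf _ _ yx).
exact: measurable_level_set.
Qed.

Definition dint f := measurable_fun setT f /\
  forall Q, mu.-integrable (dcube Q) (EFin \o f).

Definition avR f Q : R := (dvol R Q)^-1 * \int[mu]_(x in dcube Q) f x.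

Lemma integral_dcubeE f Q : mu.-integrable (dcube Q) (EFin \o f) ->
  (\int[mu]_(x in dcube Q) (f x)%:E = (dvol R Q * avR f Q)%:E)%E.
Proof.
move=> fi; rewrite /avR mulrA divff ?gt_eqF ?dvol_gt0// mul1r fineK//.
by apply: integrable_fin_num => //; exact: measurable_dcube.
Qed.

Variable s : nat.
Local Notation I := (@cidx n s).
Local Notation M := (#|{: I}|%:R : R).

Lemma integral_children g Q : measurable_fun setT g ->
  (\int[mu]_(x in dcube Q) (g x)%:E =
   \sum_(c : I) \int[mu]_(x in dcube (child Q c)) (g x)%:E)%E.
Proof.
move=> mg; rewrite [in LHS](dcube_children s Q) integral_bigsetU_EFin//.
- by move=> c; exact: measurable_dcube.
- exact: index_enum_uniq.
- exact: trivIset_children.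
- by apply/measurable_EFinP; exact: measurable_funTS.
Qed.

Lemma avR_children f Q : dint f -> avR f Q = M^-1 * \sum_(c : I) avR f (child Q c).
Proof.
move=> [mf fi]; have v0 := dvol_gt0 (R := R) Q.
apply: (mulfI (lt0r_neq0 v0)); apply: EFin_inj; rewrite -integral_dcubeE//.
rewrite integral_children// mulrA mulr_sumr -sumEFin; apply: eq_bigr => c _.
by rewrite integral_dcubeE// dvol_child.
Qed.

Definition node Q (l : seq I) : dyadic n := foldl (@child n s) Q l.
Definition node_avg f Q : seq I -> R := fun l => avR f (node Q l).
Local Notation avL := node_avg.

Lemma avg_avL f Q d : dint f -> avg d (avL f Q) = avR f Q.
Proof.
move=> fi; elim: d Q => //= d IH Q; rewrite (avR_children _ fi); congr (_ * _).
by apply: eq_bigr => c _; exact: IH.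
Qed.

Fixpoint addr d Q x : seq I :=
  if d is d'.+1 then cidx_of s Q x :: addr d' (child Q (cidx_of s Q x)) x else [::].

Lemma size_addr d Q x : size (addr d Q x) = d.
Proof. by elim: d Q => //= d IH Q; rewrite IH. Qed.

Lemma node_addr d Q x : dcube Q x ->
  dcube (node Q (addr d Q x)) x /\ (node Q (addr d Q x)).1 = Q.1 - (s * d)%N%:Z.
Proof.
elim: d Q => [|d IH] Q xQ /=; first by rewrite muln0 subr0.
have [h1 h2] := IH _ (child_cidx_of s xQ); split => //.
by rewrite /node/= h2 /= mulnS PoszD opprD addrA.
Qed.

Lemma step_addr d Q x y : cell (Q.1 - (s * d)%N%:Z) x = cell (Q.1 - (s * d)%N%:Z) y ->
  addr d Q x = addr d Q y.
Proof.
elim: d Q => //= d IH Q xy.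
have c1 : cell (Q.1 - s%:Z) x = cell (Q.1 - s%:Z) y.
  by apply: cell_mono xy; rewrite lerD2l lerN2 lez_nat mulnS leq_addr.
have e : cidx_of s Q x = cidx_of s Q y by rewrite /cidx_of c1.
rewrite e; congr (_ :: _); apply: IH => /=.
by move: xy; rewrite mulnS PoszD opprD addrA.
Qed.

Lemma measurable_addr d Q (Phi : seq I -> R) : measurable_fun setT (fun x => Phi (addr d Q x)).
Proof.
apply: (@measurable_step (Q.1 - (s * d)%N%:Z)) => x y xy.
by rewrite (step_addr xy).
Qed.

(** The passage from integrals to tree averages: a function constant on the last generation sees [w]
    only through its averages there. *)
Lemma integral_tree d Q (Phi : seq I -> R) w : dint w ->
  (\int[mu]_(x in dcube Q) (Phi (addr d Q x) * w x)%:E =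
   (dvol R Q * avg d (fun l => Phi l * avL w Q l))%:E)%E.
Proof.
move=> wi; have [mw iw] := wi; elim: d Q Phi => [|d IH] Q Phi.
  rewrite /=; under eq_integral do rewrite EFinM.
  by rewrite integralZl//; [rewrite integral_dcubeE// -EFinM mulrCA|exact: measurable_dcube].
rewrite integral_children; last first.
  by apply: measurable_funM => //; exact: (measurable_addr d.+1).
rewrite /= mulrA mulr_sumr -sumEFin; apply: eq_bigr => c _.
rewrite -(dvol_child _ c) -IH; apply: eq_integral => x /set_mem xc.
by have [_ ->] := child_in xc.
Qed.

Lemma avL_child f Q c : sub (avL f Q) c = avL f (child Q c).
Proof. by []. Qed.

End dyadic_averages.

(** * The blocks of a Haar shift *)
Section blocks.
Context {R : realType} {n : nat}.
Hypothesis n_gt0 : (0 < n)%N.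
Local Notation mu := (lebesgue_Rn n : {measure set (Rn R n) -> \bar R}).
Implicit Types (x y : Rn R n) (k : int) (Q : dyadic n) (f : Rn R n -> R).
Variables (tau : nat) (C0 : R) (H : dyadic n -> Rn R n -> R)
  (a : dyadic n -> dyadic n -> dyadic n -> R).
Local Notation s := tau.+1.
Local Notation I := (@cidx n s).
Local Notation M := (#|{: I}|%:R : R).
Hypothesis HH : forall Q, haar_function Q (H Q).
Hypothesis aC : forall Q Q' Q'', near_subcubes R tau Q Q' -> near_subcubes R tau Q Q'' ->
  `|a Q Q' Q''| <= C0 * Num.sqrt (dvol R Q' / dvol R Q * (dvol R Q'' / dvol R Q)).

Lemma near_gen Q Q' : near_subcubes R tau Q Q' -> Q.1 - tau%:Z <= Q'.1 <= Q.1.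
Proof.
move=> [sub hv]; rewrite (subcubes_gen n_gt0 sub) andbT.
move: hv; rewrite !dvolE exprM -exprVn -exprMn ler_pXn2r ?nnegrE//.
- by rewrite exprnN -pow2D pow2_le addrC.
- by rewrite mulr_ge0 ?ltW// ?pow2_gt0// invr_gt0 exprn_gt0.
- by rewrite ltW// pow2_gt0.
Qed.

(** A near subcube is determined by its generation, one of [s], and by any descendant of [Q] of
    generation [Q.1 - s] inside it, so this finite list contains all of them. *)
Definition near_list Q : seq (dyadic n) :=
  [seq (Q.1 - (p.1 : nat)%:Z, cell (Q.1 - (p.1 : nat)%:Z) (corner (child Q p.2) : Rn R n))
  | p : 'I_s * I <- enum {: 'I_s * I}].

Lemma near_in_list Q Q' : near_subcubes R tau Q Q' -> Q' \in near_list Q.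
Proof.
move=> nQ; have /andP[g1 g2] := near_gen nQ; have [sub _] := nQ.
pose y := corner Q' : Rn R n.
have yQ' : dcube Q' y by exact: corner_in.
have yQ : dcube Q y by exact: sub.
pose c := cidx_of s Q y.
have js : (absz (Q.1 - Q'.1) < s)%N.
  by rewrite ltnS -lez_nat gez0_abs ?subr_ge0// lerBlDr addrC -lerBlDr.
apply/mapP; exists (Ordinal js, c); first by rewrite mem_enum.
rewrite /= gez0_abs ?subr_ge0// opprB addrC subrK.
rewrite [LHS](dcube_eq yQ'); congr pair.
have yc := child_cidx_of s yQ.
apply: (@cell_mono _ _ (Q.1 - s%:Z)).
  by apply: le_trans g1; rewrite lerD2l lerN2 lez_nat.
have /in_dcube /= -> := yc.
by have /in_dcube /= -> := corner_in (R := R) (child Q c).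
Qed.

Lemma near_finite Q : finite_set (near_subcubes R tau Q).
Proof.
apply: (@sub_finite_set _ _ [set` near_list Q]); last exact: finite_seq.
by move=> Q' /near_in_list.
Qed.

Definition near Q : seq (dyadic n) :=
  finmap.enum_fset (fset_set (near_subcubes R tau Q)).

Lemma in_near Q Q' : Q' \in near Q -> near_subcubes R tau Q Q'.
Proof. by rewrite /near in_fset_set ?inE//; exact: near_finite. Qed.

Lemma size_near Q : (size (near Q) <= s * #|{: I}|)%N.
Proof.
have -> : (s * #|{: I}|)%N = size (near_list Q).
  by rewrite size_map -cardE card_prod card_ord.
apply: uniq_leq_size; first exact: finmap.fset_uniq.
by move=> Q' /in_near /near_in_list.
Qed.

Lemma fsbig_near Q (F : dyadic n -> R) :
  \sum_(Q' \in near_subcubes R tau Q) F Q' = \sum_(Q' <- near Q) F Q'.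
Proof. by rewrite fsbig_finite//; exact: near_finite. Qed.

Definition hval Q Q' (c : I) : R := H Q' (corner (child Q c)).

(** A near subcube is at most [tau] generations below [Q], so the children on which its Haar
    function is constant have generation at least [Q.1 - s]. This is the reason for
    [s = tau + 1]. *)
Lemma haar_const Q Q' c x : near_subcubes R tau Q Q' -> dcube (child Q c) x ->
  H Q' x = hval Q Q' c.
Proof.
move=> nQ xc; have /andP[g1 g2] := near_gen nQ.
have [H0 Hc _ _] := HH Q'.
have yc : dcube (child Q c) (corner (child Q c) : Rn R n) by exact: corner_in.
rewrite /hval; set y := corner _ in yc *.
have xy : cell (Q.1 - s%:Z) x = cell (Q.1 - s%:Z) y.
  by have /in_dcube /= -> := xc; have /in_dcube /= -> := yc.
have same k : Q.1 - s%:Z <= k -> cell k x = cell k y by move=> h; exact: cell_mono xy.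
have gs : Q.1 - s%:Z <= Q'.1 - 1.
  rewrite -[s]addn1 PoszD opprD addrA lerD2r//.
have [xQ'|nxQ'] := pselect (dcube Q' x); last first.
  rewrite !H0//; apply: contra_not nxQ' => /in_dcube yQ'; apply/in_dcube.
  by rewrite same//; apply: le_trans gs _; rewrite gerBl.
have [v Hv] : exists v, forall z, dcube (Q'.1 - 1, cell (Q'.1 - 1) x) z -> H Q' z = v.
  apply: Hc; split => //=; apply: (@subcubes_nested _ _ _ _ x) => //=.
    by rewrite gerBl.
  exact: dcube_cell.
rewrite (Hv x); last exact: dcube_cell.
by rewrite Hv//; apply/in_dcube => /=; rewrite -same.
Qed.

Lemma measurable_haar Q : measurable_fun setT (H Q).
Proof.
have [H0 Hc _ _] := HH Q.
apply: (@measurable_step _ _ (Q.1 - 1)) => x y xy.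
have e1 : cell Q.1 x = cell Q.1 y by apply: cell_mono xy; rewrite gerBl.
have [xQ|nxQ] := pselect (dcube Q x); last first.
  by rewrite !H0//; apply: contra_not nxQ => /in_dcube h; apply/in_dcube; rewrite e1.
have [v Hv] : exists v, forall z, dcube (Q.1 - 1, cell (Q.1 - 1) x) z -> H Q z = v.
  apply: Hc; split => //=; apply: (@subcubes_nested _ _ _ _ x) => //=.
    by rewrite gerBl.
  exact: dcube_cell.
by rewrite !Hv//; apply/in_dcube.
Qed.

Lemma integral_haar Q Q' f : near_subcubes R tau Q Q' -> dint f ->
  (\int[mu]_x (f x * H Q' x)%:E =
   (\sum_(c : I) hval Q Q' c * (dvol R Q / M * avR f (child Q c)))%:E)%E.
Proof.
move=> nQ [mf fi]; have [sub _] := nQ; have [H0 _ _ _] := HH Q'.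
rewrite -sumEFin.
have -> : (\int[mu]_x (f x * H Q' x)%:E = \int[mu]_(x in dcube Q) (f x * H Q' x)%:E)%E.
  rewrite [RHS]integral_mkcond; apply: eq_integral => x _; rewrite patchE.
  by case: ifPn => // /negP; rewrite inE => xQ; rewrite H0 ?mulr0// => /sub.
rewrite (integral_children s)//; last first.
  by apply: measurable_funM => //; exact: measurable_haar.
apply: eq_bigr => c _; rewrite -(dvol_child _ c) EFinM -integral_dcubeE// -integralZl//; last first.
  exact: measurable_dcube.
apply: eq_integral => x /set_mem xc; rewrite -EFinM mulrC; congr (_ * _)%:E.
exact: haar_const.
Qed.

Lemma dint1 : @dint R n (fun=> 1).
Proof.
split=> // Q; apply/integrableP; split; first exact: measurable_cst.
under eq_integral do rewrite /= normr1.
by rewrite integral_cst ?mul1e ?mu_dcube ?ltry//; exact: measurable_dcube.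
Qed.

Lemma avR1 Q : @avR R n (fun=> 1) Q = 1.
Proof.
apply: (mulfI (lt0r_neq0 (dvol_gt0 (R := R) Q))); apply: EFin_inj.
rewrite -integral_dcubeE; last by have [_] := dint1; apply.
by rewrite integral_cst ?mul1e ?mu_dcube ?mulr1//; exact: measurable_dcube.
Qed.

(** The zero integral of the Haar function, read through [integral_haar] for the constant function
    1. *)
Lemma hval_sum Q Q' : near_subcubes R tau Q Q' -> \sum_(c : I) hval Q Q' c = 0.
Proof.
move=> nQ; have [_ _ _ int0] := HH Q'.
have := integral_haar nQ dint1.
under eq_integral do rewrite mul1r.
rewrite int0 => -[/esym].
under eq_bigr do rewrite avR1 mulr1.
rewrite -mulr_suml => /eqP; rewrite mulf_eq0 => /orP[/eqP//|].
by rewrite gt_eqF// divr_gt0 ?dvol_gt0// ltr0n cidx_gt0.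
Qed.

(** The factor [dvol R Q] appears because the pairings are integrals whereas the tree kernel acts on
    averages. *)
Definition bker Q (c c' : I) : R := dvol R Q *
  \sum_(Q' <- near Q) \sum_(Q'' <- near Q) a Q Q' Q'' * hval Q Q' c' * hval Q Q'' c.

Lemma shift_blockE Q f x : dint f -> dcube Q x ->
  shift_block tau H a Q f x =
  M^-1 * \sum_(c' : I) bker Q (cidx_of s Q x) c' * avR f (child Q c').
Proof.
move=> fi xQ; rewrite /shift_block fsbig_near; set c := cidx_of s Q x.
have xc := child_cidx_of s xQ.
transitivity (\sum_(Q' <- near Q) \sum_(Q'' <- near Q) \sum_(c' : I)
  a Q Q' Q'' * (hval Q Q' c' * (dvol R Q / M * avR f (child Q c'))) * hval Q Q'' c).
  rewrite big_seq [RHS]big_seq; apply: eq_bigr => Q' /in_near nQ'.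
  rewrite fsbig_near big_seq [RHS]big_seq; apply: eq_bigr => Q'' /in_near nQ''.
  rewrite /pairing /Rintegral (integral_haar nQ')//= -mulr_suml -mulr_sumr.
  by rewrite (haar_const nQ'' xc).
under eq_bigr do rewrite exchange_big/=.
rewrite exchange_big/= mulr_sumr; apply: eq_bigr => c' _.
rewrite /bker; set S := \sum_(Q' <- near Q) _.
have -> : M^-1 * (dvol R Q * S * avR f (child Q c')) =
  (M^-1 * dvol R Q * avR f (child Q c')) * S by ring.
rewrite mulr_sumr; apply: eq_bigr => Q' _.
rewrite mulr_sumr; apply: eq_bigr => Q'' _; ring.
Qed.

Lemma shift_block_out Q f x : ~ dcube Q x -> shift_block tau H a Q f x = 0.
Proof.
move=> xQ; rewrite /shift_block fsbig1// => Q' _; rewrite fsbig1// => Q'' [sub _].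
by have [H0 _ _ _] := HH Q''; rewrite H0 ?mulr0// => /sub.
Qed.

Lemma hval_le Q Q' c : `|hval Q Q' c| <= (Num.sqrt (dvol R Q'))^-1.
Proof. by have [_ _ h _] := HH Q'; exact: h. Qed.

Lemma near_self Q : near_subcubes R tau Q Q.
Proof.
split; first by move=> x.
by rewrite ler_piMl ?(ltW (dvol_gt0 _))// invf_le1 ?exprn_gt0// exprn_ege1// ler1n.
Qed.

Lemma C0_ge0 : 0 <= C0.
Proof.
pose Q : dyadic n := (0, [tuple 0 | i < n]).
have := le_trans (normr_ge0 _) (aC (near_self Q) (near_self Q)).
by rewrite pmulr_lge0// sqrtr_gt0 !mulr_gt0 ?invr_gt0// dvol_gt0.
Qed.

Definition block_const : R := C0 * (s * #|{: I}|)%:R ^+ 2.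

(** The volume of [Q], the size condition and the two sup norms cancel to exactly [C0] for each pair
    of near subcubes, and there are at most the square of [s * #|I|] pairs. *)
Lemma bker_le Q c c' : `|bker Q c c'| <= block_const.
Proof.
have v0 := dvol_gt0 (R := R) Q.
have C00 := C0_ge0.
apply: (@le_trans _ _ (\sum_(Q' <- near Q) \sum_(Q'' <- near Q) C0)); last first.
  rewrite !big_const_seq !count_predT !iter_addr_0 -mulrnA -[leLHS]mulr_natr ler_wpM2l//.
  by rewrite -natrX ler_nat -mulnn leq_mul// size_near.
rewrite /bker mulr_sumr; apply: le_trans (ler_norm_sum _ _ _) _.
rewrite big_seq [leRHS]big_seq; apply: ler_sum => Q' /in_near nQ'.
rewrite mulr_sumr; apply: le_trans (ler_norm_sum _ _ _) _.
rewrite big_seq [leRHS]big_seq; apply: ler_sum => Q'' /in_near nQ''.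
have v'0 := dvol_gt0 (R := R) Q'; have v''0 := dvol_gt0 (R := R) Q''.
have sq' : 0 < Num.sqrt (dvol R Q') by rewrite sqrtr_gt0.
have sq'' : 0 < Num.sqrt (dvol R Q'') by rewrite sqrtr_gt0.
rewrite !normrM gtr0_norm//.
have e : C0 * Num.sqrt (dvol R Q' / dvol R Q * (dvol R Q'' / dvol R Q)) =
   C0 * (Num.sqrt (dvol R Q') * Num.sqrt (dvol R Q'') / dvol R Q).
  have -> : dvol R Q' / dvol R Q * (dvol R Q'' / dvol R Q) =
     dvol R Q' * (dvol R Q'' * ((dvol R Q)^-1) ^+ 2) by ring.
  rewrite sqrtrM ?(ltW v'0)// sqrtrM ?(ltW v''0)// sqrtr_sqr ger0_norm ?invr_ge0 ?(ltW v0)//.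
  by rewrite !mulrA.
have := aC nQ' nQ''; rewrite e => ha.
apply: (@le_trans _ _ (dvol R Q * (C0 * (Num.sqrt (dvol R Q') * Num.sqrt (dvol R Q'') / dvol R Q)
   * (Num.sqrt (dvol R Q'))^-1 * (Num.sqrt (dvol R Q''))^-1))).
  by rewrite ler_wpM2l ?(ltW v0)// ler_pM ?mulr_ge0 ?hval_le// ler_pM ?hval_le.
rewrite le_eqVlt; apply/orP; left; apply/eqP; field.
by rewrite !gt_eqF.
Qed.

Lemma bker_sumr Q c : \sum_c' bker Q c c' = 0.
Proof.
rewrite -mulr_sumr exchange_big/= big_seq big1 ?mulr0// => Q' /in_near nQ'.
rewrite exchange_big/= big1// => Q'' _.
by rewrite -mulr_suml -mulr_sumr hval_sum// mulr0 mul0r.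
Qed.

Lemma bker_suml Q c' : \sum_c bker Q c c' = 0.
Proof.
rewrite -mulr_sumr exchange_big/= big1 ?mulr0// => Q' _.
rewrite exchange_big/= big_seq big1// => Q'' /in_near nQ''.
by rewrite -mulr_sumr hval_sum// mulr0.
Qed.

End blocks.

(** * Density of dyadic step functions *)
Import HBSimple.

Section density.
Context {R : realType} {n : nat}.
Local Notation mu := (lebesgue_Rn n : {measure set (Rn R n) -> \bar R}).
Implicit Types (x y : Rn R n) (k : int) (f g h : Rn R n -> R).

Definition bstep k g := step_fun k g /\ exists B, forall x, `|g x| <= B.

Lemma bounded_dint g (B : R) : measurable_fun setT g -> (forall x, `|g x| <= B) -> dint g.
Proof.
move=> mg gB; split=> // Q; apply: measurable_bounded_integrable.
- exact: measurable_dcube.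
- by rewrite mu_dcube ltry.
- exact: measurable_funTS.
- by exists B; split; rewrite ?num_real// => t Bt x _; exact: le_trans (ltW Bt).
Qed.

Lemma bstep_dint k g : bstep k g -> dint g.
Proof. by move=> [sg [B gB]]; apply: (bounded_dint _ gB); exact: measurable_step sg. Qed.

Lemma step_fun_le k k' g : k' <= k -> step_fun k g -> step_fun k' g.
Proof. by move=> kk sg x y xy; apply: sg; exact: cell_mono xy. Qed.

Variables (s : nat) (Q : dyadic n).
Hypothesis s_gt0 : (0 < s)%N.

Definition ldist f g : \bar R := (\int[mu]_(x in dcube Q) `|f x - g x|%:E)%E.

Let mQ : measurable (dcube Q : set (Rn R n)). Proof. exact: measurable_dcube. Qed.

Lemma measurable_dist f g (D : set (Rn R n)) : measurable_fun setT f -> measurable_fun setT g ->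
  measurable_fun D (fun x => `|f x - g x|%:E).
Proof.
move=> mf mg; apply/measurable_EFinP; apply: measurable_funTS.
by apply: measurableT_comp => //; exact: measurable_funB.
Qed.

Lemma ldist_tri f g h : measurable_fun setT f -> measurable_fun setT g ->
  measurable_fun setT h -> (ldist f h <= ldist f g + ldist g h)%E.
Proof.
move=> mf mg mh; rewrite /ldist -ge0_integralD//; [|exact: measurable_dist..].
apply: ge0_le_integral => //; [exact: measurable_dist| |].
  exact: (emeasurable_funD (measurable_dist mf mg) (measurable_dist mg mh)).
move=> x _; rewrite -EFinD lee_fin.
by rewrite (_ : f x - h x = (f x - g x) + (g x - h x)) ?ler_normD//; ring.
Qed.

Definition approx f := measurable_fun setT f /\ forall e : R, 0 < e ->
  exists d g, bstep (Q.1 - (s * d)%N%:Z) g /\ (ldist f g <= e%:E)%E.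

Lemma approx_lim f : measurable_fun setT f -> (forall e : R, 0 < e ->
  exists2 g, approx g & (ldist f g <= e%:E)%E) -> approx f.
Proof.
move=> mf H; split=> // e e0.
have [g [mg ag] fg] := H (e / 2) (divr_gt0 e0 (ltr0Sn _ 1)).
have [d [h [sh gh]]] := ag (e / 2) (divr_gt0 e0 (ltr0Sn _ 1)).
exists d, h; split=> //; have [dh _] := bstep_dint sh.
apply: le_trans (ldist_tri mf mg dh) _.
by rewrite [in leRHS](splitr e) EFinD leeD.
Qed.

(** Lipschitz combinations cover complements ([b - a]), unions ([Num.max]) and the sums defining
    simple functions in one statement. *)
Lemma approx_comp (phi : R -> R -> R) (K : R) f g : 0 < K ->
  (forall a b c d, `|phi a b - phi c d| <= K * (`|a - c| + `|b - d|)) ->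
  measurable_fun setT (fun x => phi (f x) (g x)) ->
  approx f -> approx g -> approx (fun x => phi (f x) (g x)).
Proof.
move=> K0 Hphi mphi [mf af] [mg ag]; split=> // e e0.
have e2 : 0 < e / K / 2 by rewrite !divr_gt0.
have [d1 [g1 [[s1 [B1 b1]] fg1]]] := af _ e2.
have [d2 [g2 [[s2 [B2 b2]] fg2]]] := ag _ e2.
have mg1 : measurable_fun setT g1 by exact: measurable_step s1.
have mg2 : measurable_fun setT g2 by exact: measurable_step s2.
pose d := maxn d1 d2.
have st1 : step_fun (Q.1 - (s * d)%N%:Z) g1.
  by apply: step_fun_le s1; rewrite lerD2l lerN2 lez_nat leq_mul2l leq_maxl orbT.
have st2 : step_fun (Q.1 - (s * d)%N%:Z) g2.
  by apply: step_fun_le s2; rewrite lerD2l lerN2 lez_nat leq_mul2l leq_maxr orbT.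
have st : step_fun (Q.1 - (s * d)%N%:Z) (fun x => phi (g1 x) (g2 x)).
  by move=> x y xy; rewrite (st1 _ _ xy) (st2 _ _ xy).
exists d, (fun x => phi (g1 x) (g2 x)); split.
  split=> //; exists (K * (B1 + B2) + `|phi 0 0|) => x.
  rewrite -[phi _ _](subrK (phi 0 0)); apply: le_trans (ler_normD _ _) _.
  rewrite lerD2r; apply: le_trans (Hphi _ _ _ _) _.
  by rewrite ler_pM2l// !subr0 lerD.
apply: (@le_trans _ _ (K%:E * (ldist f g1 + ldist g g2))%E).
  rewrite /ldist -ge0_integralD//; [|exact: measurable_dist..].
  rewrite -ge0_integralZl//; last 3 first.
  - exact: (emeasurable_funD (measurable_dist mf mg1) (measurable_dist mg mg2)).
  - by move=> x _; rewrite -EFinD lee_fin addr_ge0.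
  - by rewrite lee_fin ltW.
  apply: ge0_le_integral => //.
  - by apply: measurable_dist => //; exact: measurable_step st.
  - apply: measurable_funeM.
    exact: (emeasurable_funD (measurable_dist mf mg1) (measurable_dist mg mg2)).
  - by move=> x _; rewrite -EFinD -EFinM lee_fin.
have -> : e%:E = (K%:E * ((e / K / 2)%:E + (e / K / 2)%:E))%E.
  by rewrite -EFinD -EFinM; congr EFin; field; rewrite gt_eqF.
by rewrite lee_wpmul2l ?lee_fin ?(ltW K0)// leeD.
Qed.

Lemma approx_level d p : approx (\1_(level_set (Q.1 - (s * d)%N%:Z) p)).
Proof.
set L := level_set _ _.
have mL : measurable L by exact: measurable_level_set.
split; first exact: measurable_indic.
move=> e e0; exists d, (\1_L); split; last first.
  rewrite /ldist; under eq_integral do rewrite subrr normr0.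
  by rewrite integral0 lee_fin ltW.
split; last by exists 1 => x; rewrite indicE; case: (_ \in _); rewrite ?normr1 ?normr0.
by move=> x y xy; rewrite !indicE; congr (_%:R); congr nat_of_bool;
   apply/idP/idP; rewrite !inE /L /level_set/= xy.
Qed.

Definition approx_set (A : set (Rn R n)) := measurable A /\ approx (\1_A).

Lemma approx_cst (c : R) : approx (fun=> c).
Proof.
split; first exact: measurable_cst.
move=> e e0; exists 0%N, (fun=> c); split; last first.
  rewrite /ldist; under eq_integral do rewrite subrr normr0.
  by rewrite integral0 lee_fin ltW.
by split=> //; exists `|c|.
Qed.

Lemma approx_setC A : approx_set A -> approx_set (~` A).
Proof.
move=> [mA aA]; have mC := measurableC mA; split=> //.
have e : \1_(~` A) = (fun x => (fun a b => b - a) (\1_A x) 1) :> (Rn R n -> R).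
  by apply/funext => x; rewrite !indicE in_setC; case: (x \in A); rewrite /= ?subrr ?subr0.
rewrite e.
apply: (@approx_comp (fun a b => b - a) 1 (\1_A) (fun=> 1)) => //; last exact: approx_cst.
  move=> a b c d; rewrite mul1r (_ : _ - _ = - (a - c) + (b - d)); last ring.
  by apply: le_trans (ler_normD _ _) _; rewrite normrN.
by rewrite -e; exact: measurable_indic.
Qed.

Lemma indicU (A B : set (Rn R n)) :
  \1_(A `|` B) = (fun x => Num.max (\1_A x) (\1_B x)) :> (Rn R n -> R).
Proof.
apply/funext => x; rewrite !indicE in_setU.
by case: (x \in A); case: (x \in B); rewrite /= ?maxxx ?(max_l ler01) ?(max_r ler01).
Qed.

Lemma approx_setU A B : approx_set A -> approx_set B -> approx_set (A `|` B).
Proof.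
move=> [mA aA] [mB aB]; have mU := measurableU _ _ mA mB; split=> //.
rewrite indicU; apply: (@approx_comp Num.max 1) => //.
  move=> a b c d; rewrite mul1r.
  have h (u v : R) : Num.max u v = (u + v + `|u - v|) / 2.
    by case: (lerP u v) => uv; rewrite ?ler0_norm ?subr_le0// ?gtr0_norm ?subr_gt0//; field.
  rewrite !h (_ : _ - _ = ((a - c) + (b - d) + (`|a - b| - `|c - d|)) / 2); last by field.
  have h2 : `| `|a - b| - `|c - d| | <= `|a - c| + `|b - d|.
    apply: le_trans (ler_dist_dist _ _) _.
    rewrite (_ : a - b - (c - d) = (a - c) - (b - d)); last ring.
    exact: ler_normB.
  rewrite normrM [ `|2^-1|]ger0_norm// ler_pdivrMr//.
  apply: le_trans (ler_normD _ _) _; have := ler_normD (a - c) (b - d); lra.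
by rewrite -indicU; exact: measurable_indic.
Qed.

Lemma approx_bigcup (F : nat -> set (Rn R n)) : (forall i, approx_set (F i)) ->
  approx_set (\bigcup_i F i).
Proof.
move=> aF; have mU : measurable (\bigcup_i F i).
  by apply: bigcupT_measurable => i; have [] := aF i.
split=> //; pose G N := \big[setU/set0]_(i < N) F i.
have aG N : approx_set (G N).
  rewrite /G; elim: N => [|N IH]; last by rewrite big_ord_recr; exact: approx_setU.
  rewrite big_ord0; split=> //; rewrite indic0; exact: approx_cst.
have mG N : measurable (G N) by have [] := aG N.
have mi A : measurable A -> measurable_fun setT (\1_A : Rn R n -> R).
  by move=> mA; exact: measurable_indic.
have [|||||_ cv _] := @dominated_convergence _ _ _ mu (dcube Q) mQ
  (fun N x => (\1_(G N) x)%:E) (fun x => (\1_(\bigcup_i F i) x)%:E) (fun=> 1%E).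
- by move=> N; apply/measurable_EFinP; apply: measurable_funTS; exact: mi.
- by apply/measurable_EFinP; apply: measurable_funTS; exact: mi.
- apply: aeW => x _; apply: cvg_near_cst.
  have [[i _ Fi]|nF] := pselect ((\bigcup_i F i) x).
    exists i.+1 => // N /= iN; rewrite !indicE !mem_set//; first by exists i.
    by rewrite /G -bigcup_mkord; exists i.
  exists 0%N => // N _; rewrite !indicE !memNset// => GN; apply: nF.
  by move: GN; rewrite /G -bigcup_mkord => -[i _ Fi]; exists i.
- have [_] : @dint R n (fun=> 1) by apply: (@bounded_dint _ 1) => // x; rewrite normr1.
  exact.
- apply: aeW => x N _; rewrite lee_fin ger0_norm ?indicE//; case: (_ \in _) => //.
apply: approx_lim; first exact: mi.
move=> e e0; have /fine_cvgP[[N1 _ fin] /cvgrPdist_le /(_ e e0)[N2 _ H]] := cv.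
pose N := maxn N1 N2; have := H N (leq_maxr _ _); have := fin N (leq_maxl _ _).
rewrite /= => finN; rewrite sub0r normrN => hN.
exists (\1_(G N)); first by have [] := aG N.
rewrite /ldist.
have -> : (\int[mu]_(x in dcube Q) `|\1_(\bigcup_i F i) x - \1_(G N) x|%:E =
  \int[mu]_(x in dcube Q) `|(\1_(G N) x)%:E - (\1_(\bigcup_i F i) x)%:E|)%E.
  by apply: eq_integral => x _; rewrite -EFinB abse_EFin distrC.
rewrite -(fineK finN) lee_fin; exact: le_trans (ler_norm _) hN.
Qed.

Lemma pow2_small k (e : R) : 0 < e -> exists d, (2 : R) ^ (k - (s * d)%N%:Z) < e.
Proof.
move=> e0; pose d := (Num.trunc ((2 : R) ^ k / e)).+1; exists d.
have h : 2 ^ k / e < 2 ^+ (s * d).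
  apply: (@lt_trans _ _ d%:R); first exact: truncnS_gt.
  apply: lt_le_trans (_ : d%:R < 2 ^+ d) _; first by rewrite -natrX ltr_nat ltn_expl.
  by rewrite ler_weXn2l ?ler1n// leq_pmull.
rewrite pow2D -exprnN ltr_pdivrMr ?exprn_gt0//.
by move: h; rewrite ltr_pdivrMr// mulrC.
Qed.

(** Once the mesh is smaller than the distance from [x] to the hyperplane, the cell of [x] lies
    entirely beyond it; so the half-space is a countable union of level sets. *)
Lemma approx_halfspace i (a : R) : approx_set [set x : Rn R n | a < tnth x i].
Proof.
pose L d := level_set (Q.1 - (s * d)%N%:Z)
   (fun m => Num.floor (a / 2 ^ (Q.1 - (s * d)%N%:Z)) < tnth m i) : set (Rn R n).
have -> : [set x : Rn R n | a < tnth x i] = \bigcup_d L d.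
  apply/seteqP; split => [x /= ax|x [d _]].
    have [d hd] : exists d, (2 : R) ^ (Q.1 - (s * d)%N%:Z) < tnth x i - a.
      by apply: pow2_small; rewrite subr_gt0.
    exists d => //.
    rewrite /L /level_set/= tnth_mktuple.
    set q := 2 ^ _ in hd *; have q0 : 0 < q by exact: pow2_gt0.
    rewrite floor_lt_int; have := floorD1_gt (tnth x i / q); rewrite intrD1 => fl.
    rewrite -(ltrD2r 1); apply: le_lt_trans fl.
    have -> : a / q + 1 = (a + q) / q by field; rewrite gt_eqF.
    by rewrite ler_pM2r ?invr_gt0//; lra.
  rewrite /L /level_set/= tnth_mktuple; set q := 2 ^ _; have q0 : 0 < q by exact: pow2_gt0.
  rewrite floor_lt_int => h; have /andP[fl _] := floor_itv (tnth x i / q).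
  by have := lt_le_trans h fl; rewrite ltr_pM2r// invr_gt0.
apply: approx_bigcup => d; split; first exact: measurable_level_set.
exact: approx_level.
Qed.

(** The approximable sets form a sigma-algebra, and it contains the half-spaces, which generate the
    product one. *)
Lemma approx_measurable A : measurable A -> approx_set A.
Proof.
have sub0 : approx_set set0.
  by split=> //; rewrite indic0; exact: approx_cst.
have subD (P : set (Rn R n)) : approx_set P -> approx_set (setT `\` P).
  by rewrite setTD; exact: approx_setC.
suff H : (measurable : set (set (Rn R n))) `<=` approx_set by exact: H.
apply: smallest_sub; first by split => //; exact: approx_bigcup.
move=> X0; have bigP (F : 'I_n -> set (set (Rn R n))) X :
    (\big[setU/set0]_(i < n) F i) X -> exists i, F i X.
  by elim/big_rec: _ => [[]|i Y _ IH [h|/IH//]]; exists i.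
move=> /bigP[i [B mB <-]]; rewrite setTI.
suff : (@RGenOInfty.G R).-sigma.-measurable `<=` [set B | approx_set ((@tnth n R ^~ i) @^-1` B)].
  by apply; move: mB; rewrite -RGenOInfty.measurableE.
apply: smallest_sub; last by move=> C [a ->]; have := approx_halfspace i a;
  congr approx_set; apply/seteqP; split=> x /=; rewrite in_itv/= andbT.
split => [|C aC|F aF] /=.
- by rewrite preimage_set0.
- rewrite setTD preimage_setC; exact: approx_setC.
- by rewrite preimage_bigcup; exact: approx_bigcup.
Qed.

Lemma approx_integrable f : measurable_fun setT f ->
  mu.-integrable (dcube Q) (EFin \o f) -> approx f.
Proof.
move=> mf fi; apply: approx_lim => // e e0.
have [g_ [gi _ cv]] := approximation_sfun_integrable mQ fi.
have /fine_cvgP[[N1 _ fin] /cvgrPdist_le /(_ e e0)[N2 _ H]] := cv.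
pose N := maxn N1 N2; have := H N (leq_maxr _ _); have := fin N (leq_maxl _ _).
rewrite /= => finN; rewrite sub0r normrN => hN.
exists (g_ N); last first.
  by rewrite /ldist -(fineK finN) lee_fin; exact: le_trans (ler_norm _) hN.
have -> : (g_ N : _ -> _) = (fun x => \sum_(y <- finmap.enum_fset (fset_set (range (g_ N))))
    y * \1_((g_ N) @^-1` [set y]) x).
  apply/funext => x; rewrite fimfunE fsbig_finite//=.
elim: (finmap.enum_fset _) => [|y r IH].
  by under eq_fun do rewrite big_nil; exact: approx_cst.
under eq_fun do rewrite big_cons.
have mY : measurable ((g_ N) @^-1` [set y]) by exact: measurable_funPTI.
have [_ aY] := approx_measurable mY.
pose h x := \sum_(j <- r) j * \1_((g_ N) @^-1` [set j]) x.
have mI : measurable_fun setT (\1_((g_ N) @^-1` [set y]) : Rn R n -> R) by exact: measurable_indic.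
have [mh _] := IH.
apply: (@approx_comp (fun a b => y * a + b) (`|y| + 1) (\1_((g_ N) @^-1` [set y])) h) => //.
- move=> a b c d; rewrite (_ : _ - _ = y * (a - c) + (b - d)); last ring.
  apply: le_trans (ler_normD _ _) _; rewrite normrM mulrDl mul1r mulrDr.
  have := normr_ge0 (a - c); have : 0 <= `|y| * `|b - d| by rewrite mulr_ge0.
  by lra.
- by apply: measurable_funD => //; exact: measurable_funM.
Qed.

End density.

(** * Almost everywhere convergence *)
Section convergence.
Context {R : realType} {n : nat}.
Hypothesis n_gt0 : (0 < n)%N.
Local Notation mu := (lebesgue_Rn n : {measure set (Rn R n) -> \bar R}).
Implicit Types (x y : Rn R n) (k : int) (Q : dyadic n) (f : Rn R n -> R).
Variables (tau : nat) (C0 : R) (H : dyadic n -> Rn R n -> R)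
  (a : dyadic n -> dyadic n -> dyadic n -> R).
Local Notation s := tau.+1.
Local Notation I := (@cidx n s).
Local Notation M := (#|{: I}|%:R : R).
Local Notation avL := (@node_avg R n s).
Local Notation addr := (@addr R n s).
Local Notation absf := (fun f : Rn R n -> R => fun x => `|f x|).
Hypothesis HH : forall Q, haar_function Q (H Q).
Hypothesis aC : forall Q Q' Q'', near_subcubes R tau Q Q' -> near_subcubes R tau Q Q'' ->
  `|a Q Q' Q''| <= C0 * Num.sqrt (dvol R Q' / dvol R Q * (dvol R Q'' / dvol R Q)).
Variable mask : int -> bool.

Definition shift_at k f x := shift_block tau H a (k, cell k x) f x.
Local Notation blk := shift_at.

Definition kapM Q : seq I -> I -> I -> R := fun l c c' =>
  if mask (node Q l).1 then bker H a (node Q l) c c' else 0.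

Definition bconst := @block_const R n tau C0.

Lemma bconst_ge0 : 0 <= bconst.
Proof. by rewrite mulr_ge0 ?exprn_ge0//; exact: (C0_ge0 aC). Qed.

Lemma kapM_bound Q : kernel_bound bconst (kapM Q).
Proof.
split=> [l c c'|l c|l c']; rewrite /kapM; case: (mask _).
- exact: (bker_le n_gt0 HH aC).
- by rewrite normr0 bconst_ge0.
- exact: (bker_sumr n_gt0 _ HH).
- by rewrite big1.
- exact: (bker_suml n_gt0 _ HH).
- by rewrite big1.
Qed.

Lemma kapM_sub Q c : sub (kapM Q) c = kapM (child Q c). Proof. by []. Qed.

Definition masked_shift_at k f x := if mask k then blk k f x else 0.
Local Notation mblk := masked_shift_at.

(* The generations congruent to [k] modulo [s]; [mask] truncates them to finitely many. *)
Definition residue_sum k f d x := \sum_(0 <= l < d) mblk (k - (s * l)%N%:Z) f x.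
Local Notation psum := residue_sum.

Lemma mblk_tree f Q x : dint f -> dcube Q x ->
  M^-1 * \sum_c' kapM Q [::] (cidx_of s Q x) c' * avR f (child Q c') = mblk Q.1 f x.
Proof.
move=> fi xQ; rewrite /mblk /kapM /=; case: (mask _).
  by rewrite -(@shift_blockE _ _ n_gt0 tau H a HH)// /blk -(dcube_eq xQ).
by rewrite big1 ?mulr0// => c _; rewrite mul0r.
Qed.

Lemma psumS k f d x : psum k f d.+1 x = mblk k f x + psum (k - s%:Z) f d x.
Proof.
rewrite /psum big_nat_recl// muln0 subr0; congr (_ + _); apply: eq_bigr => l _.
by rewrite mulnS PoszD opprD addrA.
Qed.

Lemma mtrans_psum d Q f x : dint f -> dcube Q x ->
  mtrans d (kapM Q) (avL f Q) (addr d Q x) = psum Q.1 f d x.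
Proof.
move=> fi; elim: d Q => [|d IH] Q xQ; first by rewrite /psum big_geq.
have xc := child_cidx_of s xQ.
rewrite psumS /= kapM_sub avL_child IH//=; congr (_ + _).
rewrite -mblk_tree//; congr (_ * _); apply: eq_bigr => c' _; congr (_ * _).
by rewrite avL_child avg_avL.
Qed.

Lemma dint_abs f : dint f -> dint (absf f).
Proof.
move=> [mf fi]; split; first exact: measurableT_comp.
by move=> Q; have := integrable_norm (fi Q).
Qed.

Lemma avR_ge0 f Q : (forall x, 0 <= f x) -> 0 <= avR f Q.
Proof.
move=> f0; rewrite mulr_ge0 ?invr_ge0 ?(ltW (dvol_gt0 _))//.
by apply: Rintegral_ge0.
Qed.

Lemma ler_norm_avR f Q : dint f -> `|avR f Q| <= avR (absf f) Q.
Proof.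
move=> [mf fi]; rewrite normrM gtr0_norm ?invr_gt0 ?dvol_gt0//.
rewrite ler_wpM2l ?invr_ge0 ?(ltW (dvol_gt0 _))//.
by apply: le_normr_Rintegral => //; exact: measurable_dcube.
Qed.

Lemma avgabs_le d f Q : dint f -> avg d (tree_abs (avL f Q)) <= avR (absf f) Q.
Proof.
move=> fi; rewrite -(@avg_avL _ _ s (absf f) Q d (dint_abs fi)).
by apply: (le_avg (@cidx_gt0 n s)) => l _; exact: ler_norm_avR.
Qed.

(** The shift [x0] carries the part of the sum accumulated along the branch, so that the induction
    can move to the child. *)
Lemma bad_psum d l Q f (lam x0 : R) x : dint f -> dcube Q x -> (l <= d)%N ->
  lam < `|x0 + psum Q.1 f l x| \/
  lam < `|avR f (Q.1 - (s * l)%N%:Z, cell (Q.1 - (s * l)%N%:Z) x)| ->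
  bad d (kapM Q) (avL f Q) lam x0 (addr d Q x).
Proof.
move=> fi; elim: d l Q x0 => [|d IH] l Q x0 xQ.
  rewrite leqn0 => /eqP ->; rewrite muln0 subr0 -(dcube_eq xQ) /psum big_geq// addr0.
  by move=> [h|h] /=; rewrite h ?orbT.
case: l => [_|l ld].
  rewrite muln0 subr0 -(dcube_eq xQ) /psum big_geq// addr0.
  move=> [h|h]; first by rewrite [bad _ _ _ _ _ _]/= h.
  have h2 : lam < avg d.+1 (tree_abs (avL f Q)).
    apply: lt_le_trans h _; rewrite -(@avg_avL _ _ s f Q d.+1 fi).
    exact: ler_norm_avg (@cidx_gt0 n s) _ _.
  by rewrite [bad _ _ _ _ _ _]/= -/(avg d.+1 (tree_abs (avL f Q))) h2 orbT.
move=> h; rewrite [bad _ _ _ _ _ _]/=.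
have -> : M^-1 * (\sum_c' kapM Q [::] (cidx_of s Q x) c' * avg d (sub (avL f Q) c')) =
    mblk Q.1 f x.
  rewrite -mblk_tree//; congr (_ * _); apply: eq_bigr => c' _; congr (_ * _).
  by rewrite avL_child avg_avL.
rewrite kapM_sub avL_child (IH l)//= ?orbT//; first exact: child_cidx_of.
move: h; rewrite psumS mulnS PoszD opprD !addrA.
by rewrite /= -addrA.
Qed.

Definition wconst := 1 + bconst ^+ 2 * M.

Definition badset d Q f (lam : R) : set (Rn R n) :=
  [set x | bad d (kapM Q) (avL f Q) lam 0 (addr d Q x)].

Lemma measurable_badset d Q f lam : measurable (badset d Q f lam).
Proof.
rewrite (_ : badset _ _ _ _ = level_set (Q.1 - (s * d)%N%:Z)
    (fun m => exists2 x, cell (Q.1 - (s * d)%N%:Z) x = m & badset d Q f lam x)).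
  exact: measurable_level_set.
apply/seteqP; split => x; first by move=> Bx; exists x.
by move=> [y yx]; rewrite /badset /= (step_addr yx).
Qed.

Lemma weak_real d Q f (lam : R) : 0 < lam -> dint f ->
  (mu (dcube Q `&` badset d Q f lam) <=
   (wconst / lam)%:E * \int[mu]_(x in dcube Q) `|f x|%:E)%E.
Proof.
move=> lam0 fi; have mB := measurable_badset d Q f lam.
have mQ : measurable (dcube Q : set (Rn R n)) by exact: measurable_dcube.
have -> : mu (dcube Q `&` badset d Q f lam) = (\int[mu]_(x in dcube Q)
   ((bad d (kapM Q) (avL f Q) lam 0 (addr d Q x))%:R * 1)%:E)%E.
  rewrite setIC -integral_indic//; apply: eq_integral => x _.
  rewrite mulr1 indicE; congr (_%:R)%:E; congr nat_of_bool.
  by apply/idP/idP; rewrite inE.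
rewrite (@integral_tree _ _ s d Q (fun l => (bad d (kapM Q) (avL f Q) lam 0 l)%:R))//;
  last exact: dint1.
have [mf _] := fi.
have [_ /(_ Q) fi'] := dint_abs fi.
rewrite (integral_dcubeE fi') -EFinM lee_fin mulrCA ler_wpM2l ?(ltW (dvol_gt0 _))//.
have h := weak_type (@cidx_gt0 n s) d (avL f Q) bconst_ge0 lam0 (kapM_bound Q).
apply: (@le_trans _ _ (wconst / lam * avg d (tree_abs (avL f Q)))); last first.
  rewrite ler_wpM2l ?avgabs_le// divr_ge0 ?(ltW lam0)// addr_ge0// mulr_ge0//.
  by rewrite exprn_ge0// bconst_ge0.
apply: le_trans h; rewrite le_eqVlt; apply/orP; left; apply/eqP.
by apply: (eq_avg (@cidx_gt0 n s)) => l _; rewrite /avL avR1 mulr1.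
Qed.

Lemma step_blk k f : dint f -> step_fun (k - s%:Z) (blk k f).
Proof.
move=> fi x y xy; have e : cell k x = cell k y by apply: cell_mono xy; rewrite gerBl.
rewrite /blk e.
rewrite !(@shift_blockE _ _ n_gt0 tau H a HH)//; first by rewrite /cidx_of xy.
  exact: dcube_cell.
by rewrite -e; exact: dcube_cell.
Qed.

Lemma step_psum k f d : dint f -> step_fun (k - (s * d)%N%:Z) (psum k f d).
Proof.
move=> fi x y xy; rewrite /psum; apply: eq_big_nat => l /andP[_ ld].
rewrite /mblk; case: (mask _) => //; apply: (step_blk fi).
apply: cell_mono xy; rewrite -addrA lerD2l -opprD lerN2 -PoszD lez_nat.
by rewrite -mulnSr leq_mul2l.
Qed.

Definition maxset Q f (lam : R) d : set (Rn R n) := dcube Q `&`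
  [set x | exists2 l, (l <= d)%N & lam < `|psum Q.1 f l x| \/
     lam < `|avR f (Q.1 - (s * l)%N%:Z, cell (Q.1 - (s * l)%N%:Z) x)|].

Lemma measurable_maxset Q f lam d : dint f -> measurable (maxset Q f lam d).
Proof.
move=> fi; apply: measurableI; first exact: measurable_dcube.
rewrite (_ : [set x | _] = level_set (Q.1 - (s * d)%N%:Z) (fun m =>
  exists2 x, cell (Q.1 - (s * d)%N%:Z) x = m & (exists2 l, (l <= d)%N &
    lam < `|psum Q.1 f l x| \/
     lam < `|avR f (Q.1 - (s * l)%N%:Z, cell (Q.1 - (s * l)%N%:Z) x)|))).
  exact: measurable_level_set.
apply/seteqP; split => x; first by move=> h; exists x.
move=> [y yx [l ld h]]; exists l; first exact: ld.
have yx' : cell (Q.1 - (s * l)%N%:Z) x = cell (Q.1 - (s * l)%N%:Z) y.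
  by apply/esym; apply: cell_mono yx; rewrite lerD2l lerN2 lez_nat leq_mul2l ld orbT.
by rewrite (step_psum fi yx') yx'.
Qed.

(** The weak-type constant does not depend on the depth and the sets increase with it, so continuity
    from below gives the maximal bound over all truncations. *)
Lemma maxset_le Q f (lam : R) : 0 < lam -> dint f ->
  (mu (\bigcup_d maxset Q f lam d) <=
   (wconst / lam)%:E * \int[mu]_(x in dcube Q) `|f x|%:E)%E.
Proof.
move=> lam0 fi.
have mE d : measurable (maxset Q f lam d) by exact: measurable_maxset.
have cv : mu \o maxset Q f lam @ \oo --> mu (\bigcup_d maxset Q f lam d).
  apply: nondecreasing_cvg_mu => //; first exact: bigcupT_measurable.
  move=> d d' dd'; apply/subsetPset => x [xQ [l ld h]]; split => //.
  by exists l => //; exact: leq_trans dd'.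
rewrite -(cvg_lim _ cv)//; apply: lime_le; first by apply/cvg_ex; eexists; exact: cv.
apply: nearW => d /=; apply: le_trans (weak_real d Q lam0 fi).
apply: le_measure; rewrite ?inE//.
  by apply: measurableI; [exact: measurable_dcube|exact: measurable_badset].
move=> x [xQ [l ld h]]; split => //=; apply: (bad_psum (l := l)) => //.
by rewrite add0r.
Qed.

End convergence.

(** * Convergence along one residue class of generations *)

Section ae_convergence.
Context {R : realType} {n : nat}.
Hypothesis n_gt0 : (0 < n)%N.
Local Notation mu := (lebesgue_Rn n : {measure set (Rn R n) -> \bar R}).
Implicit Types (x y : Rn R n) (k : int) (Q : dyadic n) (f g : Rn R n -> R).
Variables (tau : nat) (C0 : R) (H : dyadic n -> Rn R n -> R)
  (a : dyadic n -> dyadic n -> dyadic n -> R).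
Local Notation s := tau.+1.
Local Notation avL := (@node_avg R n s).
Local Notation addr := (@addr R n s).
Hypothesis HH : forall Q, haar_function Q (H Q).
Hypothesis aC : forall Q Q' Q'', near_subcubes R tau Q Q' -> near_subcubes R tau Q Q'' ->
  `|a Q Q' Q''| <= C0 * Num.sqrt (dvol R Q' / dvol R Q * (dvol R Q'' / dvol R Q)).
Variable mask : int -> bool.
Local Notation blk := (@shift_at R n tau H a).
Local Notation psum := (@residue_sum R n tau H a mask).

Lemma avRD f g Q : dint f -> dint g -> avR (fun x => f x + g x) Q = avR f Q + avR g Q.
Proof.
move=> [_ fi] [_ gi]; rewrite -mulrDr; congr (_ * _).
by apply: RintegralD => //; exact: measurable_dcube.
Qed.

Lemma dintD f g : dint f -> dint g -> dint (fun x => f x + g x).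
Proof.
move=> [mf fi] [mg gi]; split; first exact: measurable_funD.
move=> Q; have := integrableD (measurable_dcube Q) (fi Q) (gi Q).
by apply: eq_integrable => //; exact: measurable_dcube.
Qed.

Lemma dintN f : dint f -> dint (fun x => - f x).
Proof.
move=> [mf fi]; split; first exact: measurableT_comp.
move=> Q; have := integrableN (fi Q).
by apply: eq_integrable => //; exact: measurable_dcube.
Qed.

Lemma psumD k f g d x : dint f -> dint g ->
  psum k (fun x => f x + g x) d x = psum k f d x + psum k g d x.
Proof.
move=> fi gi; pose Q : dyadic n := (k, cell k x).
have xQ : dcube Q x by exact: dcube_cell.
have e h : dint h -> psum k h d x = mtrans d (@kapM R n tau H a mask Q) (avL h Q) (addr d Q x).
  by move=> hi; apply/esym; exact: mtrans_psum.
rewrite !e//; last exact: dintD.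
rewrite -mtransD; apply: (eq_mtrans (@cidx_gt0 n s)) => l _.
exact: avRD.
Qed.

Lemma avR_step g Q x : dint g -> step_fun Q.1 g -> dcube Q x -> avR g Q = g x.
Proof.
move=> gi gs xQ; have v0 := dvol_gt0 (R := R) Q.
apply: (mulfI (lt0r_neq0 v0)); apply: EFin_inj; rewrite -integral_dcubeE; last by case: gi.
rewrite (eq_integral (fun=> (g x)%:E)); last first.
  move=> y /set_mem yQ; congr EFin; apply: gs.
  by have /in_dcube -> := yQ; have /in_dcube -> := xQ.
rewrite integral_cst; last exact: measurable_dcube.
by rewrite mu_dcube -EFinM mulrC.
Qed.

(** All the averages entering the block are equal to [g x], and the rows of the kernel sum to
    zero. *)
Lemma blk_step0 g k k' x : dint g -> step_fun k' g -> k <= k' -> blk k g x = 0.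
Proof.
move=> gi gs kk'; pose Q : dyadic n := (k, cell k x).
have xQ : dcube Q x by exact: dcube_cell.
rewrite /shift_at (@shift_blockE _ _ n_gt0 tau H a HH)//.
rewrite (eq_bigr (fun c' => bker H a (k, cell k x) (cidx_of s Q x) c' * g x)).
  by rewrite -mulr_suml (bker_sumr n_gt0 _ HH) mul0r mulr0.
move=> c _; congr (_ * _).
have yc : dcube (child Q c) (corner (child Q c) : Rn R n) by exact: corner_in.
rewrite (avR_step gi _ yc).
  apply: gs; apply: cell_mono kk' _.
  by have [/in_dcube /= -> _] := child_in yc.
by apply: (step_fun_le _ gs) => /=; rewrite (le_trans _ kk')// gerBl.
Qed.

Lemma negligible_eps (N : set (Rn R n)) :
  (forall e : R, 0 < e -> exists B, [/\ measurable B, N `<=` B & (mu B <= e%:E)%E]) ->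
  mu.-negligible N.
Proof.
move=> HN; have /choice[B hB] j : exists B, [/\ measurable B, N `<=` B &
    (mu B <= (j.+1%:R^-1)%:E)%E] by apply: HN; rewrite invr_gt0.
have mB j : measurable (B j) by have [] := hB j.
have mI : measurable (\bigcap_j B j) by exact: bigcapT_measurable.
exists (\bigcap_j B j); split => //; last by move=> x Nx j _; have [_ + _] := hB j; apply.
apply/le_anti; rewrite measure_ge0 andbT; apply/lee_addgt0Pr => e e0; rewrite add0e.
pose j := Num.trunc e^-1.
have [_ _ hj] := hB j; apply: (@le_trans _ _ (mu (B j))).
  by apply: le_measure; rewrite ?inE//; exact: bigcap_inf.
apply: (le_trans hj); rewrite lee_fin -[leRHS]invrK lef_pV2 ?posrE ?invr_gt0//.
exact/ltW/truncnS_gt.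
Qed.

Lemma chebyshev_dcube f Q (lam : R) : 0 < lam -> dint f ->
  (mu (dcube Q `&` [set x | (lam < `|f x|)%R]) <=
    (lam^-1)%:E * \int[mu]_(x in dcube Q) `|f x|%:E)%E.
Proof.
move=> lam0 [mf fi]; set E := _ `&` _.
have mQ : measurable (dcube Q : set (Rn R n)) by exact: measurable_dcube.
have mf' : measurable_fun setT (fun x => `|f x|) by exact: measurableT_comp.
have mE : measurable E.
  apply: measurableI => //.
  rewrite (_ : [set x | _] = (fun x => `|f x|) @^-1` `]lam, +oo[%classic).
    by rewrite -[X in measurable X]setTI; apply: mf' => //; exact: measurable_itv.
  by apply/seteqP; split => x /=; rewrite in_itv/= andbT.
have h : (lam%:E * mu E <= \int[mu]_(x in dcube Q) `|f x|%:E)%E.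
  rewrite -integral_cst//.
  apply: (@le_trans _ _ (\int[mu]_(x in E) `|f x|%:E)%E).
    apply: ge0_le_integral => //.
    - by move=> x _; rewrite lee_fin ltW.
    - by apply/measurable_EFinP; exact: measurable_funTS.
    - by move=> x [_ /ltW]; rewrite lee_fin.
  apply: ge0_subset_integral => //; first by apply/measurable_EFinP; exact: measurable_funTS.
  by move=> x [].
rewrite -[mu E]mul1e -(mulVf (lt0r_neq0 lam0)) EFinM -muleA.
by rewrite lee_wpmul2l// lee_fin invr_ge0 ltW.
Qed.

(** Write [f = h + g] with [g] a step function of depth [d0] and [h] small in L^1. Past [d0] the
    sums of [g] are frozen and its averages equal [g]; the maximal weak type and Chebyshev's
    inequality control [h] outside a small set. *)
Lemma negligible_cube f Q (e : R) : dint f -> 0 < e ->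
  mu.-negligible (dcube Q `&` [set x | ~ exists d0, forall d, (d0 <= d)%N ->
  `|psum Q.1 f d x - psum Q.1 f d0 x| <= e /\
  `|avR f (Q.1 - (s * d)%N%:Z, cell (Q.1 - (s * d)%N%:Z) x) - f x| <= e]).
Proof.
move=> fi e0; pose lam := e / 2; have lam0 : 0 < lam by rewrite divr_gt0.
have [mf fQ] := fi.
apply: negligible_eps => ep ep0.
have [W WE] : exists W, W = @wconst R n tau C0 by exists (@wconst R n tau C0).
have W0 : 0 < W.
  by rewrite WE /wconst ltr_wpDr// mulr_ge0// exprn_ge0// (bconst_ge0 aC).
(* The two exceptional sets have measure at most [W / lam * eta] and [eta / lam], which add up to
   [ep]. *)
pose eta := ep * lam / (W + 1).
have W1 : 0 < W + 1 by rewrite addr_gt0.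
have eta0 : 0 < eta by apply: divr_gt0 => //; exact: mulr_gt0.
have [_ /(_ eta eta0)[d0 [g [bg fg]]]] := approx_integrable (ltn0Sn tau) mf (fQ Q).
have gi := bstep_dint bg; have [gs _] := bg.
pose h x := f x - g x.
have hi : dint h by apply: dintD => //; exact: dintN.
have fE : f = (fun x => h x + g x) by apply/funext => x; rewrite /h subrK.
have hE x : h x = f x - g x by [].
have {}fg : (\int[mu]_(x in dcube Q) `|h x|%:E <= eta%:E)%E by exact: fg.
clearbody h.
have mQ : measurable (dcube Q : set (Rn R n)) by exact: measurable_dcube.
pose E1 := \bigcup_d @maxset R n tau H a mask Q h lam d.
pose E2 := dcube Q `&` [set x : Rn R n | (lam < `|h x|)%R].
have mE1 : measurable E1.
  by apply: bigcupT_measurable => d; exact: (measurable_maxset n_gt0).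
have mE2 : measurable E2.
  apply: measurableI => //.
  rewrite (_ : [set x | _] = (fun x => `|h x|) @^-1` `]lam, +oo[%classic).
    have mh : measurable_fun setT (fun x => `|h x|) by apply: measurableT_comp => //; case: hi.
    by rewrite -[X in measurable X]setTI; apply: mh => //; exact: measurable_itv.
  by apply/seteqP; split => x /=; rewrite in_itv/= andbT.
exists (E1 `|` E2); split; first exact: measurableU.
- move=> x [xQ Hx]; apply: contrapT => nE; apply: Hx; exists d0 => d dd0.
  have n1 l : ~ (lam < `|psum Q.1 h l x| \/
     lam < `|avR h (Q.1 - (s * l)%N%:Z, cell (Q.1 - (s * l)%N%:Z) x)|).
    by move=> hl; apply: nE; left; exists l => //; split => //; exists l.
  have n2 : `|h x| <= lam by rewrite leNgt; apply/negP => hl; apply: nE; right.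
  have p1 l : `|psum Q.1 h l x| <= lam.
    by rewrite leNgt; apply/negP => hl; apply: (n1 l); left.
  have p2 l : `|avR h (Q.1 - (s * l)%N%:Z, cell (Q.1 - (s * l)%N%:Z) x)| <= lam.
    by rewrite leNgt; apply/negP => hl; apply: (n1 l); right.
  have ee : e = lam + lam by rewrite /lam -splitr.
  have gs' l : (d0 <= l)%N -> step_fun (Q.1 - (s * l)%N%:Z) g.
    by move=> dl; apply: step_fun_le gs; rewrite lerD2l lerN2 lez_nat leq_mul2l dl orbT.
  split.
    have pg : psum Q.1 g d x = psum Q.1 g d0 x.
      rewrite /residue_sum (big_cat_nat (leq0n d0) dd0)/=.
      rewrite [X in _ + X](_ : _ = 0) ?addr0//.
      rewrite big_nat big1// => l /andP[d0l _]; rewrite /masked_shift_at; case: (mask _) => //.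
      exact: (blk_step0 _ gi (gs' l d0l)).
    rewrite fE !psumD// pg (_ : _ - _ = psum Q.1 h d x - psum Q.1 h d0 x); last ring.
    by rewrite ee; apply: le_trans (ler_normB _ _) _; exact: lerD.
  rewrite {1}fE avRD// (@avR_step g _ x)//; [|exact: gs'|exact: dcube_cell].
  rewrite (_ : _ - f x = avR h (Q.1 - (s * d)%N%:Z, cell (Q.1 - (s * d)%N%:Z) x) - h x); last first.
    by rewrite hE; ring.
  by rewrite ee; apply: le_trans (ler_normB _ _) _; exact: lerD.
have h1 := maxset_le n_gt0 HH aC mask Q lam0 hi; rewrite -WE in h1.
have h2 := chebyshev_dcube Q lam0 hi.
apply: le_trans (measureU2 _ mE1 mE2) _.
apply: le_trans (leeD h1 h2) _.
apply: (@le_trans _ _ ((W / lam)%:E * eta%:E + (lam^-1)%:E * eta%:E)%E).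
  apply: leeD; apply: lee_wpmul2l => //; rewrite lee_fin ?invr_ge0 ?divr_ge0// ltW//.
rewrite -!EFinM -EFinD lee_fin /eta le_eqVlt; apply/orP; left; apply/eqP; field.
by rewrite !gt_eqF// addr_gt0.
Qed.

Lemma ae_good f : dint f -> {ae mu, forall x, forall k,
  cvgn (fun d => psum k f d x) /\
  avR f (k - (s * d)%N%:Z, cell (k - (s * d)%N%:Z) x) @[d --> \oo] --> f x}.
Proof.
move=> fi.
pose B (k : int) (m : n.-tuple int) (j : nat) := dcube (k, m) `&` [set x : Rn R n |
  ~ exists d0, forall d, (d0 <= d)%N -> `|psum k f d x - psum k f d0 x| <= j.+1%:R^-1 /\
  `|avR f (k - (s * d)%N%:Z, cell (k - (s * d)%N%:Z) x) - f x| <= j.+1%:R^-1].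
pose F i := if (unpickle i : option (int * n.-tuple int * nat)) is Some t then
  B t.1.1 t.1.2 t.2 else set0.
have negF : mu.-negligible (\bigcup_i F i).
  apply: negligible_bigcup => i; rewrite /F; case: (unpickle i) => [t|]; last exact: negligible_set0.
  by apply: negligible_cube => //; rewrite invr_gt0.
rewrite /almost_everywhere; apply: negligibleS negF => x /= nx; apply: contrapT => nF; apply: nx => k.
have gd (e : R) : 0 < e -> exists d0, forall d, (d0 <= d)%N ->
    `|psum k f d x - psum k f d0 x| <= e /\
    `|avR f (k - (s * d)%N%:Z, cell (k - (s * d)%N%:Z) x) - f x| <= e.
  move=> e0; pose j := Num.trunc e^-1.
  have je : j.+1%:R^-1 <= e.
    by rewrite -[leRHS]invrK lef_pV2 ?posrE ?invr_gt0//; exact/ltW/truncnS_gt.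
  apply: contrapT => nd; apply: nF; exists (pickle (k, cell k x, j)); first by [].
  rewrite /F pickleK /B /=; split; first exact: dcube_cell.
  move=> [d0 Hd]; apply: nd; exists d0 => d /Hd[h1 h2].
  by split; [exact: le_trans h1 je|exact: le_trans h2 je].
split.
  apply: cauchy_cvg; apply/cauchy_ballP => e e0; rewrite near_map2.
  have [d0 Hd] := gd (e / 3) (divr_gt0 e0 (ltr0Sn _ 2)).
  exists ([set d | (d0 <= d)%N], [set d | (d0 <= d)%N]); first by split; exists d0.
  move=> [d d'] [/= hd hd']; rewrite /ball/=.
  have [h1 _] := Hd d hd; have [h2 _] := Hd d' hd'.
  rewrite (_ : _ - _ = (psum k f d x - psum k f d0 x) - (psum k f d' x - psum k f d0 x)); last ring.
  apply: le_lt_trans (ler_normB _ _) _; apply: le_lt_trans (lerD h1 h2) _; lra.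
apply/cvgrPdist_le => e e0; have [d0 Hd] := gd e e0; exists d0 => // d /= dd.
by rewrite distrC; have [] := Hd d dd.
Qed.

End ae_convergence.

(** * Splitting a sum into residue classes *)

Section residues.
Context {R : realType}.
Variable tau : nat.
Local Notation s := tau.+1.
Implicit Types (z : nat -> R).

(* The number of [i < N] congruent to [j] modulo [s]. *)
Definition cnt j N := ((N + (s - j).-1) %/ s)%N.

Lemma cntS j N : (j < s)%N -> cnt j N.+1 = ((N %% s == j) + cnt j N)%N.
Proof.
move=> js; rewrite /cnt addSn divnS//; congr (_ + _)%N; congr nat_of_bool.
rewrite -addnS prednK ?subn_gt0// /dvdn -modnDml.
have := ltn_pmod N (ltn0Sn tau); set r := (N %% s)%N => rs.
have [->|rj] := eqVneq r j; first by rewrite subnKC ?modnn// ltnW.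
apply/negbTE; have [lt|ge] := ltnP r j.
  by rewrite modn_small -?lt0n; lia.
have {}ge : (j < r)%N by rewrite ltn_neqAle eq_sym rj.
have -> : (r + (s - j))%N = ((r - j) + s)%N by lia.
have h1 : (r - j < s)%N by lia.
have h2 : (0 < r - j)%N by lia.
by rewrite modnDr modn_small// -lt0n.
Qed.

Lemma cnt_eq N : cnt (N %% s) N = (N %/ s)%N.
Proof.
rewrite /cnt {1}(divn_eq N s); have := ltn_pmod N (ltn0Sn tau).
set r := (N %% s)%N => rs.
have -> : (N %/ s * s + r + (s - r).-1)%N = (N %/ s * s + tau)%N by lia.
by rewrite divnMDl// (divn_small (ltnSn tau)) addn0.
Qed.

Lemma sum_residues z N :
  \sum_(0 <= i < N) z i = \sum_(j < s) \sum_(0 <= l < cnt j N) z (j + s * l)%N.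
Proof.
elim: N => [|N IH].
  rewrite big_geq// big1// => j _; rewrite big_geq// /cnt add0n divn_small//.
  by have := ltn_ord j; lia.
rewrite big_nat_recr//= IH.
have rs := ltn_pmod N (ltn0Sn tau).
pose r : 'I_s := Ordinal rs.
rewrite (bigD1 r)//= [in RHS](bigD1 r)//= cntS// eqxx add1n big_nat_recr//=.
have e : (N %% s + s * cnt (N %% s) N)%N = N.
  by rewrite cnt_eq addnC mulnC -divn_eq.
rewrite e addrAC; congr (_ + _).
apply: eq_bigr => j jr; rewrite cntS// (negbTE (_ : (N %% s)%N != j))//.
by apply: contra jr => /eqP Nj; apply/eqP/val_inj.
Qed.

Lemma cnt_full j d : (j < s)%N -> cnt j (s * d) = d.
Proof.
move=> js; rewrite /cnt mulnC divnMDl// divn_small ?addn0//; lia.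
Qed.

Lemma cnt_cvg j : cnt j N @[N --> \oo] --> \oo.
Proof.
apply/cvgnyPge => A; exists (A * s)%N => // N /= AN.
by rewrite /cnt leq_divRL// (leq_trans AN)// leq_addr.
Qed.

Lemma is_cvg_bigsum (J : Type) (r : seq J) (f : J -> nat -> R) :
  (forall j, cvgn (f j)) -> cvgn (fun N => \sum_(j <- r) f j N).
Proof.
move=> H; elim: r => [|j r IH].
  by under eq_fun do rewrite big_nil; exact: is_cvg_cst.
by under eq_fun do rewrite big_cons; exact: is_cvgD.
Qed.

Lemma cvg_residues z :
  (forall j, (j < s)%N -> cvgn (fun L => \sum_(0 <= l < L) z (j + s * l)%N)) ->
  cvgn (fun N => \sum_(0 <= i < N) z i).
Proof.
move=> H; under eq_fun do rewrite sum_residues.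
apply: is_cvg_bigsum => j; have /cvg_ex[l Hl] := H j (ltn_ord j).
by apply/cvg_ex; exists l; exact: (cvg_comp _ _ (cnt_cvg j) Hl).
Qed.

End residues.

(** * Convergence of the partial sums of the shift *)

Section shift_convergence.
Context {R : realType} {n : nat}.
Hypothesis n_gt0 : (0 < n)%N.
Local Notation mu := (lebesgue_Rn n : {measure set (Rn R n) -> \bar R}).
Implicit Types (x : Rn R n) (k : int) (Q : dyadic n) (f : Rn R n -> R).
Variables (tau : nat) (C0 : R) (H : dyadic n -> Rn R n -> R)
  (a : dyadic n -> dyadic n -> dyadic n -> R).
Local Notation s := tau.+1.
Local Notation absf := (fun f : Rn R n -> R => fun x => `|f x|).
Hypothesis HH : forall Q, haar_function Q (H Q).
Hypothesis aC : forall Q Q' Q'', near_subcubes R tau Q Q' -> near_subcubes R tau Q Q'' ->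
  `|a Q Q' Q''| <= C0 * Num.sqrt (dvol R Q' / dvol R Q * (dvol R Q'' / dvol R Q)).
Local Notation blk := (@shift_at R n tau H a).

Definition partial_shift f x (N : nat) :=
  \sum_(Q \in [set Q | - N%:Z <= Q.1 <= N%:Z]) shift_block tau H a Q f x.

Lemma partial_shiftE f x N :
  partial_shift f x N = \sum_(0 <= i < N.*2.+1) blk (N%:Z - i%:Z) f x.
Proof.
rewrite /partial_shift.
pose h i : dyadic n := (N%:Z - i%:Z, cell (N%:Z - i%:Z) x).
have hinj : set_inj `I_(N.*2.+1) h.
  by move=> i j _ _ [/addrI /oppr_inj [] //].
rewrite -(@fsbig_widen _ _ _ _ (h @` `I_(N.*2.+1))).
- by rewrite fsbig_image// -fsbig_ord big_mkord.
- move=> Q [i /= iN <-] /=; lia.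
- move=> Q [/= /andP[h1 h2] nQ]; apply: (@shift_block_out R n tau H a HH) => xQ; apply: nQ.
  exists (absz (N%:Z - Q.1)); first by rewrite /=; lia.
  rewrite /h gez0_abs ?subr_ge0// subKr; exact/esym/dcube_eq.
Qed.

Lemma blk_bound k f x : dint f ->
  `|blk k f x| <= @bconst R n tau C0 * avR (absf f) (k, cell k x).
Proof.
move=> fi; have xQ : dcube (k, cell k x) x by exact: dcube_cell.
rewrite /shift_at (@shift_blockE _ _ n_gt0 tau H a HH)//.
rewrite (avR_children s _ (dint_abs fi)) -meanZ.
apply: le_trans (ler_norm_mean (@cidx_gt0 n s) _) _.
apply: (le_mean (@cidx_gt0 n s)) => c; rewrite normrM.
by apply: ler_pM => //; [exact: (bker_le n_gt0 HH aC)|exact: ler_norm_avR].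
Qed.

Lemma avR_abs_le f (L : R) k x : dint f -> (\int[mu]_x `|f x|%:E <= L%:E)%E -> 0 <= k ->
  avR (absf f) (k, cell k x) <= L * (2 ^ k)^-1.
Proof.
move=> fi fL k0; set Q := (k, cell k x).
have [_ /(_ Q) fa] := dint_abs fi.
have v0 := dvol_gt0 (R := R) Q.
have L0 : 0 <= L by rewrite -lee_fin; apply: le_trans fL; exact: integral_ge0.
have h : dvol R Q * avR (absf f) Q <= L.
  rewrite -lee_fin -(integral_dcubeE fa); apply: le_trans fL.
  apply: ge0_subset_integral => //; first exact: measurable_dcube.
  by apply/measurable_EFinP; case: (dint_abs fi).
have h2 : avR (absf f) Q <= L / dvol R Q by rewrite ler_pdivlMr// mulrC.
apply: (le_trans h2); rewrite ler_wpM2l// lef_pV2 ?posrE ?pow2_gt0//.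
rewrite dvolE /Q /= -[leLHS]expr1 ler_weXn2l//.
have -> : (1 : R) = 2 ^ (0 : int) by [].
by rewrite pow2_le.
Qed.

(** At small scales [ae_good] applies to each residue class. At large scales global integrability
    makes the averages decay at least like [2^-k], and the series is dominated by a geometric
    one. *)
Lemma partial_shift_cvg f : dint f -> (\int[mu]_x `|f x|%:E < +oo)%E ->
  {ae mu, forall x, cvgn (partial_shift f x)}.
Proof.
move=> fi fL; have := ae_good n_gt0 HH aC (fun=> true) fi.
apply: filterS => x gx.
have e N : partial_shift f x N = \sum_(0 <= i < N) blk (i.+1)%:Z f x +
    \sum_(0 <= i < N.+1) blk (- i%:Z) f x.
  rewrite partial_shiftE (@big_cat_nat _ _ _ N)//=; last by lia.
  congr (_ + _).
    rewrite big_nat_rev/= add0n; apply: eq_big_nat => i iN; congr (blk _ f x); lia.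
  rewrite -{1}[N]add0n big_addn (_ : (N.*2.+1 - N)%N = N.+1); last lia.
  apply: eq_big_nat => i _; congr (blk _ f x); lia.
rewrite (_ : partial_shift f x = (fun N => \sum_(0 <= i < N) blk (i.+1)%:Z f x +
    \sum_(0 <= i < N.+1) blk (- i%:Z) f x)); last exact/funext.
apply: is_cvgD; last first.
  have cv : cvgn (fun N => \sum_(0 <= i < N) blk (- i%:Z) f x).
    apply: (@cvg_residues _ tau) => j js; have [h _] := gx (- j%:Z).
    rewrite (_ : (fun L => _) = (fun d => @residue_sum R n tau H a (fun=> true) (- j%:Z) f d x))//.
    apply/funext => L; apply: eq_bigr => l _.
    by rewrite /masked_shift_at PoszD opprD.
  have /cvg_ex[l Hl] := cv; apply/cvg_ex; exists l.
  by move: Hl; rewrite -(cvg_shiftS (fun N => \sum_(0 <= i < N) blk (- i%:Z) f x)).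
have [L HL] : exists L : R, (\int[mu]_x `|f x|%:E <= L%:E)%E.
  exists (fine (\int[mu]_x `|f x|%:E)%E); rewrite fineK// ge0_fin_numE//.
  exact: integral_ge0.
have L0 : 0 <= L by rewrite -lee_fin; apply: le_trans HL; exact: integral_ge0.
pose B := @bconst R n tau C0.
have B0 : 0 <= B by exact: (bconst_ge0 aC).
rewrite -[X in cvgn X]/(series (fun i => blk (i.+1)%:Z f x)); apply: normed_cvg.
apply: (@series_le_cvg _ _ (geometric (B * L) 2^-1)).
- by move=> i; exact: normr_ge0.
- by move=> i; apply: mulr_ge0; [exact: mulr_ge0|exact: exprn_ge0].
- move=> i; apply: le_trans (blk_bound _ _ fi) _; rewrite -[leRHS]/(B * L * 2^-1 ^+ i) -[leRHS]mulrA.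
  apply: (@ler_wpM2l _ B) => //; apply: le_trans (avR_abs_le x fi HL _) _ => //.
  rewrite ler_wpM2l// exprVn lef_pV2 ?posrE ?pow2_gt0 ?exprn_gt0//.
  by rewrite -exprnP exprS ler_peMl ?exprn_ge0// ler1n.
- by apply: is_cvg_geometric_series; rewrite ger0_norm// invf_lt1// ltr1n.
Qed.

End shift_convergence.

(** * Weighted estimates on dyadic cubes *)
Import HBNNSimple.

(* No measurability is assumed: the integral of a nonnegative function is a
   supremum over simple functions below it. *)
Lemma ae_le_integral d (T : measurableType d) (R : realType)
    (mu : {measure set T -> \bar R}) (f g : T -> \bar R) :
  (forall x, 0 <= f x)%E -> (forall x, 0 <= g x)%E ->
  {ae mu, forall x, (f x <= g x)%E} -> (\int[mu]_x f x <= \int[mu]_x g x)%E.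
Proof.
move=> f0 g0 [A [mA A0 fgA]].
rewrite [leLHS]ge0_integralTE//; apply: ge_ereal_sup => _ [h hf <-].
have mCA : measurable (~` A) by exact: measurableC.
pose h' := proj_nnsfun h mCA.
have hE x : h' x = (h \_ (~` A)) x by rewrite mrestrict.
rewrite -integralT_nnsfun.
rewrite (_ : (\int[mu]_x (h x)%:E = \int[mu]_x (h' x)%:E)%E); last first.
  apply: ae_eq_integral => //.
  - exact/measurable_EFinP.
  - exact/measurable_EFinP.
  - exists A; split => // x /= nx; apply: contrapT => nA; apply: nx => _.
    have e : h' x = h x by rewrite hE patchE mem_set.
    exact: (congr1 EFin (esym e)).
rewrite [leRHS]ge0_integralTE//; apply: ereal_sup_ubound; exists h'.
  move=> x; rewrite hE patchE; case: ifPn => // /set_mem xA.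
  apply: le_trans (hf x) _.
  by apply: contrapT => nfg; apply: xA; apply: fgA.
by rewrite -integralT_nnsfun.
Qed.

(** The limit is identified almost everywhere, so [g] is compared with the lower limit of the
    sequence by [ae_le_integral] before Fatou's lemma is applied. *)
Lemma fatou_bound d (T : measurableType d) (R : realType)
    (mu : {measure set T -> \bar R}) (D : set T) (B : \bar R)
    (f : nat -> T -> R) (g : T -> R) :
  measurable D -> (forall k, measurable_fun D (f k)) ->
  (forall k x, 0 <= f k x) -> (forall x, 0 <= g x) ->
  {ae mu, forall x, D x -> f k x @[k --> \oo] --> g x} ->
  (forall k, (\int[mu]_(x in D) (f k x)%:E <= B)%E) ->
  (\int[mu]_(x in D) (g x)%:E <= B)%E.
Proof.
move=> mD mf f0 g0 fg fB.
apply: (@le_trans _ _ (\int[mu]_(x in D) limn_einf (fun k => (f k x)%:E))%E).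
  rewrite integral_mkcond [leRHS]integral_mkcond; apply: ae_le_integral.
  - by move=> x; rewrite patchE; case: ifPn => // _; rewrite lee_fin.
  - move=> x; rewrite patchE; case: ifPn => // _; rewrite limn_einf_lim.
    apply: lime_ge; first exact: is_cvg_einfs.
    by apply: nearW => k; apply: le_ereal_inf_tmp => _ [m /= _ <-]; rewrite lee_fin.
  - apply: filterS fg => x fgx; rewrite !patchE; case: ifPn => // /set_mem Dx.
    have h : (f k x)%:E @[k --> \oo] --> (g x)%:E by apply: cvg_EFin; [exact: nearW|exact: fgx].
    by rewrite (cvg_limn_einf_sup h).1.
apply: le_trans (fatou _ _ _ _) _ => //.
- by move=> k; exact/measurable_EFinP.
- by move=> k x _; rewrite lee_fin.
rewrite limn_einf_lim; apply: lime_le; first exact: is_cvg_einfs.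
by apply: nearW => k; apply: le_trans (fB k); apply: ereal_inf_lbound; exists k => /=.
Qed.

Lemma powR_pred (R : realType) (x q : R) : 0 < x -> x `^ q = x * x `^ (q - 1).
Proof. by move=> x0; rewrite -{1}(subrKC 1 q) (@powR_addp _ x 1 (q - 1) x0) powRr1// ltW. Qed.

(** With [A = 2 * S * m] the term [m * S] is half of [A] and is absorbed. *)
Lemma jensen_arith (R : realType) (p A S m G : R) : 0 < S -> 0 < m ->
  A = 2 * S * m -> A <= m * S + m `^ (1 - p) * G -> A `^ p * S `^ (1 - p) <= 2 `^ p * G.
Proof.
move=> S0 m0 -> h.
rewrite !powRM ?mulr_ge0 ?(ltW S0) ?(ltW m0)//.
rewrite -mulrA -mulrA ler_pM2l ?powR_gt0//.
have -> : S `^ p * (m `^ p * S `^ (1 - p)) = S * m `^ p.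
  rewrite mulrCA [RHS]mulrC; congr (_ * _); rewrite -powR_addp// subrKC.
  by rewrite powRr1// ltW.
have {}h : S * m <= m `^ (1 - p) * G by lra.
rewrite (powR_pred p m0).
have -> : G = m `^ (1 - p) * G * m `^ (p - 1).
  rewrite mulrAC -powR_addp// (_ : 1 - p + _ = 0) ?powRr0 ?mul1r//; ring.
by rewrite mulrA ler_pM2r// powR_gt0.
Qed.

Lemma measurable_powMw d (T : measurableType d) (R : realType) (p : R) (w f : T -> R) :
  measurable_fun setT w -> measurable_fun setT f ->
  measurable_fun setT (fun x => `|f x| `^ p * w x).
Proof.
move=> mw mf; apply: measurable_funM => //.
apply: (measurableT_comp (f := fun y : R => y `^ p)) => //.
exact: measurableT_comp.
Qed.

Section weighted_averages.
Context {R : realType} {n : nat}.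
Local Notation mu := (lebesgue_Rn n : {measure set (Rn R n) -> \bar R}).
Implicit Types (x y : Rn R n) (Q : dyadic n) (f g : Rn R n -> R).

Lemma avR_le f g Q : dint f -> dint g -> (forall x, f x <= g x) -> avR f Q <= avR g Q.
Proof.
move=> [_ fi] [_ gi] fg; rewrite ler_wpM2l ?invr_ge0 ?(ltW (dvol_gt0 _))//.
by apply: le_Rintegral => //; exact: measurable_dcube.
Qed.

Lemma dint_cst (c : R) : dint (fun _ : Rn R n => c).
Proof. exact: (@bounded_dint _ _ _ `|c|). Qed.

Lemma avR_cst (c : R) Q : avR (fun=> c) Q = c.
Proof. exact: (avR_step (dint_cst c) _ (corner_in Q)). Qed.

Lemma avRZ (c : R) f Q : dint f -> avR (fun x => c * f x) Q = c * avR f Q.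
Proof.
move=> [_ fi]; rewrite /avR RintegralZl//; first by rewrite mulrCA.
exact: measurable_dcube.
Qed.

Lemma dintZ (c : R) f : dint f -> dint (fun x => c * f x).
Proof.
move=> [mf fi]; split; first exact: measurable_funM.
move=> Q; have := integrableZl (measurable_dcube Q) c (fi Q).
by apply: eq_integrable => //; exact: measurable_dcube.
Qed.

Lemma dintMb f g (B : R) : dint f -> measurable_fun setT g -> (forall x, `|g x| <= B) ->
  dint (fun x => g x * f x).
Proof.
move=> [mf fi] mg gB; split; first exact: measurable_funM.
move=> Q; have [_ /(_ Q) h] := dintZ B (dint_abs (conj mf fi)).
apply: le_integrable h => //; first exact: measurable_dcube.
  by apply/measurable_EFinP; apply: measurable_funTS; exact: measurable_funM.
move=> x _ /=; rewrite lee_fin !normrM normr_id ler_wpM2r//.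
by rewrite (le_trans (gB x))// ler_norm.
Qed.

Lemma avR_gt0 f Q : dint f -> (forall x, 0 < f x) -> 0 < avR f Q.
Proof.
move=> fi f0; have [mf /(_ Q) fQ] := fi.
have mQ := @measurable_dcube R _ Q.
rewrite lt_neqAle avR_ge0 ?andbT; last by move=> x; exact: ltW.
apply/negP => /eqP e0.
have : (\int[mu]_(x in dcube Q) `|(f x)%:E| = 0)%E.
  under eq_integral => x _ do rewrite abse_EFin ger0_norm ?(ltW (f0 x))//.
  by rewrite integral_dcubeE// -e0 mulr0.
move/ae_eq_integral_abs => /(_ mQ) [|A [mA A0 sA]].
  by apply/measurable_EFinP; exact: measurable_funTS.
have : (mu (dcube Q) <= mu A)%E.
  apply: le_measure; rewrite ?inE// => x xQ; apply: sA => /= h.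
  by have := f0 x; rewrite (EFin_inj (h xQ)) ltxx.
by rewrite A0 mu_dcube lee_fin leNgt dvol_gt0.
Qed.

Variables (p : R) (w sg : Rn R n -> R).
Hypotheses (p1 : 1 < p) (w0 : forall x, 0 < w x)
  (sgE : forall x, sg x = w x `^ (- (p - 1)^-1)) (wi : dint w) (si : dint sg).

Let sg0 x : 0 < sg x. Proof. by rewrite sgE powR_gt0. Qed.

Lemma weight_dual x : w x * sg x `^ (p - 1) = 1.
Proof.
rewrite sgE -powRrM mulNr mulVf; last by rewrite gt_eqF// subr_gt0.
by rewrite powR_inv1 ?(ltW (w0 x))// mulfV// gt_eqF.
Qed.

(** Either [y] is at most [m sg], or the factor [(y / (m sg))^(p-1)], which is at least 1, may be
    inserted; [w sg^(p-1) = 1] then produces the second term. Averaged and optimized in [m], this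
    replaces Hoelder's inequality. *)
Lemma split_weight (m y : R) x : 0 < m -> 0 <= y ->
  y <= m * sg x + m `^ (1 - p) * (y `^ p * w x).
Proof.
move=> m0 y0; have [ys|sy] := leP y (m * sg x).
  by rewrite (le_trans ys)// lerDl !mulr_ge0 ?powR_ge0// ltW.
have yp : 0 < y by apply: le_lt_trans sy; rewrite mulr_ge0// ltW.
rewrite (@le_trans _ _ (m `^ (1 - p) * (y `^ p * w x)))//; last first.
  by rewrite lerDr mulr_ge0// ltW.
rewrite (powR_pred p yp).
have h : (m * sg x) `^ (p - 1) <= y `^ (p - 1).
  by apply: ler_powRl; [by rewrite subr_ge0 ltW|rewrite mulr_ge0// ltW|exact: ltW].
have -> : m `^ (1 - p) * (y * y `^ (p - 1) * w x) =
    y * (m `^ (1 - p) * y `^ (p - 1) * w x) by ring.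
rewrite -[leLHS]mulr1 ler_pM2l//.
apply: (@le_trans _ _ (m `^ (1 - p) * (m * sg x) `^ (p - 1) * w x)).
  rewrite powRM ?(ltW m0)// ?(ltW (sg0 x))// -[leRHS]mulrA -[X in m `^ _ * X]mulrA.
  rewrite [_ * w x]mulrC weight_dual mulr1 -powR_addp//.
  by rewrite (_ : 1 - p + (p - 1) = 0) ?powRr0//; ring.
by rewrite ler_wpM2r ?(ltW (w0 x))// ler_wpM2l ?powR_ge0.
Qed.

(** Hoelder's inequality up to the factor [2^p], obtained with [m] equal to half the ratio of the
    two averages. It brings the tree norm of the averages of [u] back to the norm of [u]. *)
Lemma jensen_weight u Q : dint u -> dint (fun x => `|u x| `^ p * w x) ->
  `|avR u Q| `^ p * avR sg Q `^ (1 - p) <= 2 `^ p * avR (fun x => `|u x| `^ p * w x) Q.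
Proof.
move=> ui Gi; set G := fun x => _; set S := avR sg Q.
have S0 : 0 < S by exact: avR_gt0.
have G0 : 0 <= avR G Q by apply: avR_ge0 => x; rewrite mulr_ge0 ?powR_ge0// ltW.
have p0 : p != 0 by rewrite gt_eqF// (lt_trans _ p1).
have [->|u0] := eqVneq (avR u Q) 0.
  by rewrite normr0 powR0// mul0r mulr_ge0// powR_ge0.
set A := `|avR u Q|; have A0 : 0 < A by rewrite normr_gt0.
pose m := A / (2 * S); have m0 : 0 < m by rewrite divr_gt0// mulr_gt0.
have : A <= m * S + m `^ (1 - p) * avR G Q.
  apply: le_trans (ler_norm_avR _ ui) _.
  rewrite -!avRZ// -avRD; [|exact: dintZ..].
  apply: avR_le; [exact: dint_abs|apply: dintD; exact: dintZ|].
  by move=> x; exact: split_weight.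
apply: jensen_arith => //; rewrite /m; field; rewrite gt_eqF//.
Qed.

(** The case [u = 1] of [jensen_weight]. *)
Lemma ap_lower Q : (2 `^ p)^-1 <= avR w Q * avR sg Q `^ (p - 1).
Proof.
have e : (fun x => `|1| `^ p * w x) = w by apply/funext => x; rewrite normr1 powR1 mul1r.
have := @jensen_weight (fun=> 1) Q (dint_cst 1); rewrite e => /(_ wi).
rewrite avR_cst normr1 powR1 mul1r => h; have S0 : 0 < avR sg Q by exact: avR_gt0.
have P0 : 0 < (2 : R) `^ p by rewrite powR_gt0.
rewrite -(ler_pM2l P0) mulfV ?gt_eqF// mulrA.
have e1 : 1 = avR sg Q `^ (1 - p) * avR sg Q `^ (p - 1).
  by rewrite -powR_addp// (_ : 1 - p + _ = 0) ?powRr0//; ring.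
by rewrite [leLHS]e1 ler_wpM2r// powR_ge0.
Qed.

Variable tau : nat.
Local Notation s := tau.+1.

Lemma leaf_ap_avL d Q : leaf_ap p (2 `^ p)^-1 d (@node_avg R n s w Q) (@node_avg R n s sg Q).
Proof. by move=> l _; split; [exact: avR_gt0..|exact: ap_lower]. Qed.

Lemma ap_tree_avL (D : R) d Q : (forall Q, avR w Q * avR sg Q `^ (p - 1) <= D) ->
  ap_tree p D d (@node_avg R n s w Q) (@node_avg R n s sg Q).
Proof.
move=> wD; elim: d Q => [|d IH] Q; split; rewrite ?avg_avL//.
by move=> c; rewrite !avL_child.
Qed.

Lemma bmo_tree_avL (b : Rn R n -> R) (beta : R) d Q : dint b ->
  (forall Q, avR (fun x => `|b x - avR b Q|) Q <= beta) ->
  bmo_tree d (@node_avg R n s b Q) beta.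
Proof.
move=> bi bB.
have h Q' d' : avg d' (fun l => `|@node_avg R n s b Q' l - avg d' (@node_avg R n s b Q')|) <= beta.
  have bci : dint (fun x => b x + - avR b Q') by apply: dintD => //; exact: dint_cst.
  apply: le_trans (bB Q'); rewrite avg_avL//; apply: le_trans (avgabs_le tau d' Q' bci).
  apply: (le_avg (@cidx_gt0 n s)) => l _.
  by rewrite /node_avg /tree_abs avRD ?avR_cst//; exact: dint_cst.
elim: d Q => [|d IH] Q; split => //.
by move=> c; rewrite avL_child.
Qed.

End weighted_averages.

Lemma cvg_powR (R : realType) (v : nat -> R) (l p : R) : 0 < p -> (forall k, 0 <= v k) ->
  v k @[k --> \oo] --> l -> v k `^ p @[k --> \oo] --> l `^ p.
Proof.
move=> p0 v0 vl; have l0 : 0 <= l.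
  by apply: (cvgr_to_ge vl); exact: nearW.
have [lp|l_le0] := ltP 0 l.
  apply: (cvg_comp v (fun y : R => y `^ p) vl).
  have : {for l, continuous (fun y : R => y `^ p)}.
    apply: differentiable_continuous; apply/derivable1_diffP.
    by apply: derivable_powR; rewrite in_itv/= lp.
  by [].
have le0 : l = 0 by apply/le_anti; rewrite l0 l_le0.
rewrite le0 powR0 ?gt_eqF//; apply/cvgrPdist_le => e e0.
move: vl; rewrite le0 => /cvgrPdist_le/(_ (e `^ p^-1)); rewrite powR_gt0// => /(_ isT).
apply: filterS => k; rewrite !sub0r !normrN !ger0_norm ?powR_ge0// => h.
rewrite -[leRHS](@powRr1 _ e) ?(ltW e0)// -(mulVf (lt0r_neq0 p0)) powRrM.
by apply: ler_powRl => //; exact: ltW.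
Qed.

(** * The estimate on one cube: refining the tree *)

Section weighted_cube.
Context {R : realType} {n : nat}.
Hypothesis n_gt0 : (0 < n)%N.
Local Notation mu := (lebesgue_Rn n : {measure set (Rn R n) -> \bar R}).
Implicit Types (x y : Rn R n) (k : int) (Q : dyadic n) (f g w : Rn R n -> R).
Variables (tau : nat) (C0 : R) (H : dyadic n -> Rn R n -> R)
  (a : dyadic n -> dyadic n -> dyadic n -> R).
Local Notation s := tau.+1.
Local Notation I := (@cidx n s).
Local Notation M := (#|{: I}|%:R : R).
Local Notation avL := (@node_avg R n s).
Local Notation addr := (@addr R n s).
Local Notation absf := (fun f : Rn R n -> R => fun x => `|f x|).
Hypothesis HH : forall Q, haar_function Q (H Q).
Hypothesis aC : forall Q Q' Q'', near_subcubes R tau Q Q' -> near_subcubes R tau Q Q'' ->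
  `|a Q Q' Q''| <= C0 * Num.sqrt (dvol R Q' / dvol R Q * (dvol R Q'' / dvol R Q)).
Variable mask : int -> bool.
Local Notation psum := (@residue_sum R n tau H a mask).

Lemma ler_leaf d (Phi : seq I -> R) l : size l = d ->
  `|Phi l| <= M ^+ d * avg d (fun l => `|Phi l|).
Proof.
elim: d Phi l => [|d IH] Phi [|c l]//=; first by rewrite mul1r.
move=> [ld].
apply: (le_trans (IH (sub Phi c) l ld)); rewrite exprSr -mulrA ler_wpM2l ?exprn_ge0//.
exact: (@avg_child_le _ _ (@cidx_gt0 n s) d (fun l => `|Phi l|)).
Qed.

Lemma addr_node d Q l x : size l = d -> dcube (node Q l) x -> addr d Q x = l /\ dcube Q x.
Proof.
elim: d Q l => [|d IH] Q [|c l]//=.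
move=> [ld] xl; have [e xc] := IH _ _ ld xl; have [xQ ec] := child_in xc.
by split => //; rewrite -ec e.
Qed.

Lemma dint_addr d Q (Phi : seq I -> R) u : dint u ->
  dint (fun x => Phi (addr d Q x) * u x).
Proof.
move=> ui; apply: (@dintMb _ _ _ _ (M ^+ d * avg d (fun l => `|Phi l|))) => //.
  exact: measurable_addr.
by move=> x; apply: ler_leaf; exact: size_addr.
Qed.

Lemma avL_addr d Q (Phi : seq I -> R) u l : dint u -> size l = d ->
  avL (fun x => Phi (addr d Q x) * u x) Q l = Phi l * avL u Q l.
Proof.
move=> ui ld; rewrite /node_avg -avRZ// /avR; congr (_ * _); apply: eq_Rintegral => x /set_mem xl.
by have [-> _] := addr_node ld xl.
Qed.

(** Averaging over cells contracts the L^1 norm on [Q] and reproduces step functions of coarser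
    mesh, so the density of the latter suffices. *)
Lemma L1_avL b Q (e : R) : dint b -> 0 < e -> exists d1, forall d, (d1 <= d)%N ->
  (\int[mu]_(x in dcube Q) `|avL b Q (addr d Q x) - b x|%:E <= e%:E)%E.
Proof.
move=> bi e0; have [mb /(_ Q) bQ] := bi.
have s0 : (0 < s)%N by [].
have [_ /(_ (e / 2)) []] := approx_integrable s0 mb bQ; first by rewrite divr_gt0.
move=> d1 [g [gst bg]]; exists d1 => d d1d.
have gi := bstep_dint gst; have mg := gi.1.
have ma : measurable_fun setT (fun x => avL b Q (addr d Q x)) by exact: measurable_addr.
have gb : (ldist Q g b <= (e / 2)%:E)%E.
  by apply: le_trans bg; rewrite /ldist; under eq_integral do rewrite distrC.
apply: (@le_trans _ _ (ldist Q (fun x => avL b Q (addr d Q x)) g + ldist Q g b)%E).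
  exact: ldist_tri.
have -> : e%:E = ((e / 2)%:E + (e / 2)%:E)%E by rewrite -EFinD -splitr.
apply: leeD => //; apply: le_trans bg.
have hi : dint (fun x => b x + - g x) by apply: dintD => //; exact: dintN.
have -> : ldist Q (fun x => avL b Q (addr d Q x)) g =
    (\int[mu]_(x in dcube Q) (`|avL (fun x => (b x + - g x)%R) Q (addr d Q x)| * 1)%:E)%E.
  apply: eq_integral => x /set_mem xQ; congr EFin; rewrite mulr1.
  have [xl xg] := node_addr s d xQ.
  have -> : g x = avL g Q (addr d Q x).
    apply/esym/avR_step => //; apply: step_fun_le gst.1; rewrite xg.
    by rewrite lerD2l lerN2 lez_nat leq_mul2l d1d orbT.
  rewrite /node_avg avRD//; last exact: dintN.
  by congr (`|_ + _|); rewrite -mulN1r -avRZ//; congr avR; apply/funext => y; rewrite mulN1r.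
rewrite (@integral_tree _ _ s d Q (fun l => `|avL (fun x => b x + - g x) Q l|) (fun=> 1) (dint_cst 1)).
have -> : ldist Q b g = (dvol R Q * avR (absf (fun x => (b x + - g x)%R)) Q)%:E.
  by rewrite -integral_dcubeE//; have [_] := dint_abs hi.
rewrite lee_fin ler_wpM2l ?(ltW (dvol_gt0 _))//.
apply: le_trans (avgabs_le tau d Q hi); apply: (le_avg (@cidx_gt0 n s)) => l _.
by rewrite /tree_abs {2}/node_avg avR_cst mulr1.
Qed.

Lemma psum_abs_le k f d x : dint f ->
  `|psum k f d x| <= \sum_(0 <= l < d) @bconst R n tau C0 *
     avR (absf f) (k - (s * l)%N%:Z, cell (k - (s * l)%N%:Z) x).
Proof.
move=> fi; apply: le_trans (ler_norm_sum _ _ _) _; apply: ler_sum => l _.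
rewrite /masked_shift_at; case: (mask _).
  exact: (@blk_bound R n n_gt0 tau C0 H a HH aC).
rewrite normr0 mulr_ge0 ?avR_ge0//; exact: (bconst_ge0 aC).
Qed.

Lemma avR_sub_le f Q Q' : dint f -> (forall x, 0 <= f x) -> subcubes R Q Q' ->
  avR f Q' <= (dvol R Q')^-1 * (dvol R Q * avR f Q).
Proof.
move=> [mf fi] f0 QQ; rewrite /avR ler_wpM2l ?invr_ge0 ?(ltW (dvol_gt0 _))//.
rewrite mulrA mulfV ?gt_eqF ?dvol_gt0// mul1r.
rewrite -lee_fin /Rintegral !fineK; try by
  apply: integrable_fin_num => //; exact: measurable_dcube.
apply: ge0_subset_integral => //; try exact: measurable_dcube.
- by apply/measurable_EFinP; exact: measurable_funTS.
- by move=> x _; rewrite lee_fin.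
Qed.

(** With [d0] and [x] fixed there are finitely many blocks, each bounded by an average of [|h d|]
    over a fixed subcube of [Q]. *)
Lemma psum_cvg0 Q (h : nat -> Rn R n -> R) d0 x : dcube Q x -> (forall d, dint (h d)) ->
  avR (absf (h d)) Q @[d --> \oo] --> 0 ->
  psum Q.1 (h d) d0 x @[d --> \oo] --> 0.
Proof.
move=> xQ hi h0; apply/norm_cvg0P.
pose q l : dyadic n := (Q.1 - (s * l)%N%:Z, cell (Q.1 - (s * l)%N%:Z) x).
pose Z d := \sum_(0 <= l < d0) @bconst R n tau C0 * ((dvol R (q l))^-1 * (dvol R Q * avR (absf (h d)) Q)).
have bc0 := bconst_ge0 aC.
apply: (@squeeze_cvgr _ _ _ _ (fun=> 0) Z); last 2 first.
- exact: cvg_cst.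
- have -> : 0 = \sum_(0 <= l < d0) @bconst R n tau C0 * ((dvol R (q l))^-1 * (dvol R Q * 0)).
    by rewrite big1// => l _; rewrite !mulr0.
  apply: cvg_big => [|l _]; first exact: add_continuous.
  by do 3 (apply: cvgM; first exact: cvg_cst).
apply: nearW => d; rewrite normr_ge0/=; apply: le_trans (psum_abs_le _ _ _ (hi d)) _.
apply: ler_sum => l _; rewrite ler_wpM2l//; apply: avR_sub_le => //.
  exact: dint_abs.
apply: (subcubes_nested (x := x)) => //=; first by rewrite gerBl.
exact: dcube_cell.
Qed.

Variables (p D beta K : R) (w sg b : Rn R n -> R).
Hypotheses (p1 : 1 < p) (w0 : forall x, 0 < w x)
  (sgE : forall x, sg x = w x `^ (- (p - 1)^-1)) (wi : dint w) (si : dint sg)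
  (D0 : 0 < D) (wD : forall Q, avR w Q * avR sg Q `^ (p - 1) <= D)
  (bi : dint b) (bB : forall Q, avR (fun x => `|b x - avR b Q|) Q <= beta).
(** An assumption rather than an appeal to the theorem on trees, so that [K] can be fixed once,
    before the operator, the weight and [b]. *)
Hypothesis KB : forall (k : nat) kap (u b w sg : seq I -> R) (D beta : R),
  kernel_bound (@bconst R n tau C0) kap -> bmo_tree k b beta ->
  leaf_ap p (2 `^ p)^-1 k w sg -> ap_tree p D k w sg -> 0 < D ->
  avg k (fun s => `|b s * mtrans k kap u s - mtrans k kap (fun s => b s * u s) s| `^ p * w s) <=
  (K * D `^ (2 * ap_exp p) * beta) `^ p * avg k (fun s => `|u s| `^ p * sg s `^ (1 - p)).

Let Kp := (K * D `^ (2 * ap_exp p) * beta) `^ p * 2 `^ p.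

Variables (u : Rn R n -> R) (U : R).
Hypotheses (mu_ : measurable_fun setT u) (uU : forall x, `|u x| <= U).

Let ui : dint u. Proof. exact: bounded_dint uU. Qed.

Lemma dint_powMw : dint (fun x => `|u x| `^ p * w x).
Proof.
apply: (@dintMb _ _ _ _ (U `^ p)) => //.
  apply: (measurableT_comp (f := fun y : R => y `^ p)) => //.
  by apply: measurableT_comp.
move=> x; rewrite ger0_norm ?powR_ge0//; apply: ler_powRl => //.
by rewrite ltW// (lt_trans _ p1).
Qed.

Lemma dintMbounded f : dint f -> dint (fun x => f x * u x).
Proof.
move=> fi; have := dintMb fi mu_ uU; congr dint; apply/funext => x; exact: mulrC.
Qed.

Let kap Q := @kapM R n tau H a mask Q.
Let Phi d Q (l : seq I) := `|avL b Q l * mtrans d (kap Q) (avL u Q) l -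
  mtrans d (kap Q) (fun l => avL b Q l * avL u Q l) l| `^ p.

Lemma Phi_bound d Q : (\int[mu]_(x in dcube Q) (Phi d Q (addr d Q x) * w x)%:E <=
  Kp%:E * \int[mu]_(x in dcube Q) (`|u x| `^ p * w x)%:E)%E.
Proof.
rewrite integral_tree// integral_dcubeE; last by case: dint_powMw.
rewrite -EFinM lee_fin mulrCA ler_wpM2l ?(ltW (dvol_gt0 _))//.
have h := (KB (avL u Q) (kapM_bound n_gt0 HH aC mask Q) (bmo_tree_avL tau d Q bi bB)
  (leaf_ap_avL p1 w0 sgE wi si (d:=d) Q) (ap_tree_avL wi si tau d Q wD) D0).
apply: (le_trans h).
rewrite /Kp -[leRHS]mulrA ler_wpM2l ?powR_ge0// -(avg_avL s (f := fun x => `|u x| `^ p * w x) Q d dint_powMw) -avgZ.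
apply: (le_avg (@cidx_gt0 n s)) => l _; apply: jensen_weight => //; exact: dint_powMw.
Qed.

(** The mask removes all blocks past [d0], so the operator is fixed while the depth [d] grows. At
    depth [d] the product of the averages of [b] and [u] is the average of [g d], which is [u] times
    the discretized [b]. As [u] is bounded, [g d] tends to [b u] in L^1 on [Q]; the averages of [b]
    converge almost everywhere, and Fatou's lemma concludes. *)
Lemma cube_bound Q d0 : (forall l, (d0 <= l)%N -> mask (Q.1 - (s * l)%N%:Z) = false) ->
  (\int[mu]_(x in dcube Q) (`|b x * psum Q.1 u d0 x - psum Q.1 (fun y => (b y * u y)%R) d0 x|
     `^ p * w x)%:E <= Kp%:E * \int[mu]_(x in dcube Q) (`|u x| `^ p * w x)%:E)%E.
Proof.
move=> mk; have bui := dintMbounded bi.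
pose g d x := avL b Q (addr d Q x) * u x.
have gi d : dint (g d) by exact: dint_addr.
have psumE f d x : (d0 <= d)%N -> psum Q.1 f d x = psum Q.1 f d0 x.
  move=> dd; rewrite /residue_sum (big_cat_nat (n := d0))//= [X in _ + X]big_nat_cond.
  rewrite [X in _ + X]big1 ?addr0// => l /andP[/andP[dl _] _].
  by rewrite /masked_shift_at mk.
have PhiE d x : (d0 <= d)%N -> dcube Q x -> Phi d Q (addr d Q x) =
    `|avR b (Q.1 - (s * d)%N%:Z, cell (Q.1 - (s * d)%N%:Z) x) * psum Q.1 u d0 x -
      psum Q.1 (g d) d0 x| `^ p.
  move=> dd xQ; have <- : mtrans d (kap Q) (avL (g d) Q) (addr d Q x) = psum Q.1 (g d) d0 x.
    by rewrite mtrans_psum// psumE.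
  rewrite /Phi (@mtrans_psum _ _ n_gt0 _ _ _ HH _ _ _ u)// psumE//.
  have [xl xg] := node_addr s d xQ.
  rewrite -xg -(dcube_eq xl); congr (`|_ - _| `^ p).
  apply: (eq_mtrans (@cidx_gt0 n s)) => l ld.
  by rewrite avL_addr.
apply: (@fatou_bound _ _ _ mu (dcube Q) _
  (fun i x => Phi (i + d0)%N Q (addr (i + d0) Q x) * w x)).
- exact: measurable_dcube.
- move=> i; apply: measurable_funTS; apply: measurable_funM; last by case: wi.
  exact: measurable_addr.
- by move=> i x; rewrite mulr_ge0 ?powR_ge0// ltW.
- by move=> x; rewrite mulr_ge0 ?powR_ge0// ltW.
- have := ae_good n_gt0 HH aC mask bi; apply: filterS => x gx xQ.
  apply: cvgMl.
  have -> : (fun i => Phi (i + d0)%N Q (addr (i + d0) Q x)) = (fun d =>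
    `|avR b (Q.1 - (s * d)%N%:Z, cell (Q.1 - (s * d)%N%:Z) x) * psum Q.1 u d0 x -
      psum Q.1 (g d) d0 x| `^ p) \o addn^~ d0.
    by apply/funext => i /=; rewrite PhiE// leq_addl.
  rewrite (cvg_shiftn d0 (fun d =>
    `|avR b (Q.1 - (s * d)%N%:Z, cell (Q.1 - (s * d)%N%:Z) x) * psum Q.1 u d0 x -
      psum Q.1 (g d) d0 x| `^ p)).
  apply: cvg_powR; [by rewrite (lt_trans _ p1)|by []|].
  apply: cvg_norm; apply: cvgB.
    by apply: cvgMl; case: (gx Q.1).
  have -> : (fun d => psum Q.1 (g d) d0 x) = (fun d => psum Q.1 (fun y => b y * u y) d0 x +
      psum Q.1 (fun y => g d y + - (b y * u y)) d0 x).
    apply/funext => d; rewrite -psumD//; last by apply: dintD => //; exact: dintN.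
    have -> // : (fun y => b y * u y + (g d y + - (b y * u y))) = g d.
    by apply/funext => y; rewrite addrC subrK.
  rewrite -[X in _ --> X]addr0; apply: cvgD; first exact: cvg_cst.
  apply: psum_cvg0 => //; first by move=> d; apply: dintD => //; exact: dintN.
  have v0 := dvol_gt0 (R := R) Q; have UB : `|u x| <= `|U| by exact: le_trans (ler_norm _).
  have U1 : 0 < `|U| + 1 by rewrite ltr_wpDl.
  apply/cvgrPdist_le => e e0.
  have e1 : 0 < e / (`|U| + 1) * dvol R Q by rewrite mulr_gt0// divr_gt0.
  have [d1 hd1] := L1_avL Q bi e1; exists d1 => // d /= dd1.
  pose k y := avL b Q (addr d Q y) * 1 + - b y.
  have ki : dint k.
    by apply: dintD; [apply: dint_addr; exact: dint_cst|exact: dintN].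
  have kle : avR (absf k) Q <= e / (`|U| + 1).
    rewrite -(ler_pM2l v0) [leRHS]mulrC -lee_fin -integral_dcubeE; last by case: (dint_abs ki).
    apply: le_trans (hd1 _ dd1); rewrite le_eqVlt; apply/orP; left; apply/eqP.
    by apply: eq_integral => y _; rewrite /k mulr1.
  rewrite sub0r normrN ger0_norm ?avR_ge0//.
  apply: (@le_trans _ _ ((`|U| + 1) * avR (absf k) Q)); last first.
    by rewrite mulrC -ler_pdivlMr.
  rewrite -avRZ; last exact: dint_abs.
  apply: avR_le.
  - by apply: dint_abs; apply: dintD => //; exact: dintN.
  - by apply: dintZ; exact: dint_abs.
  move=> y; rewrite /g /k mulr1 -mulNr -mulrDl normrM mulrC ler_wpM2r//.
  by rewrite (le_trans (uU y))// (le_trans (ler_norm _))// lerDl.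
- by move=> i; exact: Phi_bound.
Qed.

End weighted_cube.

(** * From one cube to the whole space and to the full shift *)

Section weighted_space.
Context {R : realType} {n : nat}.
Hypothesis n_gt0 : (0 < n)%N.
Local Notation mu := (lebesgue_Rn n : {measure set (Rn R n) -> \bar R}).
Implicit Types (x y : Rn R n) (k : int) (Q : dyadic n) (f w : Rn R n -> R).
Variables (tau : nat) (C0 : R) (H : dyadic n -> Rn R n -> R)
  (a : dyadic n -> dyadic n -> dyadic n -> R).
Local Notation s := tau.+1.
Local Notation I := (@cidx n s).
Hypothesis HH : forall Q, haar_function Q (H Q).
Hypothesis aC : forall Q Q' Q'', near_subcubes R tau Q Q' -> near_subcubes R tau Q Q'' ->
  `|a Q Q' Q''| <= C0 * Num.sqrt (dvol R Q' / dvol R Q * (dvol R Q'' / dvol R Q)).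

Local Notation psum := (@residue_sum R n tau H a).
Local Notation partial_shift := (@partial_shift R n tau H a).

Definition cube_nth k i : set (Rn R n) :=
  if pickle_inv i is Some m then dcube (k, m : n.-tuple int) else set0.

Lemma measurable_cube_nth k i : measurable (cube_nth k i).
Proof. by rewrite /cube_nth; case: pickle_inv => [m|]; [exact: measurable_dcube|exact: measurable0]. Qed.

Lemma bigcup_cube_nth k : \bigcup_i cube_nth k i = setT.
Proof.
apply/seteqP; split => // x _; exists (pickle (cell k x)) => //.
by rewrite /cube_nth pickleK_inv; exact: dcube_cell.
Qed.

Lemma trivIset_cube_nth k : trivIset setT (cube_nth k).
Proof.
move=> i j _ _ [x []]; rewrite /cube_nth.
case ei : (pickle_inv i) => [m|//] xm; case ej : (pickle_inv j) => [m'|//] xm'.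
have <- : pickle m = i by have := @pickle_invK (n.-tuple int) i; rewrite ei.
have <- : pickle m' = j by have := @pickle_invK (n.-tuple int) j; rewrite ej.
by congr pickle; move/in_dcube: xm => /= <-; move/in_dcube: xm' => /= <-.
Qed.

Lemma integral_cubes k (f : Rn R n -> R) : measurable_fun setT f -> (forall x, 0 <= f x) ->
  (\int[mu]_x (f x)%:E = \sum_(i <oo) \int[mu]_(x in cube_nth k i) (f x)%:E)%E.
Proof.
move=> mf f0; rewrite -[in LHS](bigcup_cube_nth k) ge0_integral_bigcup//.
- exact: measurable_cube_nth.
- by apply/measurable_EFinP; exact: measurable_funTS.
- by move=> x _; rewrite lee_fin.
- exact: trivIset_cube_nth.
Qed.

Lemma measurable_psum mask k f d : dint f -> measurable_fun setT (psum mask k f d).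
Proof. by move=> fi; exact: measurable_step (@step_psum R n n_gt0 tau H a HH mask k f d fi). Qed.

Let window (N : nat) (k : int) := - N%:Z <= k <= N%:Z.

(** The range is extended to [s * N.*2.+1] generations so that every residue class has exactly
    [N.*2.+1] of them; the mask annihilates what was added. *)
Lemma partial_shift_psum f x N : partial_shift f x N =
  \sum_(j < s) psum (window N) (N%:Z - j%:Z) f N.*2.+1 x.
Proof.
have Ns : (N.*2.+1 <= s * N.*2.+1)%N by rewrite leq_pmull.
rewrite (@partial_shiftE R n n_gt0 tau H a HH).
transitivity (\sum_(0 <= i < (s * N.*2.+1)%N) @masked_shift_at R n tau H a (window N) (N%:Z - i%:Z) f x).
  rewrite [RHS](big_cat_nat (n := N.*2.+1))//= [X in _ = _ + X]big_nat_cond.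
  rewrite [X in _ = _ + X]big1 ?addr0; last first.
    move=> i /andP[/andP[iN _] _]; rewrite /masked_shift_at (_ : window _ _ = false)//.
    by apply/negP => /andP[]; lia.
  apply: eq_big_nat => i iN; rewrite /masked_shift_at (_ : window _ _ = true)//.
  by apply/andP; lia.
rewrite (@sum_residues R tau (fun i => @masked_shift_at R n tau H a (window N) (N%:Z - i%:Z) f x)).
apply: eq_bigr => j _; rewrite cnt_full//; apply: eq_bigr => l _.
by rewrite PoszD opprD addrA.
Qed.

Lemma measurable_partial_shift f N : dint f -> measurable_fun setT (fun x => partial_shift f x N).
Proof.
move=> fi; under eq_fun do rewrite partial_shift_psum.
by apply: measurable_sum => j; exact: measurable_psum.
Qed.

Variables (p D beta K : R) (w sg b : Rn R n -> R).
Hypotheses (p1 : 1 < p) (w0 : forall x, 0 < w x)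
  (sgE : forall x, sg x = w x `^ (- (p - 1)^-1)) (wi : dint w) (si : dint sg)
  (D0 : 0 < D) (wD : forall Q, avR w Q * avR sg Q `^ (p - 1) <= D)
  (bi : dint b) (bB : forall Q, avR (fun x => `|b x - avR b Q|) Q <= beta).
Hypothesis KB : forall (k : nat) kap (u b w sg : seq I -> R) (D beta : R),
  kernel_bound (@bconst R n tau C0) kap -> bmo_tree k b beta ->
  leaf_ap p (2 `^ p)^-1 k w sg -> ap_tree p D k w sg -> 0 < D ->
  avg k (fun s => `|b s * mtrans k kap u s - mtrans k kap (fun s => b s * u s) s| `^ p * w s) <=
  (K * D `^ (2 * ap_exp p) * beta) `^ p * avg k (fun s => `|u s| `^ p * sg s `^ (1 - p)).

Let Kp := (K * D `^ (2 * ap_exp p) * beta) `^ p * 2 `^ p.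

Variables (u : Rn R n -> R) (U : R).
Hypotheses (mu_ : measurable_fun setT u) (uU : forall x, `|u x| <= U).

Let ui : dint u. Proof. exact: bounded_dint uU. Qed.

Let bui : dint (fun x => b x * u x). Proof. exact: (dintMbounded mu_ uU bi). Qed.

(** The sum starts at generation [k] and goes down, so the estimates on the cubes of generation [k],
    which tile the space, can be added. *)
Lemma residue_bound mask k d0 : (forall l, (d0 <= l)%N -> mask (k - (s * l)%N%:Z) = false) ->
  (\int[mu]_x (`|b x * psum mask k u d0 x - psum mask k (fun y => (b y * u y)%R) d0 x|
     `^ p * w x)%:E <= Kp%:E * \int[mu]_x (`|u x| `^ p * w x)%:E)%E.
Proof.
move=> mk.
have mF : measurable_fun setT (fun x => b x * psum mask k u d0 x -
    psum mask k (fun y => (b y * u y)%R) d0 x).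
  apply: measurable_funB; last exact: measurable_psum.
  by apply: measurable_funM; [case: bi|exact: measurable_psum].
rewrite !(integral_cubes k)//; last 4 first.
- exact: (measurable_powMw p wi.1).
- by move=> x; rewrite mulr_ge0 ?powR_ge0// ltW.
- exact: (measurable_powMw p wi.1).
- by move=> x; rewrite mulr_ge0 ?powR_ge0// ltW.
rewrite -nneseriesZl; last first.
  by move=> i _; apply: integral_ge0 => x _; rewrite lee_fin mulr_ge0 ?powR_ge0// ltW.
apply: lee_nneseries => i *.
  by apply: integral_ge0 => x _; rewrite lee_fin mulr_ge0 ?powR_ge0// ltW.
rewrite /cube_nth; case: pickle_inv => [m|]; last by rewrite !integral_set0 mule0.
exact: (cube_bound n_gt0 HH aC p1 w0 sgE wi si D0 wD bi bB KB mu_ uU (Q := (k, m))).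
Qed.

Lemma powR_sum (m : nat) (X : 'I_m -> R) :
  `|\sum_(j < m) X j| `^ p <= m%:R `^ p * \sum_(j < m) `|X j| `^ p.
Proof.
set Z := \sum_(j < m) `|X j| `^ p; have Z0 : 0 <= Z by rewrite sumr_ge0// => j _; exact: powR_ge0.
have p0 : 0 < p by rewrite (lt_trans _ p1).
have -> : Z = (Z `^ p^-1) `^ p by rewrite -powRrM mulVf ?gt_eqF// powRr1.
rewrite -powRM ?powR_ge0//; apply: ler_powRl => //; first exact: ltW.
apply: le_trans (ler_norm_sum _ _ _) _.
rewrite -[m in leRHS]card_ord -sum1_card natr_sum mulr_suml; apply: ler_sum => j _.
rewrite mul1r -[leLHS](powRr1 (normr_ge0 _)) -[1](mulfV (lt0r_neq0 p0)) powRrM.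
apply: ler_powRl; rewrite ?invr_ge0 ?(ltW p0)//.
by rewrite /Z (bigD1 j)//= lerDl sumr_ge0.
Qed.

Lemma partial_bound N :
  (\int[mu]_x (`|b x * partial_shift u x N - partial_shift (fun y => (b y * u y)%R) x N|
     `^ p * w x)%:E <= (s%:R `^ p * s%:R * Kp)%:E * \int[mu]_x (`|u x| `^ p * w x)%:E)%E.
Proof.
pose X (j : 'I_s) x := b x * psum (window N) (N%:Z - j%:Z) u N.*2.+1 x -
  psum (window N) (N%:Z - j%:Z) (fun y => b y * u y) N.*2.+1 x.
have mX j : measurable_fun setT (X j).
  apply: measurable_funB; last exact: measurable_psum.
  by apply: measurable_funM; [case: bi|exact: measurable_psum].
have XE x : b x * partial_shift u x N - partial_shift (fun y => (b y * u y)%R) x N = \sum_j X j x.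
  by rewrite !partial_shift_psum mulr_sumr -sumrB.
have P0 (r : R) x : 0 <= `|r| `^ p * w x by rewrite mulr_ge0 ?powR_ge0// ltW.
have s0 : 0 <= (s%:R : R) `^ p by exact: powR_ge0.
apply: (@le_trans _ _ (\int[mu]_x (\sum_(j < s) (s%:R `^ p)%:E * (`|X j x| `^ p * w x)%:E))%E).
  apply: ge0_le_integral => //.
  - by move=> x _; rewrite lee_fin P0.
  - apply/measurable_EFinP; apply: (measurable_powMw p wi.1).
    under eq_fun do rewrite XE; exact: measurable_sum.
  - apply: emeasurable_sum => j; apply/measurable_EFinP; apply: measurable_funM => //.
    exact: (measurable_powMw p wi.1).
  move=> x _; rewrite XE; under [X in (_ <= X)%E]eq_bigr do rewrite -EFinM.
  rewrite sumEFin lee_fin -mulr_sumr -mulr_suml mulrA.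
  by rewrite ler_wpM2r ?(ltW (w0 _))// powR_sum.
rewrite ge0_integral_sum//; last 2 first.
- move=> j; apply/measurable_EFinP; apply: measurable_funM => //; exact: (measurable_powMw p wi.1).
- by move=> j x _; rewrite -EFinM lee_fin mulr_ge0.
have I0 : (0 <= \int[mu]_x (`|u x| `^ p * w x)%:E)%E.
  by apply: integral_ge0 => x _; rewrite lee_fin.
apply: (@le_trans _ _ (\sum_(j < s) (s%:R `^ p)%:E * (Kp%:E * \int[mu]_x (`|u x| `^ p * w x)%:E))%E).
  apply: lee_sum => j _; rewrite ge0_integralZl_EFin//; last 2 first.
  - by move=> x _; rewrite lee_fin.
  - by apply/measurable_EFinP; exact: (measurable_powMw p wi.1).
  rewrite lee_pmul2l ?lte_fin ?powR_gt0//; apply: residue_bound => l hl.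
  by apply/negP => /andP[]; have := ltn_ord j; nia.
rewrite -ge0_sume_distrl//.
have -> : (\sum_(j < s) (s%:R `^ p)%:E = (s%:R `^ p * s%:R)%:E)%E.
  by rewrite sumEFin sumr_const card_ord mulr_natr.
by rewrite muleA -EFinM.
Qed.

Lemma limit_bound : (\int[mu]_x `|u x|%:E < +oo)%E -> (\int[mu]_x `|b x * u x|%:E < +oo)%E ->
  (\int[mu]_x (`|commutator b (fun f y => limn (partial_shift f y)) u x| `^ p * w x)%:E <=
   (s%:R `^ p * s%:R * Kp)%:E * \int[mu]_x (`|u x| `^ p * w x)%:E)%E.
Proof.
move=> uL buL.
apply: (@fatou_bound _ _ _ mu setT _ (fun N x =>
    `|b x * partial_shift u x N - partial_shift (fun y => b y * u y) x N| `^ p * w x)).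
- exact: measurableT.
- move=> N; apply: (measurable_powMw p wi.1); apply: measurable_funB; last exact: measurable_partial_shift.
  by apply: measurable_funM; [case: bi|exact: measurable_partial_shift].
- by move=> N x; rewrite mulr_ge0 ?powR_ge0// ltW.
- by move=> x; rewrite mulr_ge0 ?powR_ge0// ltW.
- have := partial_shift_cvg n_gt0 HH aC ui uL; have := partial_shift_cvg n_gt0 HH aC bui buL.
  apply: filterS2 => x bux ux _; apply: cvgMl.
  apply: cvg_powR; [by rewrite (lt_trans _ p1)|by []|].
  apply: cvg_norm; rewrite /commutator; apply: cvgB; last exact: bux.
  by apply: cvgMr; exact: ux.
- exact: partial_bound.
Qed.

End weighted_space.

(** * Changes on null sets *)

Section ae_integral.
Context d (T : measurableType d) (R : realType) (mu : {measure set T -> \bar R}).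

Lemma ae_eq_integralT (f g : T -> \bar R) :
  {ae mu, forall x, f x = g x} -> (\int[mu]_x f x = \int[mu]_x g x)%E.
Proof.
have le (f' g' : T -> \bar R) : {ae mu, forall x, f' x = g' x} ->
    (\int[mu]_x (f'^\+ x) <= \int[mu]_x (g'^\+ x))%E /\
    (\int[mu]_x (f'^\- x) <= \int[mu]_x (g'^\- x))%E.
  by move=> fg; split; apply: ae_le_integral => // ; apply: filterS fg => x e;
    rewrite ?funeposE ?funenegE e.
move=> fg; have [h1 h2] := le _ _ fg.
have [h3 h4] := le g f (filterS (fun x (e : f x = g x) => esym e) fg).
rewrite integralE [RHS]integralE; congr (_ - _)%E; apply/le_anti; first by rewrite h1 h3.
by rewrite h2 h4.
Qed.

Lemma ae_eq_integral_in (D : set T) (f g : T -> \bar R) :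
  {ae mu, forall x, f x = g x} -> (\int[mu]_(x in D) f x = \int[mu]_(x in D) g x)%E.
Proof.
move=> fg; rewrite integral_mkcond [RHS]integral_mkcond; apply: ae_eq_integralT.
by apply: filterS fg => x e; rewrite !patchE e.
Qed.

End ae_integral.

(** * Norms and averages over dyadic cubes *)

Section averages.
Context {R : realType} {n : nat}.
Local Notation mu := (lebesgue_Rn n : {measure set (Rn R n) -> \bar R}).

Lemma ae_eq_Lpw_norm (p : R) (w w' f f' : Rn R n -> R) : {ae mu, forall x, w x = w' x} ->
  {ae mu, forall x, f x = f' x} -> Lpw_norm p w f = Lpw_norm p w' f'.
Proof.
move=> ww ff; congr (_ `^ _)%E; apply: ae_eq_integralT; apply: filterS2 ww ff => x e e'.
by rewrite e e'.
Qed.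

Lemma average_dcube (f : Rn R n -> R) Q : dint f -> average f (dcube Q) = (avR f Q)%:E.
Proof.
move=> [_ /(_ Q) fi]; rewrite /average integral_dcubeE// -EFinM.
by rewrite mulrA mulVf ?mul1r// gt_eqF// dvol_gt0.
Qed.

Lemma dcube_loc_integrable (f : Rn R n -> R) : loc_integrable f -> dint f.
Proof. by move=> [mf fi]; split => // Q; apply: fi; exact: dcube_cubes. Qed.

Lemma BMO_norm_dcube (b : Rn R n -> R) Q : loc_integrable b ->
  ((avR (fun x => `|b x - avR b Q|) Q)%:E <= BMO_norm b)%E.
Proof.
move=> /dcube_loc_integrable bi.
have gi : dint (fun x => `|b x + - avR b Q|).
  by apply: dint_abs; apply: dintD => //; exact: dint_cst.
rewrite -average_dcube//; apply: ereal_sup_ubound; exists (dcube Q); first exact: dcube_cubes.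
by rewrite (average_dcube Q bi).
Qed.

Lemma BMO_normE (b : Rn R n -> R) : BMO b -> BMO_norm b = (fine (BMO_norm b))%:E.
Proof.
move=> [bi blt]; rewrite fineK// fin_numE; apply/andP; split; last by rewrite lt_eqF.
by rewrite -ltNye (lt_le_trans _ (BMO_norm_dcube (0, nseq_tuple n 0) bi))// ltNyr.
Qed.

Lemma bmo_dcube (b : Rn R n -> R) Q : BMO b ->
  avR (fun x => `|b x - avR b Q|) Q <= fine (BMO_norm b).
Proof. by move=> bB; rewrite -lee_fin -BMO_normE//; apply: BMO_norm_dcube; case: bB. Qed.

Lemma BMO_norm_ge0 (b : Rn R n -> R) : BMO b -> (0 <= fine (BMO_norm b))%R.
Proof.
move=> bb; apply: le_trans (bmo_dcube (0, nseq_tuple n 0) bb).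
exact: avR_ge0.
Qed.
End averages.

(** * A positive representative of the weight and its dual *)

Section positive_weight.
Context {R : realType} {n : nat}.
Local Notation mu := (lebesgue_Rn n : {measure set (Rn R n) -> \bar R}).
Variables (p : R) (w : Rn R n -> R).
Hypotheses (p1 : 1 < p) (wA : Ap p w).

(** Altering the weight on a null set makes identities such as [weight_dual] hold at every point. *)
Definition wpos x := if 0 < w x then w x else 1.
Definition dual_weight x := wpos x `^ (- (p - 1)^-1).

Lemma wpos_gt0 x : 0 < wpos x. Proof. by rewrite /wpos; case: ifP. Qed.

Lemma wpos_ae : {ae mu, forall x, w x = wpos x}.
Proof. by have [[_ w0] _] := wA; apply: filterS w0 => x wx; rewrite /wpos wx. Qed.

Lemma dint_wpos : dint wpos.
Proof.
have [[/dcube_loc_integrable wi _] _] := wA.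
have mw : measurable_fun setT wpos.
  apply: measurable_fun_ifT => //; first by apply: measurable_fun_ltr => //; case: wi.
  by case: wi.
split=> // Q; have [_ /(_ Q) h] := dintD (dint_abs wi) (dint_cst 1).
apply: le_integrable h => //; first exact: measurable_dcube.
  by apply/measurable_EFinP; exact: measurable_funTS.
move=> x _ /=; rewrite lee_fin (ger0_norm (ltW (wpos_gt0 x))) ger0_norm ?addr_ge0//.
by rewrite /wpos; case: ifP => [/gtr0_norm ->|_]; rewrite ?lerDl ?lerDr.
Qed.

Let p10 : 0 < p - 1. Proof. by rewrite subr_gt0. Qed.

Lemma Ap_average Q : ((avR wpos Q)%:E * average dual_weight (dcube Q) `^ (p - 1) <= Ap_char p w)%E.
Proof.
apply: ereal_sup_ubound; exists (dcube Q); first exact: dcube_cubes.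
have e1 : average w (dcube Q) = average wpos (dcube Q).
  congr (_ * _)%E; apply: ae_eq_integral_in; apply: filterS wpos_ae => x e.
  exact: (congr1 EFin e).
have e2 : average (fun x => w x `^ (- (p - 1)^-1)) (dcube Q) = average dual_weight (dcube Q).
  congr (_ * _)%E; apply: ae_eq_integral_in; apply: filterS wpos_ae => x e.
  by rewrite /dual_weight e.
by rewrite e1 e2 (average_dcube Q dint_wpos).
Qed.

(** The average of the weight over a cube is positive, so an infinite integral of the dual weight
    would make the A_p characteristic infinite. *)
Lemma dint_dual : dint dual_weight.
Proof.
have m : measurable_fun setT dual_weight.
  apply: (measurableT_comp (f := fun y : R => y `^ (- (p - 1)^-1))) => //.
  by case: dint_wpos.
split => // Q; have W0 := avR_gt0 Q dint_wpos wpos_gt0.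
have i0 : (0 <= \int[mu]_(x in dcube Q) (dual_weight x)%:E)%E.
  by apply: integral_ge0 => x _; rewrite lee_fin powR_ge0.
apply/integrableP; split; first by apply/measurable_EFinP; exact: measurable_funTS.
under eq_integral => x _ do rewrite /= ger0_norm ?powR_ge0//.
rewrite ltey; apply/eqP => iy.
have [_] := wA; rewrite ltNge => /negP; apply; apply: le_trans (Ap_average Q).
rewrite /average iy gt0_muley ?lte_fin ?invr_gt0 ?dvol_gt0//.
by rewrite poweRyr ?gt_eqF// gt0_muley ?lte_fin.
Qed.

Lemma Ap_charE : Ap_char p w = (fine (Ap_char p w))%:E.
Proof.
have h := Ap_average (0, nseq_tuple n 0); have [_ lty] := wA.
rewrite fineK// ge0_fin_numE//; apply: le_trans h.
by rewrite mule_ge0 ?poweR_ge0// lee_fin ltW// (avR_gt0 _ dint_wpos wpos_gt0).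
Qed.

Lemma Ap_avR Q : avR wpos Q * avR dual_weight Q `^ (p - 1) <= fine (Ap_char p w).
Proof. by rewrite -lee_fin -Ap_charE EFinM -poweR_EFin -average_dcube ?Ap_average//; exact: dint_dual. Qed.

Lemma Ap_char_gt0 : 0 < fine (Ap_char p w).
Proof.
have Q : dyadic n := (0, nseq_tuple n 0).
apply: lt_le_trans (Ap_avR Q); rewrite mulr_gt0 ?powR_gt0 ?avR_gt0//.
- exact: dint_wpos.
- exact: wpos_gt0.
- exact: dint_dual.
- by move=> x; rewrite powR_gt0// wpos_gt0.
Qed.
End positive_weight.

(** * Passing a bound to the closure in L^p(w) *)

Section Lpw_closure.
Context {R : realType} {n : nat}.
Local Notation mu := (lebesgue_Rn n : {measure set (Rn R n) -> \bar R}).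
Variables (p : R) (w : Rn R n -> R).
Hypotheses (p1 : 1 < p) (w0 : forall x, 0 < w x) (mw : measurable_fun setT w).
Implicit Types f g : Rn R n -> R.

Let p0 : 0 < p. Proof. by rewrite (lt_trans _ p1). Qed.
Let N f := (\int[mu]_x (`|f x| `^ p * w x)%:E)%E.

Let N_ge0 f : (0 <= N f)%E.
Proof. by apply: integral_ge0 => x _; rewrite lee_fin mulr_ge0 ?powR_ge0// ltW. Qed.

Lemma powR_tri (x y : R) : `|x| `^ p <= 2 `^ p * (`|y| `^ p + `|x - y| `^ p).
Proof.
have tri : `|x| <= `|y| + `|x - y| by rewrite -[X in `|X| <= _](subrKC y x) ler_normD.
have [h|h] := leP `|y| `|x - y|.
  apply: (@le_trans _ _ ((2 * `|x - y|) `^ p)); first by apply: ler_powRl; [exact: ltW|by []|lra].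
  by rewrite powRM// ler_wpM2l ?powR_ge0// lerDr powR_ge0.
apply: (@le_trans _ _ ((2 * `|y|) `^ p)); first by apply: ler_powRl; [exact: ltW|by []|lra].
by rewrite powRM// ler_wpM2l ?powR_ge0// lerDl powR_ge0.
Qed.

Lemma measurable_powR_weight f : measurable_fun setT f ->
  measurable_fun setT (fun x => (`|f x| `^ p * w x)%:E).
Proof.
move=> mf; apply/measurable_EFinP; exact: measurable_powMw.
Qed.

Lemma Lpw_tri f g : measurable_fun setT f -> measurable_fun setT g ->
  (N f <= (2 `^ p)%:E * (N g + N (fun x => (f x - g x)%R)))%E.
Proof.
move=> mf mg; have md : measurable_fun setT (fun x => f x - g x) by exact: measurable_funB.
rewrite /N -ge0_integralD//; first last.
- exact: measurable_powR_weight.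
- by move=> x _; rewrite lee_fin mulr_ge0 ?powR_ge0// ltW.
- exact: measurable_powR_weight.
- by move=> x _; rewrite lee_fin mulr_ge0 ?powR_ge0// ltW.
have ms : measurable_fun setT (fun x => (`|f x - g x| `^ p * w x)%:E + (`|g x| `^ p * w x)%:E)%E.
  by apply: emeasurable_funD; exact: measurable_powR_weight.
rewrite -ge0_integralZl_EFin ?powR_ge0//; first last.
- by apply: emeasurable_funD; exact: measurable_powR_weight.
- by move=> x _; rewrite /= -EFinD lee_fin addr_ge0// mulr_ge0 ?powR_ge0// ltW.
apply: ge0_le_integral => //.
- by move=> x _; rewrite lee_fin mulr_ge0 ?powR_ge0// ltW.
- exact: measurable_powR_weight.
- by apply: measurable_funeM; apply: emeasurable_funD; exact: measurable_powR_weight.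
move=> x _; rewrite /= -EFinD -EFinM lee_fin -mulrDl mulrA.
by rewrite ler_wpM2r ?(ltW (w0 x))// powR_tri.
Qed.

Lemma Lpw_norm_le f (c : R) : 0 <= c -> (Lpw_norm p w f <= c%:E)%E -> (N f <= (c `^ p)%:E)%E.
Proof.
move=> c0 h; have e : N f = ((N f `^ p^-1) `^ p)%E.
  by rewrite -poweRrM mulVf ?gt_eqF// poweRe1.
rewrite e -poweR_EFin; apply: gt0_ler_poweR => //; first exact: ltW.
- by rewrite in_itv/= poweR_ge0 leey.
- by rewrite in_itv/= lee_fin c0 leey.
Qed.

Lemma Lpw_norm_small (v : nat -> Rn R n -> R) (e : R) : 0 < e ->
  Lpw_norm p w (v k) @[k --> \oo] --> 0%E -> \forall k \near \oo, (N (v k) <= e%:E)%E.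
Proof.
move=> e0 /fine_cvgP[fin /cvgrPdist_le/(_ (e `^ p^-1))]; rewrite powR_gt0// => /(_ isT) h.
apply: filterS2 fin h => k fk; rewrite sub0r normrN => hk.
have -> : e = (e `^ p^-1) `^ p by rewrite -powRrM mulVf ?gt_eqF// powRr1// ltW.
apply: Lpw_norm_le; first exact: powR_ge0.
by rewrite -(fineK fk) lee_fin (le_trans (ler_norm _)).
Qed.

(** A single index [k] far enough suffices. The triangle inequality with factor [2^p] is applied
    once to [g] and once to [u k]; the last factor 2 is 1 for [f] plus 1 for the approximation
    error. *)
Lemma Lpw_closure_bound (A : R) (u h : nat -> Rn R n -> R) f g : 0 <= A ->
  measurable_fun setT f -> measurable_fun setT g ->
  (forall k, measurable_fun setT (u k)) -> (forall k, measurable_fun setT (h k)) ->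
  (forall k, (N (h k) <= A%:E * N (u k))%E) ->
  Lpw_norm p w (fun x => u k x - f x) @[k --> \oo] --> 0%E ->
  Lpw_norm p w (fun x => h k x - g x) @[k --> \oo] --> 0%E ->
  (Lpw_norm p w f <= 1)%E -> (N g <= (2 `^ p * A * (2 `^ p * 2))%:E)%E.
Proof.
move=> A0 mf mg mu_ mh hA uf hg f1; apply/lee_addgt0Pr => e e0.
have P0 : 0 < (2 : R) `^ p by rewrite powR_gt0.
have Nf : (N f <= 1%:E)%E.
  by have := @Lpw_norm_le f 1 ler01 f1; rewrite powR1.
have e'0 : 0 < e / 2 `^ p by rewrite divr_gt0.
have Nsym f' g' : N (fun x => f' x - g' x) = N (fun x => g' x - f' x).
  by rewrite /N; under eq_integral do rewrite distrC.
have := filterI (Lpw_norm_small e'0 hg) (Lpw_norm_small ltr01 uf).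
move=> [k _ /(_ k (leqnn k)) [h1 h2]].
have Nu : (N (u k) <= (2 `^ p * 2)%:E)%E.
  apply: le_trans (Lpw_tri (mu_ k) mf) _; rewrite EFinM lee_pmul2l//.
  by apply: le_trans (leeD Nf h2) _; rewrite -EFinD lee_fin; lra.
apply: le_trans (Lpw_tri mg (mh k)) _; rewrite Nsym.
have -> : ((2 `^ p * A * (2 `^ p * 2))%:E + e%:E =
    (2 `^ p)%:E * ((A * (2 `^ p * 2))%:E + (e / 2 `^ p)%:E))%E.
  by rewrite -!EFinD -EFinM; congr EFin; field; rewrite gt_eqF.
rewrite lee_pmul2l//; apply: leeD h1; apply: le_trans (hA k) _.
by rewrite EFinM lee_wpmul2l.
Qed.
End Lpw_closure.

(** Where the sequence diverges [limn] is an arbitrary value; the upper limit is measurable and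
    agrees with it almost everywhere. *)
Lemma ae_measurable_lim d (T : measurableType d) (R : realType)
    (mu : {measure set T -> \bar R}) (F : nat -> T -> R) :
  (forall k, measurable_fun setT (F k)) -> {ae mu, forall x, cvgn (F ^~ x)} ->
  exists2 h, measurable_fun setT h & {ae mu, forall x, limn (F ^~ x) = h x}.
Proof.
move=> mF cF; exists (fun x => fine (limn_esup (fun k => (F k x)%:E))).
  apply: (measurableT_comp (f := @fine R)) => //.
  by apply: measurable_fun_limn_esup => k; exact/measurable_EFinP.
apply: filterS cF => x cx.
have h : (F k x)%:E @[k --> \oo] --> (limn (F ^~ x))%:E by apply: cvg_EFin; [exact: nearW|exact: cx].
by rewrite (cvg_limn_einf_sup h).2.
Qed.

(** * Integrability of bounded functions of compact support *)

Section compact_support.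
Context {R : realType} {n : nat}.
Local Notation mu := (lebesgue_Rn n : {measure set (Rn R n) -> \bar R}).

Lemma compact_support_cube (u : Rn R n -> R) : bounded_compact_support u ->
  exists2 Q, cubes Q & forall x, ~ Q x -> u x = 0.
Proof.
move=> [_ _ [r ur]]; pose c := `|r| + 1; have c0 : 0 < c by rewrite ltr_wpDl.
exists (cube (nseq_tuple n (- c)) (c + c)).
  by exists (nseq_tuple n (- c)), (c + c) => //; rewrite addr_gt0.
move=> x xQ; apply: ur; apply: contrapT => nr; apply: xQ => i.
have le : `|tnth x i| <= r by rewrite leNgt; apply/negP => h; apply: nr; exists i.
have lc : `|tnth x i| < c by rewrite (le_lt_trans le)// (le_lt_trans (ler_norm r))// ltrDl.
have := lc; rewrite ltr_norml => /andP[h1 h2].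
have e : tnth (nseq_tuple n (- c)) i = - c by rewrite (tnth_nth 0)/= nth_nseq ltn_ord.
by rewrite tnth_mktuple !e addKr (ltW h1).
Qed.

Lemma compact_support_integral (b u : Rn R n -> R) : loc_integrable b ->
  bounded_compact_support u -> (\int[mu]_x `|b x * u x|%:E < +oo)%E.
Proof.
move=> [mb bi] uc; have [Q cQ u0] := compact_support_cube uc.
have [mu_ [U uU] _] := uc.
have mQ : measurable Q by case: cQ => a [l _ ->]; exact: measurable_box.
have -> : (\int[mu]_x `|b x * u x|%:E = \int[mu]_(x in Q) `|b x * u x|%:E)%E.
  rewrite [RHS]integral_mkcond; apply: eq_integral => x _; rewrite patchE.
  by case: ifPn => // /negP xQ; rewrite u0 ?mulr0 ?normr0// => Qx; apply: xQ; exact: mem_set.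
have mbu : measurable_fun Q (fun x => b x * u x).
  by apply: measurable_funTS; exact: measurable_funM.
have := integrableZl mQ U (bi Q cQ) => Ub.
suff /integrableP[] : mu.-integrable Q (EFin \o (fun x => b x * u x)) by [].
apply: le_integrable Ub => //; first exact/measurable_EFinP.
move=> x _ /=; rewrite lee_fin !normrM mulrC ler_wpM2r//.
by rewrite (le_trans (uU x))// ler_norm.
Qed.
End compact_support.

Theorem theorem1p3 (R : realType) (n tau : nat) (p C0 : R)
    (hn : (1 <= n)%N) (htau : (1 <= tau)%N) (hp : 1 < p) :
  exists C : R,
    forall (T : (Rn R n -> R) -> Rn R n -> R) (b w : Rn R n -> R),
      haar_shift tau C0 T -> BMO b -> Ap p w ->
      (Lpw_opnorm p w (commutator b T) <=
         C%:E * Ap_char p w `^ (2 * Num.max 1 (p - 1)^-1)%R * BMO_norm b)%E.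
Proof.
(* The constant is chosen before the operator, so the sign of [C0] is unknown here; if [bconst] is
   negative no shift satisfies the size condition and the claim is vacuous. *)
have [B0|B0] := leP 0 (@bconst R n tau C0); last first.
  exists 0 => T b w [H [a [HH aC _]]].
  by have := bconst_ge0 aC; rewrite leNgt B0.
have c0 : 0 < (2 `^ p)^-1 :> R by rewrite invr_gt0 powR_gt0.
have p0 : 0 < p by rewrite (lt_trans _ hp).
have [K K0 KB] := commutator_tree_bound (@cidx_gt0 n tau.+1) hp c0 B0.
(* The outer factors come from the closure argument, the powers of [tau.+1] from the residue
   classes, and the middle [2^p] from [jensen_weight]. *)
pose X : R := 2 `^ p * (tau.+1%:R `^ p * tau.+1%:R * 2 `^ p) * (2 `^ p * 2).
have X0 : 0 <= X by rewrite /X; do !(apply: mulr_ge0 => //); exact: powR_ge0.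
exists (X `^ p^-1 * K) => T b w [H [a [HH aC TE]]] bB wA.
set D := fine (Ap_char p w); set beta := fine (BMO_norm b).
pose w' := wpos w.
have w'0 x : 0 < w' x by exact: wpos_gt0.
have ww : {ae lebesgue_Rn n, forall x, w x = w' x} by exact: wpos_ae wA.
have wi : dint w' by exact: dint_wpos wA.
have bloc := bB.1; have bi := dcube_loc_integrable bloc.
have beta0 : 0 <= beta := BMO_norm_ge0 bB.
pose Y := K * D `^ (2 * ap_exp p) * beta.
have Y0 : 0 <= Y by rewrite !mulr_ge0// powR_ge0.
pose A := tau.+1%:R `^ p * tau.+1%:R * (Y `^ p * 2 `^ p).
have A0 : 0 <= A by rewrite /A; do !(apply: mulr_ge0 => //); exact: powR_ge0.
(* The commutator is built from limits that exist almost everywhere, so a measurable version [h] is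
   substituted before passing to the closure. *)
have Sbound u : bounded_compact_support u -> exists h, [/\ measurable_fun setT h,
    {ae lebesgue_Rn n, forall x, commutator b T u x = h x} &
    (\int[lebesgue_Rn n]_x (`|h x| `^ p * w' x)%:E <=
     A%:E * \int[lebesgue_Rn n]_x (`|u x| `^ p * w' x)%:E)%E].
  move=> uc; have [mu_ [U uU] _] := uc.
  have ui : dint u by exact: bounded_dint uU.
  have bui : dint (fun x => b x * u x) := dintMbounded mu_ uU bi.
  have bL := compact_support_integral bloc uc.
  (* With the constant 1 as multiplier, [compact_support_integral] yields the integrability of [u]
     itself. *)
  have one_loc : loc_integrable (fun _ : Rn R n => 1 : R).
    split=> // Q [c [l l0 ->]]; apply: measurable_bounded_integrable => //.
    - exact: measurable_box.
    - by rewrite mu_cube ?ltry// ltW.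
    - by exists 1; split; rewrite ?num_real// => t t1 x _ /=; rewrite normr1 ltW.
  have uL : (\int[lebesgue_Rn n]_x `|u x|%:E < +oo)%E.
    have := compact_support_integral one_loc uc.
    by under eq_integral do rewrite mul1r.
  have [h1 mh1 e1] := ae_measurable_lim (fun N => measurable_partial_shift hn _ _ HH N ui)
    (partial_shift_cvg hn HH aC ui uL).
  have [h2 mh2 e2] := ae_measurable_lim (fun N => measurable_partial_shift hn _ _ HH N bui)
    (partial_shift_cvg hn HH aC bui bL).
  have e : {ae lebesgue_Rn n, forall x, commutator b T u x = b x * h1 x - h2 x}.
    apply: filterS2 e1 e2 => x E1 E2; rewrite /commutator !TE.
    by congr (_ * _ - _).
  exists (fun x => b x * h1 x - h2 x); split => //.
    by apply: measurable_funB => //; apply: measurable_funM => //; case: bi.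
  have := limit_bound hn HH aC hp w'0 (fun=> erefl) wi (dint_dual hp wA) (Ap_char_gt0 hp wA)
    (Ap_avR hp wA) bi (fun Q => bmo_dcube Q bB) KB mu_ uU uL bL.
  rewrite -/A; apply: le_trans.
  rewrite le_eqVlt; apply/orP; left; apply/eqP; apply: ae_eq_integralT.
  apply: filterS e => x <-.
  have TT : T = (fun f y => limn (@partial_shift R n tau H a f y)).
    by apply/funext => f; apply/funext => y; exact: TE.
  by rewrite -TT.
apply: ge_ereal_sup => _ [f [g [[mf mg [u [uc uf Sg]]] f1 ->]]].
have [h hP] := choice (fun k => Sbound _ (uc k)).
have ae_refl (F : Rn R n -> R) : {ae lebesgue_Rn n, forall x, F x = F x}.
  by apply: aeW.
have Nw F : Lpw_norm p w F = Lpw_norm p w' F by exact: ae_eq_Lpw_norm.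
have gB : (\int[lebesgue_Rn n]_x (`|g x| `^ p * w' x)%:E <= (2 `^ p * A * (2 `^ p * 2))%:E)%E.
  apply: (@Lpw_closure_bound R n p w' hp w'0 wi.1 A u h f g A0 mf mg).
  - by move=> k; case: (uc k).
  - by move=> k; case: (hP k).
  - by move=> k; case: (hP k).
  - by move: uf; under eq_fun do rewrite Nw.
  - have -> : (fun k => Lpw_norm p w' (fun x => h k x - g x)) =
        (fun k => Lpw_norm p w (fun x => commutator b T (u k) x - g x)).
      apply/funext => k; rewrite Nw; apply: ae_eq_Lpw_norm; first exact: ae_refl.
      by have [_ e _] := hP k; apply: filterS e => x ->.
    exact: Sg.
  - by rewrite -Nw.
rewrite Nw.
have -> : ((X `^ p^-1 * K)%:E * Ap_char p w `^ (2 * Num.max 1 (p - 1)^-1)%R * BMO_norm b =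
    ((2 `^ p * A * (2 `^ p * 2)) `^ p^-1)%:E)%E.
  rewrite (Ap_charE wA) (BMO_normE bB) poweR_EFin -!EFinM; congr EFin.
  have -> : 2 `^ p * A * (2 `^ p * 2) = X * Y `^ p by rewrite /A /X; ring.
  rewrite powRM ?powR_ge0// -powRrM mulfV ?gt_eqF// powRr1// /Y.
  by rewrite /D /beta /ap_exp !mulrA.
rewrite -poweR_EFin; apply: gt0_ler_poweR gB.
- by rewrite invr_ge0 ltW.
- rewrite in_itv/= leey andbT.
  by apply: integral_ge0 => x _; rewrite lee_fin mulr_ge0 ?powR_ge0// ltW.
- by rewrite in_itv/= leey andbT lee_fin; do !(apply: mulr_ge0 => //); exact: powR_ge0.
Qed.
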